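(* Let $k$ be a field and $n$ a positive integer. Let $R$ be a local noetherian $k$-algebra with maximal ideal $P$. Assume that the $P$-adic completion of $R$ is $\hat R = k[[x_1,\ldots,x_r]]$, the formal power series ring over $k$ in $r>0$ variables. Then the functor $\mathcal{H}ilb^n R$ is not representable in the category of noetherian $k$-schemes.
   Context: For a local noetherian $k$-algebra $R$ with maximal ideal $P$ and a noetherian $k$-scheme $T$, $\mathcal{H}ilb^n R(T)$ denotes the set of closed subschemes $Z\subseteq T\times_k \operatorname{Spec}(R)$ such that: the projection $Z\to T$ is flat; for every point $y\in T$ the global sections of the fiber $Z_y = Z\times_T\operatorname{Spec}(\kappa(y))$ form a $\kappa(y)$-vector space of dimension $n$; and $Z_{\mathrm{red}}\subseteq T\times_k\operatorname{Spec}(R/P)$. Here $Z_{\mathrm{red}}$ is the reduced scheme associated to $Z$ and $\kappa(y)$ is the residue field of $y$. The assignment $T\mapsto \mathcal{H}ilb^n R(T)$, with a morphism $U\to T$ acting by pull-back $Z\mapsto U\times_T Z$, is a contravariant functor from noetherian $k$-schemes to sets. *)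

(* Defs.v *)
From HB Require Import structures.
From mathcomp Require Import all_boot all_order all_algebra.
From mathcomp Require Import mpoly.
From mathcomp Require Import boolp classical_sets topology.
From mathcomp Require Import ring.

Set Implicit Arguments.
Unset Strict Implicit.
Unset Printing Implicit Defensive.
Import GRing.Theory.
Local Open Scope classical_set_scope.
Local Open Scope ring_scope.

(* Rings are [comPzRingType]s: the zero ring must be allowed, since it is the
   ring of sections over the empty set. *)

(* Representatives for the elements of a ring; localizations, stalks and residue
   rings are all obtained as quotients of a [ringoid]. *)
Record ringoid := Ringoid {
  rep :> Type;
  eqv : rep -> rep -> Prop;
  r0 : rep; r1 : rep;
  rN : rep -> rep; rD : rep -> rep -> rep; rM : rep -> rep -> rep;
  eqv_refl : forall x, eqv x x;
  eqv_sym : forall x y, eqv x y -> eqv y x;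
  eqv_trans : forall x y z, eqv x y -> eqv y z -> eqv x z;
  eqvN : forall x y, eqv x y -> eqv (rN x) (rN y);
  eqvD : forall x x' y y', eqv x x' -> eqv y y' -> eqv (rD x y) (rD x' y');
  eqvM : forall x x' y y', eqv x x' -> eqv y y' -> eqv (rM x y) (rM x' y');
  rDA : forall x y z, eqv (rD x (rD y z)) (rD (rD x y) z);
  rDC : forall x y, eqv (rD x y) (rD y x);
  r0D : forall x, eqv (rD r0 x) x;
  rND : forall x, eqv (rD (rN x) x) r0;
  rMA : forall x y z, eqv (rM x (rM y z)) (rM (rM x y) z);
  rMC : forall x y, eqv (rM x y) (rM y x);
  r1M : forall x, eqv (rM r1 x) x;
  rMD : forall x y z, eqv (rM (rD x y) z) (rD (rM x z) (rM y z)) }.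

Record quot (E : ringoid) : Type :=
  Quot { cls_set : set E; cls_setP : exists x, cls_set = eqv x }.

HB.instance Definition _ (E : ringoid) := gen_eqMixin (quot E).
HB.instance Definition _ (E : ringoid) := gen_choiceMixin (quot E).

Section Quot.
Variable E : ringoid.
Implicit Types (x y : E) (a b c : quot E).

Lemma quot_ext a b : cls_set a = cls_set b -> a = b.
Proof.
by case: a b => C hC [D hD] /= CD; case: D / CD hD => hD; congr Quot.
Qed.

Definition cls x : quot E := Quot (ex_intro _ x erefl).

Definition rp a : E := projT1 (cid (cls_setP a)).

Lemma cls_eq x y : eqv x y -> cls x = cls y.
Proof.
move=> xy; apply: quot_ext; apply/predeqP => z; split.
  by apply: eqv_trans; exact: eqv_sym.
by apply: eqv_trans.
Qed.

Lemma eq_cls x y : cls x = cls y -> eqv x y.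
Proof. by move=> /(congr1 (@cls_set E)) /= ->; exact: eqv_refl. Qed.

Lemma rpK a : cls (rp a) = a.
Proof. by apply: quot_ext; rewrite /rp; case: cid => x /=. Qed.

Lemma rp_cls x : eqv (rp (cls x)) x.
Proof. by apply: eq_cls; rewrite rpK. Qed.

Definition quot0 := cls (r0 E).
Definition quot1 := cls (r1 E).
Definition quotN a := cls (rN (rp a)).
Definition quotD a b := cls (rD (rp a) (rp b)).
Definition quotM a b := cls (rM (rp a) (rp b)).

Lemma quotNE x : quotN (cls x) = cls (rN x).
Proof. by apply: cls_eq; apply: eqvN; exact: rp_cls. Qed.
Lemma quotDE x y : quotD (cls x) (cls y) = cls (rD x y).
Proof. by apply: cls_eq; apply: eqvD; exact: rp_cls. Qed.
Lemma quotME x y : quotM (cls x) (cls y) = cls (rM x y).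
Proof. by apply: cls_eq; apply: eqvM; exact: rp_cls. Qed.

Lemma quot_ind (P : quot E -> Prop) : (forall x, P (cls x)) -> forall a, P a.
Proof. by move=> h a; rewrite -(rpK a). Qed.

Fact quotDA : associative quotD.
Proof.
by elim/quot_ind=> x; elim/quot_ind=> y; elim/quot_ind=> z;
  rewrite !quotDE; apply/cls_eq/rDA.
Qed.
Fact quotDC : commutative quotD.
Proof.
by elim/quot_ind=> x; elim/quot_ind=> y; rewrite !quotDE; apply/cls_eq/rDC.
Qed.
Fact quot0D : left_id quot0 quotD.
Proof. by elim/quot_ind=> x; rewrite quotDE; apply/cls_eq/r0D. Qed.
Fact quotND : left_inverse quot0 quotN quotD.
Proof. by elim/quot_ind=> x; rewrite quotNE quotDE; apply/cls_eq/rND. Qed.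
Fact quotMA : associative quotM.
Proof.
by elim/quot_ind=> x; elim/quot_ind=> y; elim/quot_ind=> z;
  rewrite !quotME; apply/cls_eq/rMA.
Qed.
Fact quotMC : commutative quotM.
Proof.
by elim/quot_ind=> x; elim/quot_ind=> y; rewrite !quotME; apply/cls_eq/rMC.
Qed.
Fact quot1M : left_id quot1 quotM.
Proof. by elim/quot_ind=> x; rewrite quotME; apply/cls_eq/r1M. Qed.
Fact quotMD : left_distributive quotM quotD.
Proof.
by elim/quot_ind=> x; elim/quot_ind=> y; elim/quot_ind=> z;
  rewrite !(quotDE, quotME); apply/cls_eq/rMD.
Qed.

HB.instance Definition _ :=
  GRing.isZmodule.Build (quot E) quotDA quotDC quot0D quotND.
HB.instance Definition _ :=
  GRing.Zmodule_isComPzRing.Build (quot E) quotMA quotMC quot1M quotMD.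

Lemma cls0 : cls (r0 E) = 0. Proof. by []. Qed.
Lemma cls1 : cls (r1 E) = 1. Proof. by []. Qed.
Lemma clsN x : cls (rN x) = - cls x. Proof. by rewrite -quotNE. Qed.
Lemma clsD x y : cls (rD x y) = cls x + cls y. Proof. by rewrite -quotDE. Qed.
Lemma clsM x y : cls (rM x y) = cls x * cls y. Proof. by rewrite -quotME. Qed.

Section Lift.
Variables (S : comPzRingType) (f : E -> S).
Hypothesis f_eqv : forall x y, eqv x y -> f x = f y.
Hypothesis fD : forall x y, f (rD x y) = f x + f y.
Hypothesis f1 : f (r1 E) = 1.
Hypothesis fM : forall x y, f (rM x y) = f x * f y.

Definition lift_fun a := f (rp a).

Lemma lift_funE x : lift_fun (cls x) = f x.
Proof. by apply: f_eqv; exact: rp_cls. Qed.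

Fact lift_nmod : {morph lift_fun : x y / x + y} .
Proof.
by elim/quot_ind=> x; elim/quot_ind=> y; rewrite -clsD !lift_funE fD.
Qed.

Fact lift_monoid : monoid_morphism lift_fun.
Proof.
split; first by rewrite -cls1 lift_funE.
by elim/quot_ind=> x; elim/quot_ind=> y; rewrite -clsM !lift_funE fM.
Qed.

Fact lift_zmod : zmod_morphism lift_fun.
Proof.
move=> a b; apply: (addIr (lift_fun b)).
by rewrite -lift_nmod !subrK.
Qed.

HB.instance Definition _ :=
  GRing.isZmodMorphism.Build (quot E) S lift_fun lift_zmod.
HB.instance Definition _ :=
  GRing.isMonoidMorphism.Build (quot E) S lift_fun lift_monoid.

Definition qlift : {rmorphism quot E -> S} := lift_fun.

Lemma qliftE x : qlift (cls x) = f x. Proof. exact: lift_funE. Qed.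

End Lift.
End Quot.

Section MkMorph.
Variables (A B : comPzRingType) (f : A -> B).
Hypotheses (fD : forall x y, f (x + y) = f x + f y) (f1 : f 1 = 1)
  (fM : forall x y, f (x * y) = f x * f y).
Definition mk_fun of (forall x y, f (x + y) = f x + f y) & f 1 = 1 &
  (forall x y, f (x * y) = f x * f y) := f.
Fact mk_zmod : zmod_morphism (mk_fun fD f1 fM).
Proof. by move=> a b; apply: (addIr (f b)); rewrite /mk_fun -fD !subrK. Qed.
Fact mk_monoid : monoid_morphism (mk_fun fD f1 fM).
Proof. by split. Qed.
HB.instance Definition _ :=
  GRing.isZmodMorphism.Build A B (mk_fun fD f1 fM) mk_zmod.
HB.instance Definition _ :=
  GRing.isMonoidMorphism.Build A B (mk_fun fD f1 fM) mk_monoid.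
Definition mk_rmorphism : {rmorphism A -> B} := mk_fun fD f1 fM.
End MkMorph.

Record subprod (I : Type) (F : I -> comPzRingType) := Subprod {
  sp_set : set (forall i, F i);
  sp1 : sp_set (fun _ => 1);
  spB : forall s t, sp_set s -> sp_set t -> sp_set (fun i => s i - t i);
  spM : forall s t, sp_set s -> sp_set t -> sp_set (fun i => s i * t i) }.

Record sp_type I F (D : @subprod I F) : Type :=
  Sp { sp_fun :> forall i, F i; sp_funP : sp_set D sp_fun }.

Section Subprod.
Variables (I : Type) (F : I -> comPzRingType) (D : subprod F).

HB.instance Definition _ := gen_eqMixin (sp_type D).
HB.instance Definition _ := gen_choiceMixin (sp_type D).

Implicit Types s t u : sp_type D.

Lemma sp_ext s t : (forall i, s i = t i) -> s = t.
Proof.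
case: s t => s hs [t ht] /= st.
have {}st : s = t by exact: functional_extensionality_dep.
by case: t / st ht => ht; congr Sp.
Qed.

Fact sp_set0   : sp_set D (fun _ => 0).
Proof.
have := spB (sp1 D) (sp1 D).
by under [X in sp_set D X -> _]functional_extensionality_dep do rewrite subrr.
Qed.
Fact sp_setN s   : sp_set D (fun i => - s i).
Proof.
have := spB sp_set0 (sp_funP s).
by under [X in sp_set D X -> _]functional_extensionality_dep do rewrite sub0r.
Qed.
Fact sp_setD s t   : sp_set D (fun i => s i + t i).
Proof.
have := spB (sp_funP s) (sp_setN t).
by under [X in sp_set D X -> _]functional_extensionality_dep do rewrite opprK.
Qed.

Definition sp_0 : sp_type D := Sp sp_set0.
Definition sp_1 : sp_type D := Sp (sp1 D).
Definition sp_N s : sp_type D := Sp (sp_setN s).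
Definition sp_D s t : sp_type D := Sp (sp_setD s t).
Definition sp_M s t : sp_type D :=
  Sp (spM (sp_funP s) (sp_funP t)).

Fact sp_DA : associative sp_D.
Proof. by move=> s t u; apply: sp_ext => i; exact: addrA. Qed.
Fact sp_DC : commutative sp_D.
Proof. by move=> s t; apply: sp_ext => i; exact: addrC. Qed.
Fact sp_0D : left_id sp_0 sp_D.
Proof. by move=> s; apply: sp_ext => i; exact: add0r. Qed.
Fact sp_ND : left_inverse sp_0 sp_N sp_D.
Proof. by move=> s; apply: sp_ext => i; exact: addNr. Qed.
Fact sp_MA : associative sp_M.
Proof. by move=> s t u; apply: sp_ext => i; exact: mulrA. Qed.
Fact sp_MC : commutative sp_M.
Proof. by move=> s t; apply: sp_ext => i; exact: mulrC. Qed.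
Fact sp_1M : left_id sp_1 sp_M.
Proof. by move=> s; apply: sp_ext => i; exact: mul1r. Qed.
Fact sp_MD : left_distributive sp_M sp_D.
Proof. by move=> s t u; apply: sp_ext => i; exact: mulrDl. Qed.

HB.instance Definition _ :=
  GRing.isZmodule.Build (sp_type D) sp_DA sp_DC sp_0D sp_ND.
HB.instance Definition _ :=
  GRing.Zmodule_isComPzRing.Build (sp_type D) sp_MA sp_MC sp_1M sp_MD.

End Subprod.

Definition is_unit (A : comPzRingType) (a : A) := exists b, a * b = 1.

Record ideal (A : comPzRingType) (I : set A) : Prop := {
  ideal0 : I 0;
  idealD : forall a b, I a -> I b -> I (a + b);
  idealM : forall a b, I b -> I (a * b) }.

Record prime_ideal (A : comPzRingType) (p : set A) : Prop := {
  prime_is_ideal :> ideal p;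
  prime_n1 : ~ p 1;
  primeM : forall a b, p (a * b) -> p a \/ p b }.

Definition maximal_ideal (A : comPzRingType) (m : set A) :=
  [/\ ideal m, ~ m 1 & forall I, ideal I -> ~ I 1 -> m `<=` I -> I = m].

Definition local_with (A : comPzRingType) (m : set A) :=
  maximal_ideal m /\ forall m', maximal_ideal m' -> m' = m.

Definition local_ring (A : comPzRingType) := exists m : set A, local_with m.

Definition ideal_gen (A : comPzRingType) (S : set A) : set A :=
  fun a => forall I, ideal I -> S `<=` I -> I a.

Definition noetherian (A : comPzRingType) :=
  forall I : set A, ideal I -> exists s : seq A, I = ideal_gen [set` s].

Definition ideal_pow (A : comPzRingType) (I : set A) (m : nat) : set A :=
  ideal_gen [set a | exists f : 'I_m -> A,
                       (forall i, I (f i)) /\ a = \prod_(i < m) f i].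

Lemma ideal_genP (A : comPzRingType) (S : set A) : ideal (ideal_gen S).
Proof.
split=> [I [] //|a b Sa Sb I II SI|a b Sb I II SI].
  by apply: (idealD II); [exact: Sa|exact: Sb].
by apply: (idealM II); exact: Sb.
Qed.

Lemma ideal_powP (A : comPzRingType) (I : set A) m : ideal (ideal_pow I m).
Proof. exact: ideal_genP. Qed.

Section IdealTheory.
Variable A : comPzRingType.
Implicit Types (I m : set A) (a b : A).

Lemma idealN I a : ideal I -> I a -> I (- a).
Proof. by move=> II Ia; rewrite -mulN1r; exact: (idealM II). Qed.
Lemma idealB I a b : ideal I -> I a -> I b -> I (a - b).
Proof. by move=> II Ia Ib; apply: (idealD II) => //; exact: idealN. Qed.
End IdealTheory.

Section QuotientRing.
Variables (A : comPzRingType) (I : set A) (idI : ideal I).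

Definition modI_ringoid : ringoid.
Proof.
refine (@Ringoid A (fun a b => I (a - b)) 0 1 -%R +%R *%R
  _ _ _ _ _ _ _ _ _ _ _ _ _ _) => /=.
- by move=> x; rewrite subrr; exact: (ideal0 idI).
- by move=> x y h; rewrite -opprB; exact: idealN.
- by move=> x y z h h'; rewrite -(subrKA y); exact: (idealD idI).
- by move=> x y h; rewrite -opprD; exact: idealN.
- by move=> x x' y y' h h'; rewrite opprD addrACA; exact: (idealD idI).
- move=> x x' y y' h h'.
  have -> : x * y - x' * y' = y * (x - x') + x' * (y - y') by ring.
  by apply: (idealD idI); exact: (idealM idI).
- by move=> x y z; rewrite addrA subrr; exact: (ideal0 idI).
- by move=> x y; rewrite [y + x]addrC subrr; exact: (ideal0 idI).
- by move=> x; rewrite add0r subrr; exact: (ideal0 idI).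
- by move=> x; rewrite addNr subrr; exact: (ideal0 idI).
- by move=> x y z; rewrite mulrA subrr; exact: (ideal0 idI).
- by move=> x y; rewrite [y * x]mulrC subrr; exact: (ideal0 idI).
- by move=> x; rewrite mul1r subrr; exact: (ideal0 idI).
- by move=> x y z; rewrite mulrDl subrr; exact: (ideal0 idI).
Defined.

Definition modI : comPzRingType := quot modI_ringoid.

Definition modI_pi : {rmorphism A -> modI} :=
  @mk_rmorphism A modI (@cls modI_ringoid)
    (@clsD modI_ringoid) (@cls1 modI_ringoid) (@clsM modI_ringoid).

Lemma modI_pi_eq a b : modI_pi a = modI_pi b <-> I (a - b).
Proof. by split=> [/eq_cls|h] //; exact: (@cls_eq modI_ringoid). Qed.

End QuotientRing.

Section Completion.
Variables (A : comPzRingType) (I : set A).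

Definition compatible : set (forall m, modI (ideal_powP I m)) :=
  [set u | forall m, exists a, modI_pi (ideal_powP I m) a = u m
             /\ modI_pi (ideal_powP I m.+1) a = u m.+1].

Definition completion_subprod : subprod (fun m => modI (ideal_powP I m)).
Proof.
refine (@Subprod _ _ compatible _ _ _) => [m|u v cu cv m|u v cu cv m].
- by exists 1; rewrite !rmorph1.
- have [a [<- <-]] := cu m; have [b [<- <-]] := cv m.
  by exists (a - b); rewrite !rmorphB.
- have [a [<- <-]] := cu m; have [b [<- <-]] := cv m.
  by exists (a * b); rewrite !rmorphM.
Defined.

Definition completion : comPzRingType := sp_type completion_subprod.

Fact completion_diag a : compatible (fun m => modI_pi (ideal_powP I m) a).
Proof. by move=> m; exists a. Qed.

Definition to_completion : {rmorphism A -> completion}.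
Proof.
refine (@mk_rmorphism A completion
  (fun a => @Sp _ _ completion_subprod _ (completion_diag a)) _ _ _).
- by move=> a b; apply: sp_ext => m; exact: rmorphD.
- by apply: sp_ext => m; exact: rmorph1.
- by move=> a b; apply: sp_ext => m; exact: rmorphM.
Defined.

End Completion.

Section PowerSeries.
Variables (k : fieldType) (r : nat).
(* f m is the coefficient of the monomial with exponent vector m *)
Record powser := PowSer { coefps : 'X_{1..r} -> k }.

HB.instance Definition _ := gen_eqMixin powser.
HB.instance Definition _ := gen_choiceMixin powser.

Implicit Types f g h : powser.

Lemma powser_ext f g : (forall m, coefps f m = coefps g m) -> f = g.
Proof. by case: f g => f [g] /= fg; congr PowSer; exact: funext. Qed.

Definition ps0 := PowSer (fun _ => 0).
Definition psN f := PowSer (fun m => - coefps f m).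
Definition psD f g := PowSer (fun m => coefps f m + coefps g m).

Definition psC (c : k) :=
  PowSer (fun m => if m == 0%MM then c else 0).

(* Cauchy product: p.1 and p.2 range over the (finitely many) monomials of
   degree at most that of m, subject to p.1 * p.2 = m. *)
Definition psM f g := PowSer (fun m =>
  \sum_(p : 'X_{1..r < (mdeg m).+1, (mdeg m).+1} | m == (p.1 + p.2)%MM)
    coefps f p.1 * coefps g p.2).

Fact psDA : associative psD.
Proof. by move=> f g h; apply: powser_ext => m; exact: addrA. Qed.
Fact psDC : commutative psD.
Proof. by move=> f g; apply: powser_ext => m; exact: addrC. Qed.
Fact ps0D : left_id ps0 psD.
Proof. by move=> f; apply: powser_ext => m; exact: add0r. Qed.
Fact psND : left_inverse ps0 psN psD.
Proof. by move=> f; apply: powser_ext => m; exact: addNr. Qed.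

HB.instance Definition _ := GRing.isZmodule.Build powser psDA psDC ps0D psND.

(* The ring axioms are checked on polynomial truncations. *)
Definition pstrunc d f : {mpoly k[r]} :=
  \sum_(m : 'X_{1..r < d}) coefps f m *: 'X_[m].

Lemma pstruncE d f m : (mdeg m < d)%N -> (pstrunc d f)@_m = coefps f m.
Proof.
move=> md; rewrite /pstrunc raddf_sum /= (bigD1 (BMultinom md)) //=.
rewrite mcoeffZ mcoeffX eqxx mulr1 big1 ?addr0 // => m' /negPf m'm.
rewrite mcoeffZ mcoeffX; case: eqP => [e|]; last by rewrite mulr0.
by move: m'm; rewrite -val_eqE /= e eqxx.
Qed.

Lemma psM_trunc d f g m : (mdeg m < d)%N ->
  coefps (psM f g) m = (pstrunc d f * pstrunc d g)@_m.
Proof.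
move=> md; rewrite mcoeffM /=; apply: eq_bigr => p /eqP mp.
have h : mdeg m = (mdeg p.1 + mdeg p.2)%N by rewrite -mdegD -mp.
rewrite !pstruncE //; apply: leq_ltn_trans md.
  by apply: (@leq_trans (mdeg p.1 + mdeg p.2)); rewrite ?leq_addl // -h.
by apply: (@leq_trans (mdeg p.1 + mdeg p.2)); rewrite ?leq_addr // -h.
Qed.

Lemma pstrunc_eq d f p m : (forall m', (mdeg m' <= mdeg m)%N ->
    (pstrunc d f)@_m' = p@_m') ->
  forall q, (pstrunc d f * q)@_m = (p * q)@_m.
Proof.
move=> fp q; rewrite !mcoeffM; apply: eq_bigr => x /eqP mx.
have h : mdeg m = (mdeg x.1 + mdeg x.2)%N by rewrite -mdegD -mx.
rewrite fp //.
by apply: (@leq_trans (mdeg x.1 + mdeg x.2)); rewrite ?leq_addr // -h.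
Qed.

Fact psMC : commutative psM.
Proof.
move=> f g; apply: powser_ext => m.
by rewrite !(psM_trunc _ _ (ltnSn _)) mulrC.
Qed.

Lemma psM3 f g h m : let d := (mdeg m).+1 in
  coefps (psM (psM f g) h) m = (pstrunc d f * pstrunc d g * pstrunc d h)@_m.
Proof.
move=> d; rewrite (psM_trunc _ _ (ltnSn _)); apply: pstrunc_eq => m' m'm.
by rewrite pstruncE ?ltnS // (@psM_trunc d) ?ltnS.
Qed.

Fact psMA : associative psM.
Proof.
move=> f g h; apply: powser_ext => m.
rewrite psMC !psM3; congr (_ @_m); ring.
Qed.

Fact ps1M : left_id (psC 1) psM.
Proof.
move=> f; apply: powser_ext => m.
rewrite (psM_trunc _ _ (ltnSn _)) (@pstrunc_eq _ _ 1) => [|m' m'm].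
  by rewrite mul1r pstruncE.
by rewrite pstruncE ?ltnS // mcoeff1 /=; case: eqP.
Qed.

Fact psMD : left_distributive psM psD.
Proof.
move=> f g h; apply: powser_ext => m /=; rewrite -big_split /=.
by apply: eq_bigr => p _; rewrite mulrDl.
Qed.

HB.instance Definition _ :=
  GRing.Zmodule_isComPzRing.Build powser psMA psMC ps1M psMD.

End PowerSeries.

Section Localization.
Variables (A : comPzRingType) (p : set A) (pp : prime_ideal p).

Record frac := Frac { fnum : A; fden : A; fdenP : ~ p fden }.
Arguments fdenP : clear implicits.

Definition frac_eqv (x y : frac) :=
  exists u, ~ p u /\ u * (fnum x * fden y) = u * (fnum y * fden x).

Lemma primeMn a b : ~ p a -> ~ p b -> ~ p (a * b).
Proof. by move=> pa pb /(primeM pp) []. Qed.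

Lemma frac_eqv_eq x y : fnum x * fden y = fnum y * fden x -> frac_eqv x y.
Proof. by move=> e; exists 1; split; [exact: (prime_n1 pp)|rewrite e]. Qed.

Definition loc_ringoid : ringoid.
Proof.
refine (@Ringoid frac frac_eqv
  (Frac 0 (prime_n1 pp)) (Frac 1 (prime_n1 pp))
  (fun x => Frac (- fnum x) (fdenP x))
  (fun x y => Frac (fnum x * fden y + fnum y * fden x)
                   (primeMn (fdenP x) (fdenP y)))
  (fun x y => Frac (fnum x * fnum y) (primeMn (fdenP x) (fdenP y)))
  _ _ _ _ _ _ _ _ _ _ _ _ _ _).
- by move=> x; exact: frac_eqv_eq.
- by move=> x y [u [pu e]]; exists u.
- move=> x y z [u [pu e]] [v [pv e']]; exists (u * v * fden y); split.
    by apply: primeMn (fdenP y); exact: primeMn.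
  have -> : u * v * fden y * (fnum x * fden z) =
            v * fden z * (u * (fnum x * fden y)) by ring.
  have -> : u * v * fden y * (fnum z * fden x) =
            u * fden x * (v * (fnum z * fden y)) by ring.
  by rewrite e -e'; ring.
- by move=> x y [u [pu e]]; exists u; split=> //=; rewrite !mulNr !mulrN e.
- move=> x x' y y' [u [pu e]] [v [pv e']]; exists (u * v).
  split; first exact: primeMn.
  move=> /=.
  have -> : u * v * ((fnum x * fden y + fnum y * fden x) * (fden x' * fden y')) =
    v * fden y * fden y' * (u * (fnum x * fden x')) +
    u * fden x * fden x' * (v * (fnum y * fden y')) by ring.
  by rewrite e e'; ring.
- move=> x x' y y' [u [pu e]] [v [pv e']]; exists (u * v).
  split; first exact: primeMn.
  move=> /=.
  have -> : u * v * (fnum x * fnum y * (fden x' * fden y')) =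
    (u * (fnum x * fden x')) * (v * (fnum y * fden y')) by ring.
  by rewrite e e'; ring.
- by move=> x y z; apply: frac_eqv_eq => /=; ring.
- by move=> x y; apply: frac_eqv_eq => /=; ring.
- by move=> x; apply: frac_eqv_eq => /=; ring.
- by move=> x; apply: frac_eqv_eq => /=; ring.
- by move=> x y z; apply: frac_eqv_eq => /=; ring.
- by move=> x y; apply: frac_eqv_eq => /=; ring.
- by move=> x; apply: frac_eqv_eq => /=; ring.
- by move=> x y z; apply: frac_eqv_eq => /=; ring.
Defined.

Definition loc : comPzRingType := quot loc_ringoid.

Definition mkfrac (a f : A) (pf : ~ p f) : loc := @cls loc_ringoid (Frac a pf).

Lemma mkfrac_irr a f (pf pf' : ~ p f) : mkfrac a pf = mkfrac a pf'.
Proof. by apply: (@cls_eq loc_ringoid); exact: frac_eqv_eq. Qed.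

Lemma mkfrac0 : mkfrac 0 (prime_n1 pp) = 0. Proof. by []. Qed.
Lemma mkfrac1 : mkfrac 1 (prime_n1 pp) = 1. Proof. by []. Qed.
Lemma mkfracN a f (pf : ~ p f) : mkfrac (- a) pf = - mkfrac a pf.
Proof. exact: (@clsN loc_ringoid (Frac a pf)). Qed.
Lemma mkfracD a b f g (pf : ~ p f) (pg : ~ p g) :
  mkfrac a pf + mkfrac b pg = mkfrac (a * g + b * f) (primeMn pf pg).
Proof. by rewrite /mkfrac -(@clsD loc_ringoid). Qed.
Lemma mkfracM a b f g (pf : ~ p f) (pg : ~ p g) :
  mkfrac a pf * mkfrac b pg = mkfrac (a * b) (primeMn pf pg).
Proof. by rewrite /mkfrac -(@clsM loc_ringoid). Qed.

Definition to_loc : {rmorphism A -> loc}.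
Proof.
refine (@mk_rmorphism A loc (fun a => mkfrac a (prime_n1 pp)) _ _ _) => //.
- move=> a b; rewrite mkfracD !mulr1; apply: (@cls_eq loc_ringoid).
  by apply: frac_eqv_eq => /=; ring.
- move=> a b; rewrite mkfracM; apply: (@cls_eq loc_ringoid).
  by apply: frac_eqv_eq => /=; ring.
Defined.

End Localization.
Arguments fdenP {A p} f _.

Section LocMap.
Variables (A B : comPzRingType) (phi : {rmorphism A -> B}).

Lemma ideal_preim (J : set B) : ideal J -> ideal (phi @^-1` J).
Proof.
move=> idJ; split=> /= [|a b|a b]; first by rewrite rmorph0; exact: (ideal0 idJ).
- by rewrite rmorphD; exact: (idealD idJ).
- by rewrite rmorphM; exact: (idealM idJ).
Qed.

Variables (q : set B) (pq : prime_ideal q).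

Lemma prime_preim : prime_ideal (phi @^-1` q).
Proof.
split=> [|/=|a b /=]; last 2 first.
- by rewrite rmorph1; exact: (prime_n1 pq).
- by rewrite rmorphM; exact: primeM.
exact: (ideal_preim pq).
Qed.

Definition loc_map : {rmorphism loc prime_preim -> loc pq}.
Proof.
refine (@qlift (loc_ringoid prime_preim) (loc pq)
  (fun x => mkfrac pq (phi (fnum x)) (fdenP x : ~ q (phi (fden x)))) _ _ _ _).
- move=> x y [u [qu e]]; apply: (@cls_eq (loc_ringoid pq)).
  by exists (phi u); split=> //=; rewrite -!rmorphM e.
- move=> x y; rewrite mkfracD; apply: (@cls_eq (loc_ringoid pq)).
  by apply: frac_eqv_eq => //=; rewrite rmorphD !rmorphM.
- apply: (@cls_eq (loc_ringoid pq)); apply: frac_eqv_eq => //=.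
  by rewrite !rmorph1.
- move=> x y; rewrite mkfracM; apply: (@cls_eq (loc_ringoid pq)).
  by apply: frac_eqv_eq => //=; rewrite !rmorphM.
Defined.

Lemma loc_map_frac a f (pf : ~ q (phi f)) :
  loc_map (@mkfrac _ _ prime_preim a f pf) = mkfrac pq (phi a) pf.
Proof. exact: qliftE. Qed.

End LocMap.

Record opens (X : topologicalType) := Opens {
  oset :> set X;
  oset_open : open oset }.

Definition ofull (X : topologicalType) : opens X := Opens openT.

Definition omeet (X : topologicalType) (U V : opens X) : opens X :=
  Opens (openI (oset_open U) (oset_open V)).

Lemma omeetl (X : topologicalType) (U V : opens X) : omeet U V `<=` U.
Proof. by move=> x []. Qed.

Lemma omeetr (X : topologicalType) (U V : opens X) : omeet U V `<=` V.
Proof. by move=> x []. Qed.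

Definition opre (X Y : topologicalType) (f : X -> Y) (cf : continuous f)
    (U : opens Y) : opens X :=
  Opens ((continuousP _).1 cf U (oset_open U)).

Lemma opre_sub (X Y : topologicalType) (f : X -> Y) (cf : continuous f)
  (U V : opens Y) : V `<=` U -> opre cf V `<=` opre cf U.
Proof. by move=> VU x; exact: VU. Qed.
Arguments opre_sub {X Y f} cf {U V} _.

Record ringed_space := RingedSpace {
  rs_top :> topologicalType;
  sec : opens rs_top -> comPzRingType;
  res : forall U V : opens rs_top, V `<=` U -> {rmorphism sec U -> sec V};
  res_id : forall (U : opens rs_top) (h : U `<=` U) s, res h s = s;
  res_res : forall (U V W : opens rs_top) (VU : V `<=` U) (WV : W `<=` V)
    (WU : W `<=` U) s, res WV (res VU s) = res WU s;
  sec_sep : forall (I : Type) (U : opens rs_top) (V : I -> opens rs_top)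
    (VU : forall i, V i `<=` U), U `<=` \bigcup_i V i ->
    forall s t, (forall i, res (VU i) s = res (VU i) t) -> s = t;
  sec_glue : forall (I : Type) (U : opens rs_top) (V : I -> opens rs_top)
    (VU : forall i, V i `<=` U), U `<=` \bigcup_i V i ->
    forall s : (forall i, sec (V i)),
    (forall i j (W : opens rs_top) (Wi : W `<=` V i) (Wj : W `<=` V j),
        res Wi (s i) = res Wj (s j)) ->
    exists t, forall i, res (VU i) t = s i }.

Lemma resT (X : ringed_space) (U V W : opens X) (VU : V `<=` U)
  (WV : W `<=` V) s : res WV (res VU s) = res (subset_trans WV VU) s.
Proof. exact: res_res. Qed.

Lemma res_irr (X : ringed_space) (U V : opens X) (h h' : V `<=` U) s :
  res h s = res h' s.
Proof. by rewrite (Prop_irrelevance h h'). Qed.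

Section Stalk.
Variables (X : ringed_space) (x : X).

Record germ_rep := GermRep {
  g_dom : opens X; g_in : oset g_dom x; g_sec : sec g_dom }.

Definition germ_eqv (g h : germ_rep) :=
  exists (W : opens X) (Wg : W `<=` g_dom g) (Wh : W `<=` g_dom h),
    oset W x /\ res Wg (g_sec g) = res Wh (g_sec h).

Definition germ_op1 (op : forall U : opens X, sec U -> sec U) (g : germ_rep) :=
  GermRep (g_in g) (op _ (g_sec g)).

Definition germ_op2 (op : forall U : opens X, sec U -> sec U -> sec U)
    (g h : germ_rep) :=
  @GermRep (omeet (g_dom g) (g_dom h)) (conj (g_in g) (g_in h))
    (op _ (res (@omeetl _ _ _) (g_sec g)) (res (@omeetr _ _ _) (g_sec h))).

Lemma germ_eqvI (g h : germ_rep) :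
  (forall (W : opens X) (Wg : W `<=` g_dom g) (Wh : W `<=` g_dom h),
     res Wg (g_sec g) = res Wh (g_sec h)) -> germ_eqv g h.
Proof.
move=> e; exists (omeet (g_dom g) (g_dom h)), (@omeetl _ _ _), (@omeetr _ _ _).
by split=> //; split; exact: g_in.
Qed.

Lemma germ_op1_eqv (op : forall U : opens X, sec U -> sec U) g h :
  (forall (U V : opens X) (VU : V `<=` U) s, res VU (op _ s) = op _ (res VU s)) ->
  germ_eqv g h -> germ_eqv (germ_op1 op g) (germ_op1 op h).
Proof.
move=> opr [W [Wg [Wh [Wx e]]]]; exists W, Wg, Wh; split=> //=.
by rewrite !opr e.
Qed.

Lemma germ_op2_eqv (op : forall U : opens X, sec U -> sec U -> sec U) g g' h h' :
  (forall (U V : opens X) (VU : V `<=` U) s t,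
     res VU (op _ s t) = op _ (res VU s) (res VU t)) ->
  germ_eqv g g' -> germ_eqv h h' ->
  germ_eqv (germ_op2 op g h) (germ_op2 op g' h').
Proof.
move=> opr [W [Wg [Wg' [Wx e]]]] [W' [Wh [Wh' [Wx' e']]]].
exists (omeet W W').
exists (setISS Wg Wh), (setISS Wg' Wh'); split=> //=.
rewrite !opr !resT; congr op.
- transitivity (res (@omeetl _ W W') (res Wg (g_sec g))); first exact/esym/res_res.
  by rewrite e; exact: res_res.
- transitivity (res (@omeetr _ W W') (res Wh (g_sec h))); first exact/esym/res_res.
  by rewrite e'; exact: res_res.
Qed.

Definition stalk_ringoid : ringoid.
Proof.
refine (@Ringoid germ_rep germ_eqv
  (@GermRep (ofull X) I 0) (@GermRep (ofull X) I 1)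
  (germ_op1 (fun U s => - s))
  (germ_op2 (fun U s t => s + t)) (germ_op2 (fun U s t => s * t))
  _ _ _ _ _ _ _ _ _ _ _ _ _ _).
- by move=> g; apply: germ_eqvI => W p q; exact: res_irr.
- by move=> g h [W [Wg [Wh [Wx e]]]]; exists W, Wh, Wg.
- move=> g h l [W [Wg [Wh [Wx e]]]] [W' [Wh' [Wl [Wx' e']]]].
  exists (omeet W W'), (subset_trans (@omeetl _ _ _) Wg),
    (subset_trans (@omeetr _ _ _) Wl); split=> //.
  transitivity (res (@omeetl _ W W') (res Wg (g_sec g))); first exact/esym/res_res.
  rewrite e resT; transitivity (res (@omeetr _ W W') (res Wl (g_sec l))).
    by rewrite -e' resT; exact: res_irr.
  exact: res_res.
- by move=> g h; apply: germ_op1_eqv => *; exact: rmorphN.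
- by move=> g g' h h'; apply: germ_op2_eqv => *; exact: rmorphD.
- by move=> g g' h h'; apply: germ_op2_eqv => *; exact: rmorphM.
- move=> g h l; apply: germ_eqvI => W p q /=.
  by rewrite !rmorphD !resT addrA; congr (_ + _ + _); exact: res_irr.
- move=> g h; apply: germ_eqvI => W p q /=.
  by rewrite !rmorphD !resT addrC; congr (_ + _); exact: res_irr.
- move=> g; apply: germ_eqvI => W p q /=.
  by rewrite rmorphD rmorph0 rmorph0 add0r resT; exact: res_irr.
- move=> g; apply: germ_eqvI => W p q /=.
  rewrite rmorphD !rmorphN !rmorph0 !resT; apply/eqP; rewrite addrC subr_eq0.
  by apply/eqP; exact: res_irr.
- move=> g h l; apply: germ_eqvI => W p q /=.
  by rewrite !rmorphM !resT mulrA; congr (_ * _ * _); exact: res_irr.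
- move=> g h; apply: germ_eqvI => W p q /=.
  by rewrite !rmorphM !resT mulrC; congr (_ * _); exact: res_irr.
- move=> g; apply: germ_eqvI => W p q /=.
  by rewrite rmorphM !rmorph1 mul1r resT; exact: res_irr.
- move=> g h l; apply: germ_eqvI => W p q /=.
  rewrite !(rmorphM, rmorphD) !resT mulrDl.
  by congr (_ * _ + _ * _); exact: res_irr.
Defined.

Definition stalk : comPzRingType := quot stalk_ringoid.

Definition mkgerm (U : opens X) (Ux : oset U x) (s : sec U) : stalk :=
  @cls stalk_ringoid (GermRep Ux s).

Lemma stalk_ind (P : stalk -> Prop) :
  (forall U (Ux : oset U x) s, P (mkgerm Ux s)) -> forall a, P a.
Proof. by move=> h; elim/quot_ind => -[U Ux s]; exact: h. Qed.

Lemma mkgerm_eq U V (Ux : oset U x) (Vx : oset V x) s t (W : opens X)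
    (WU : W `<=` U) (WV : W `<=` V) : oset W x -> res WU s = res WV t ->
  mkgerm Ux s = mkgerm Vx t.
Proof. by move=> Wx e; apply: (@cls_eq stalk_ringoid); exists W, WU, WV. Qed.

Lemma eq_mkgerm U V (Ux : oset U x) (Vx : oset V x) s t :
  mkgerm Ux s = mkgerm Vx t -> exists (W : opens X) (WU : W `<=` U)
    (WV : W `<=` V), oset W x /\ res WU s = res WV t.
Proof. by move=> /(@eq_cls stalk_ringoid). Qed.

Lemma mkgerm_irr U (Ux Ux' : oset U x) s : mkgerm Ux s = mkgerm Ux' s.
Proof.
exact: (@mkgerm_eq _ _ _ _ _ _ U (@subset_refl _ _) (@subset_refl _ _)).
Qed.

Lemma mkgerm_res U V (Ux : oset U x) (Vx : oset V x) (VU : V `<=` U) s :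
  mkgerm Vx (res VU s) = mkgerm Ux s.
Proof.
by apply: (@mkgerm_eq _ _ _ _ _ _ V (@subset_refl _ _) VU) => //; rewrite res_id.
Qed.

Definition germ (U : opens X) (Ux : oset U x) : {rmorphism sec U -> stalk}.
Proof.
refine (@mk_rmorphism (sec U) stalk (mkgerm Ux) _ _ _).
- move=> s t; rewrite /mkgerm -(@clsD stalk_ringoid).
  apply: (@cls_eq stalk_ringoid); apply: germ_eqvI => W p q /=.
  by rewrite !rmorphD !resT; congr (_ + _); exact: res_irr.
- by apply: (@cls_eq stalk_ringoid); apply: germ_eqvI => W p q /=; rewrite !rmorph1.
- move=> s t; rewrite /mkgerm -(@clsM stalk_ringoid).
  apply: (@cls_eq stalk_ringoid); apply: germ_eqvI => W p q /=.
  by rewrite !rmorphM !resT; congr (_ * _); exact: res_irr.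
Defined.

Lemma germE U (Ux : oset U x) s : germ Ux s = mkgerm Ux s.
Proof. by []. Qed.

End Stalk.

Record locally_ringed_space := LocallyRingedSpace {
  lrs_rs :> ringed_space;
  lrs_local : forall x : lrs_rs, local_ring (stalk x) }.

Record rs_mor (X Y : ringed_space) := RsMor {
  rs_fun :> X -> Y;
  rs_cont : continuous rs_fun;
  rs_sh : forall U : opens Y, {rmorphism sec U -> sec (opre rs_cont U)};
  rs_nat : forall (U V : opens Y) (VU : V `<=` U) s,
    rs_sh V (res VU s) = res (opre_sub rs_cont VU) (rs_sh U s) }.

Arguments rs_cont {X Y} r : rename.

Section StalkMap.
Variables (X Y : ringed_space) (f : rs_mor X Y) (x : X).

Lemma sh_germ_res (U V : opens Y) (VU : V `<=` U) (Ux : oset U (f x))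
    (Vx : oset V (f x)) s :
  @mkgerm X x (opre (rs_cont f) V) Vx (rs_sh f V (res VU s)) =
  @mkgerm X x (opre (rs_cont f) U) Ux (rs_sh f U s).
Proof. by rewrite rs_nat; exact: mkgerm_res. Qed.

Definition stalk_map : {rmorphism stalk (f x) -> stalk x}.
Proof.
refine (@qlift (stalk_ringoid (f x)) (stalk x)
  (fun g => @mkgerm X x (opre (rs_cont f) (g_dom g)) (g_in g)
              (rs_sh f _ (g_sec g))) _ _ _ _).
- move=> g h [W [Wg [Wh [Wx e]]]].
  by rewrite -(sh_germ_res Wg (g_in g) Wx) -(sh_germ_res Wh (g_in h) Wx) e.
- move=> g h; have ghx := conj (g_in g) (g_in h).
  rewrite -(@sh_germ_res _ _ (@omeetl _ (g_dom g) (g_dom h)) (g_in g) ghx).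
  rewrite -(@sh_germ_res _ _ (@omeetr _ (g_dom g) (g_dom h)) (g_in h) ghx).
  rewrite -!germE -rmorphD -rmorphD /= !germE; exact: mkgerm_irr.
- by rewrite -!germE /= rmorph1 rmorph1.
- move=> g h; have ghx := conj (g_in g) (g_in h).
  rewrite -(@sh_germ_res _ _ (@omeetl _ (g_dom g) (g_dom h)) (g_in g) ghx).
  rewrite -(@sh_germ_res _ _ (@omeetr _ (g_dom g) (g_dom h)) (g_in h) ghx).
  rewrite -!germE -rmorphM -rmorphM /= !germE; exact: mkgerm_irr.
Defined.

Lemma stalk_mapE U (Ux : oset U (f x)) s :
  stalk_map (mkgerm Ux s) = @mkgerm X x (opre (rs_cont f) U) Ux (rs_sh f U s).
Proof. exact: qliftE. Qed.

End StalkMap.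

Definition local_hom (A B : comPzRingType) (phi : {rmorphism A -> B}) :=
  forall m n, @local_with A m -> @local_with B n -> phi @^-1` n = m.

Record mor (X Y : locally_ringed_space) := Mor {
  mor_rs :> rs_mor X Y;
  mor_local : forall x : X, local_hom (stalk_map mor_rs x) }.

Section LocalRings.
Variable A : comPzRingType.
Implicit Types (m I : set A) (a b : A).

Definition principal a : set A := [set b | exists c, b = c * a].

Lemma principalP a : ideal (principal a).
Proof.
split=> [|_ _ [c ->] [d ->]|b _ [c ->]].
- by exists 0; rewrite mul0r.
- by exists (c + d); rewrite mulrDl.
- by exists (b * c); rewrite mulrA.
Qed.

Lemma maximal_over I : ideal I -> ~ I 1 ->
  exists2 m, maximal_ideal m & I `<=` m.
Proof.
move=> idI I1.
pose P (J : set A) := J = set0 \/ [/\ ideal J, ~ J 1 & I `<=` J].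
have [F FP Ftot|m [Pm mmax]] := @Zorn_bigcup A P.
  have [F0|/existsNP [J /not_implyP [FJ J0]]] :=
    pselect (forall J, F J -> J = set0).
    by left; apply/seteqP; split=> // x [J /F0 ->].
  right; have [//|[idJ J1 IJ]] := FP _ FJ.
  have dir x y : (\bigcup_(X in F) X) x -> (\bigcup_(X in F) X) y ->
      exists X, [/\ F X, X x & X y].
    move=> [X FX Xx] [Y FY Yy].
    by have [XY|YX] := Ftot _ _ FX FY; [exists Y|exists X];
      split=> //; [exact: XY|exact: YX].
  split.
  - split=> [|x y Ux Uy|x y [X FX Xy]].
    + by exists J => //; exact: ideal0 idJ.
    + have [X [FX Xx Xy]] := dir _ _ Ux Uy.
      have [X0|[idX _ _]] := FP _ FX; first by rewrite X0 in Xx.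
      by exists X => //; exact: (idealD idX).
    + have [X0|[idX _ _]] := FP _ FX; first by rewrite X0 in Xy.
      by exists X => //; exact: (idealM idX).
  - move=> [X FX X1]; have [X0|[_ nX1 _]] := FP _ FX; first by rewrite X0 in X1.
    exact: nX1.
  - by move=> x /IJ Jx; exists J.
have [m0|[idm m1 Im]] := Pm.
  exfalso; apply: (mmax I); last by right; split.
  rewrite m0; split=> //; move=> /(_ 0) h; exact: h (ideal0 idI).
exists m => //; split=> // J idJ J1 mJ; apply: contrapT => Jm.
apply: (mmax J); last by right; split=> //; exact: subset_trans mJ.
by split=> // Jm'; apply: Jm; apply/seteqP; split.
Qed.

Lemma local_ideal m : local_with m -> ideal m.
Proof. by move=> [[]]. Qed.

Lemma local_unit m a : local_with m -> is_unit a <-> ~ m a.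
Proof.
move=> [[idm m1 _] muniq]; split=> [[b ab] ma|ma].
  by apply: m1; rewrite -ab mulrC; exact: (idealM idm).
apply: contrapT => na; apply: ma.
have [|m' m'max sm'] := maximal_over (principalP a).
  by move=> [c e]; apply: na; exists c; rewrite mulrC.
by rewrite -(muniq _ m'max); apply: sm'; exists 1; rewrite mul1r.
Qed.

Lemma local_withI m : ideal m -> ~ m 1 -> (forall a, ~ m a -> is_unit a) ->
  local_with m.
Proof.
move=> idm m1 mu; have prop I : ideal I -> ~ I 1 -> I `<=` m.
  move=> idI I1 a Ia; apply: contrapT => /mu [b ab]; apply: I1.
  by rewrite -ab mulrC; exact: (idealM idI).
split=> [|m' [idm' m'1 m'max]].
  by split=> // I idI I1 mI; apply/seteqP; split=> //; exact: prop.
by apply/esym/m'max => //; exact: prop.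
Qed.

End LocalRings.

Lemma local_homI (A B : comPzRingType) (phi : {rmorphism A -> B}) :
  (forall a, is_unit (phi a) -> is_unit a) -> local_hom phi.
Proof.
move=> h m n lm ln; apply/seteqP; split=> a /=.
  move=> na; apply: contrapT => /(local_unit _ lm) [b ab].
  have /(local_unit _ ln) : is_unit (phi a) by exists (phi b); rewrite -rmorphM ab rmorph1.
  by apply.
move=> ma; apply: contrapT => /(local_unit _ ln) /h /(local_unit _ lm); exact.
Qed.

Lemma local_hom_unit (A B : comPzRingType) (phi : {rmorphism A -> B}) :
  local_ring A -> local_ring B -> local_hom phi ->
  forall a, is_unit (phi a) -> is_unit a.
Proof.
move=> [m lm] [n ln] /(_ _ _ lm ln) e a /(local_unit _ ln) na.
by apply/(local_unit _ lm); rewrite -e.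
Qed.

Definition max_ideal (A : comPzRingType) (lA : local_ring A) : set A :=
  projT1 (cid lA).

Lemma max_idealP (A : comPzRingType) (lA : local_ring A) :
  local_with (max_ideal lA).
Proof. exact: projT2 (cid lA). Qed.

Section ResidueField.
Variables (X : locally_ringed_space) (x : X).

Definition residue_field : comPzRingType :=
  modI (local_ideal (max_idealP (lrs_local x))).

Definition residue : {rmorphism stalk x -> residue_field} := modI_pi _.

Lemma residue_eq0 a : residue a = 0 <-> ~ is_unit a.
Proof.
have l := max_idealP (lrs_local x).
rewrite -(rmorph0 residue) /residue modI_pi_eq subr0.
by rewrite (local_unit a l); split=> [?|/contrapT].
Qed.

End ResidueField.

Lemma cont_id (X : topologicalType) : continuous (fun x : X => x).
Proof. by move=> x; exact: cvg_id. Qed.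

Lemma cont_comp (X Y Z : topologicalType) (f : X -> Y) (g : Y -> Z) :
  continuous f -> continuous g -> continuous (fun x => g (f x)).
Proof. by move=> cf cg x; apply: continuous_comp; [exact: cf|exact: cg]. Qed.

Section IdComp.

Definition rs_id (X : ringed_space) : rs_mor X X.
Proof.
refine (@RsMor X X (fun x => x) (@cont_id X)
  (fun U => @res X U (opre (@cont_id X) U) (fun x Ux => Ux)) _).
by move=> U V VU s; rewrite !resT; exact: res_irr.
Defined.

Lemma stalk_map_id (X : ringed_space) (x : X) a : stalk_map (rs_id X) x a = a.
Proof.
by elim/stalk_ind: a => U Ux s; rewrite stalk_mapE /=; exact: mkgerm_res.
Qed.

Definition idm (X : locally_ringed_space) : mor X X.
Proof.
refine (@Mor X X (rs_id X) _).
by move=> x; apply: local_homI => a; rewrite stalk_map_id.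
Defined.

Variables (X Y Z : ringed_space) (g : rs_mor Y Z) (f : rs_mor X Y).

Let gf_cont := cont_comp (rs_cont f) (rs_cont g).

Definition rs_comp_sh (U : opens Z) : {rmorphism sec U -> sec (opre gf_cont U)} :=
  @res X (opre (rs_cont f) (opre (rs_cont g) U)) (opre gf_cont U)
       (fun x Ux => Ux) \o rs_sh f (opre (rs_cont g) U) \o rs_sh g U.

Definition rs_comp : rs_mor X Z.
Proof.
refine (@RsMor X Z (fun x => g (f x)) gf_cont rs_comp_sh _).
by move=> U V VU s /=; rewrite 2!rs_nat !resT; exact: res_irr.
Defined.

Lemma stalk_map_comp (x : X) a :
  stalk_map rs_comp x a = stalk_map f x (stalk_map g (f x) a).
Proof.
elim/stalk_ind: a => U Ux s; rewrite stalk_mapE /=.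
apply: esym; apply: etrans (congr1 (stalk_map f x)
  (@stalk_mapE Y Z g (f x) U Ux s)) _.
apply: etrans (@stalk_mapE X Y f x (opre (rs_cont g) U) Ux (rs_sh g U s)) _.
by apply: esym; exact: mkgerm_res.
Qed.

End IdComp.

Definition mcomp (X Y Z : locally_ringed_space) (g : mor Y Z) (f : mor X Y) :
  mor X Z.
Proof.
refine (@Mor X Z (rs_comp g f) _).
move=> x; apply: local_homI => a; rewrite stalk_map_comp => u.
apply: (local_hom_unit (lrs_local _) (lrs_local _) (@mor_local _ _ g (f x))).
by apply: (local_hom_unit (lrs_local _) (lrs_local _) (@mor_local _ _ f x)).
Defined.

Notation "g \c f" := (mcomp g f) (at level 50, format "g  \c  f").

Record spec (A : comPzRingType) := SpecPt {
  sp_ideal :> set A;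
  sp_prime : prime_ideal sp_ideal }.

HB.instance Definition _ (A : comPzRingType) := gen_eqMixin (spec A).
HB.instance Definition _ (A : comPzRingType) := gen_choiceMixin (spec A).

Section Zariski.
Variable A : comPzRingType.

(* The closed sets are the V(S) = {p | S `<=` p}. *)
Definition zariski_open : set (set (spec A)) :=
  [set U | exists S : set A, U = [set p | ~ S `<=` sp_ideal p]].

Fact zariskiT : zariski_open setT.
Proof.
exists setT; apply/seteqP; split=> // p _ /= /(_ 1 I).
exact: (prime_n1 (sp_prime p)).
Qed.

Fact zariskiI : setI_closed zariski_open.
Proof.
move=> _ _ [S ->] [T ->].
exists [set a | exists b c, [/\ S b, T c & a = b * c]].
apply/seteqP; split=> p /=.
  move=> [/existsNP [b /not_implyP [Sb pb]] /existsNP [c /not_implyP [Tc pc]]].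
  move=> /(_ (b * c)) h.
  have /(primeM (sp_prime p)) [] // : sp_ideal p (b * c) by apply: h; exists b, c.
have idp := prime_is_ideal (sp_prime p).
move=> /existsNP [_ /not_implyP [[b [c [Sb Tc ->]]] pbc]].
split=> h; apply: pbc; last by apply: (idealM idp); exact: h.
by rewrite mulrC; apply: (idealM idp); exact: h.
Qed.

Fact zariski_bigU (I : Type) (f : I -> set (spec A)) :
  (forall i, zariski_open (f i)) -> zariski_open (\bigcup_i f i).
Proof.
move=> fo; exists [set a | exists i (S : set A),
  f i = [set p | ~ S `<=` sp_ideal p] /\ S a].
apply/seteqP; split=> p /=.
  move=> [i _ fip] h; have [S e] := fo i; move: (fip); rewrite e /=; apply.
  by move=> a Sa; apply: h; exists i, S.
move=> /existsNP [a /not_implyP [[i [S [e Sa]]] pa]].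
by exists i => //; rewrite e => /(_ a Sa).
Qed.

HB.instance Definition _ :=
  isOpenTopological.Build (spec A) zariskiT zariskiI zariski_bigU.

End Zariski.

Section StructureSheaf.
Variable A : comPzRingType.
Implicit Types (U V W : opens (spec A)).

Definition loc_at (p : spec A) : comPzRingType := loc (sp_prime p).

Definition fr (p : spec A) (a f : A) (pf : ~ sp_ideal p f) : loc_at p :=
  mkfrac (sp_prime p) a pf.

Definition basic_open (f : A) : opens (spec A).
Proof.
refine (@Opens (spec A) [set p | ~ sp_ideal p f] _).
exists [set f]; apply/seteqP; split=> p /=; first by move=> h /(_ f erefl).
by move=> /existsNP [_ /not_implyP [-> ?]].
Defined.

Definition pts U : Type := {p : spec A | oset U p}.

(* Sections over U: families of elements of the local rings A_p, p in U,
   that are locally given by a fraction a/f. *)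
Definition locally_fraction U : set (forall p : pts U, loc_at (sval p)) :=
  [set s | forall p : pts U, exists V : opens (spec A),
     [/\ oset V (sval p), V `<=` U & exists a f, forall q : pts U,
       oset V (sval q) -> exists qf : ~ sp_ideal (sval q) f, s q = fr a qf]].

Lemma frN (p : spec A) a f (pf : ~ sp_ideal p f) : fr (- a) pf = - fr a pf.
Proof. exact: mkfracN. Qed.
Lemma frD (p : spec A) a b f g (pf : ~ sp_ideal p f) (pg : ~ sp_ideal p g) :
  fr a pf + fr b pg = fr (a * g + b * f) (primeMn (sp_prime p) pf pg).
Proof. exact: mkfracD. Qed.
Lemma frM (p : spec A) a b f g (pf : ~ sp_ideal p f) (pg : ~ sp_ideal p g) :
  fr a pf * fr b pg = fr (a * b) (primeMn (sp_prime p) pf pg).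
Proof. exact: mkfracM. Qed.

Definition spec_subprod U : subprod (fun p : pts U => loc_at (sval p)).
Proof.
refine (@Subprod _ _ (@locally_fraction U) _ _ _) => [p|s t hs ht p|s t hs ht p].
- exists U; split=> //; first exact: (proj2_sig p).
  by exists 1, 1 => q _; exists (prime_n1 (sp_prime (sval q))).
- have [V [Vp VU [a [f sV]]]] := hs p; have [W [Wp WU [b [g tW]]]] := ht p.
  exists (omeet V W); split=> //; first by move=> q [/VU].
  exists (a * g + - b * f), (f * g) => q [/sV [qf ->] /tW [qg ->]].
  by exists (primeMn (sp_prime (sval q)) qf qg); rewrite -frN frD.
- have [V [Vp VU [a [f sV]]]] := hs p; have [W [Wp WU [b [g tW]]]] := ht p.
  exists (omeet V W); split=> //; first by move=> q [/VU].
  exists (a * b), (f * g) => q [/sV [qf ->] /tW [qg ->]].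
  by exists (primeMn (sp_prime (sval q)) qf qg); rewrite frM.
Defined.

Definition spec_sec U : comPzRingType := sp_type (spec_subprod U).

Lemma spec_addE U (s t : spec_sec U) p : (s + t) p = s p + t p.
Proof. by []. Qed.
Lemma spec_mulE U (s t : spec_sec U) p : (s * t) p = s p * t p.
Proof. by []. Qed.
Lemma spec_oneE U p : (1 : spec_sec U) p = 1.
Proof. by []. Qed.

Definition sub_pts U V (VU : V `<=` U) (p : pts V) : pts U :=
  exist _ (sval p) (VU _ (proj2_sig p)).

Lemma pts_irr U (s : forall p : pts U, loc_at (sval p)) p (h h' : oset U p) :
  s (exist _ p h) = s (exist _ p h').
Proof. by rewrite (Prop_irrelevance h h'). Qed.

Lemma pts_val U (s : forall p : pts U, loc_at (sval p)) p
  (h : oset U (sval p)) : s (exist _ (sval p) h) = s p.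
Proof. by case: p h => p h h'; exact: pts_irr. Qed.

Fact spec_res_subproof U V (VU : V `<=` U) (s : spec_sec U) :
  @locally_fraction V (fun p => s (sub_pts VU p)).
Proof.
move=> p; have [W [Wp WU [a [f sW]]]] := sp_funP s (sub_pts VU p).
exists (omeet V W); split=> //; first by split=> //; exact: (proj2_sig p).
  by move=> q [].
by exists a, f => q [_ Wq]; exact: (sW (sub_pts VU q)).
Qed.

Definition spec_res U V (VU : V `<=` U) : {rmorphism spec_sec U -> spec_sec V}.
Proof.
by refine (@mk_rmorphism (spec_sec U) (spec_sec V)
  (fun s => @Sp _ _ (spec_subprod V) _ (spec_res_subproof VU s)) _ _ _);
  move=> *; apply: sp_ext.
Defined.

Definition Spec_rs : ringed_space.
Proof.
refine (@RingedSpace (spec A) spec_sec spec_res _ _ _ _).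
- by move=> U h s; apply: sp_ext => p; exact: (pts_val (sp_fun s)).
- by move=> U V W VU WV WU s; apply: sp_ext => p; exact: (pts_irr (sp_fun s)).
- move=> I U V VU cov s t st; apply: sp_ext => p.
  have [i _ Vp] := cov _ (proj2_sig p).
  have := congr1 (fun u : spec_sec (V i) => u (exist _ (sval p) Vp)) (st i) => /=.
  by rewrite /sub_pts /= !(pts_val (sp_fun _)).
- move=> I U V VU cov s sV.
  pose idx (p : pts U) : {i | oset (V i) (sval p)} :=
    let: exist2 i _ h := cid2 (cov _ (proj2_sig p)) in exist _ i h.
  pose t (p : pts U) : loc_at (sval p) :=
    s (sval (idx p)) (exist _ (sval p) (proj2_sig (idx p))).
  have tE i (p : pts U) (Vp : oset (V i) (sval p)) :
      t p = s i (exist _ (sval p) Vp).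
    rewrite /t; case: (idx p) => j /= Vj.
    pose W := omeet (V j) (V i).
    have Wp : oset W (sval p) by [].
    have := congr1 (fun u : spec_sec W => u (exist _ (sval p) Wp))
      (sV j i W (@omeetl _ _ _) (@omeetr _ _ _)).
    move=> /=; rewrite /sub_pts /= => e.
    by rewrite (pts_irr (s j) Vj (omeetl Wp)) e; exact: (pts_irr (s i)).
  have lt : locally_fraction t.
    move=> p; have [i _ Vp] := cov _ (proj2_sig p).
    have [W [Wp WV [a [f sW]]]] := sp_funP (s i) (exist _ (sval p) Vp).
    exists W; split=> //; first by apply: subset_trans (VU i).
    exists a, f => q Wq; rewrite (tE i q (WV _ Wq)).
    exact: (sW (exist _ (sval q) (WV _ Wq))).
  exists (@Sp _ _ (spec_subprod U) t lt) => i; apply: sp_ext => p /=.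
  by rewrite (tE i (sub_pts (VU i) p) (proj2_sig p)); exact: (pts_val (s i)).
Defined.

Definition germ_val (p : spec A) : {rmorphism @stalk Spec_rs p -> loc_at p}.
Proof.
refine (@qlift (@stalk_ringoid Spec_rs p) (loc_at p)
  (fun g => (g_sec g : spec_sec _) (exist _ p (g_in g))) _ _ _ _) => //.
- move=> g h [W [Wg [Wh [Wx e]]]].
  have := congr1 (fun u : spec_sec W => u (exist _ p Wx)) e => /=.
  rewrite /sub_pts /=.
  by rewrite (Prop_irrelevance (Wg p Wx) (g_in g))
             (Prop_irrelevance (Wh p Wx) (g_in h)).
- by move=> g h /=; congr (_ + _); exact: (pts_irr (sp_fun _)).
- by move=> g h /=; congr (_ * _); exact: (pts_irr (sp_fun _)).
Defined.

Lemma germ_valE (p : spec A) U (Up : oset U p) (s : spec_sec U) :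
  germ_val p (@mkgerm Spec_rs p U Up s) = s (exist _ p Up).
Proof. exact: qliftE. Qed.

Definition loc_max (p : spec A) : set (loc_at p) :=
  [set x | exists a f (pf : ~ sp_ideal p f), sp_ideal p a /\ x = fr a pf].

Lemma fr_max (p : spec A) a f (pf : ~ sp_ideal p f) :
  loc_max (fr a pf) <-> sp_ideal p a.
Proof.
have idp := prime_is_ideal (sp_prime p).
split=> [[b [g [pg [pb]]]]|pa]; last by exists a, f, pf.
move=> /(@eq_cls (loc_ringoid (sp_prime p))) [u [pu /= e]].
have : sp_ideal p (u * (a * g)).
  by rewrite e; apply: (idealM idp); rewrite mulrC; exact: (idealM idp).
move=> /(primeM (sp_prime p)) [] // /(primeM (sp_prime p)) [] //.
Qed.

Lemma loc_frac (p : spec A) (x : loc_at p) : exists a f (pf : ~ sp_ideal p f), x = fr a pf.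
Proof. by elim/quot_ind: x => -[a f pf]; exists a, f, pf. Qed.

Lemma loc_maxP (p : spec A) : local_with (@loc_max p).
Proof.
pose pp := sp_prime p; have idp := prime_is_ideal pp.
apply: local_withI.
- split=> [|_ _ [a [f [pf [pa ->]]]] [b [g [pg [pb ->]]]]|x _ [b [g [pg [pb ->]]]]].
  + by exists 0, 1, (prime_n1 pp); split=> //; exact: (ideal0 idp).
  + exists (a * g + b * f), (f * g), (primeMn pp pf pg); split; last exact: frD.
    by apply: (idealD idp); rewrite mulrC; exact: (idealM idp).
  + have [a [f [pf ->]]] := loc_frac x.
    exists (a * b), (f * g), (primeMn pp pf pg); split; last exact: frM.
    exact: (idealM idp).
- by move=> /(@fr_max p 1 1 (prime_n1 pp)); exact: (prime_n1 pp).
- move=> x; have [a [f [pf ->]]] := loc_frac x => /fr_max pa.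
  exists (fr f pa); rewrite frM; apply: (@cls_eq (loc_ringoid pp)).
  by apply: (frac_eqv_eq pp) => /=; ring.
Qed.

Lemma spec_stalk_max (p : spec A) :
  @local_with (@stalk Spec_rs p) (germ_val p @^-1` @loc_max p).
Proof.
have [[idm m1 _] _] := @loc_maxP p; apply: local_withI.
- exact: ideal_preim.
- by rewrite /preimage /mkset rmorph1.
- elim/stalk_ind=> U Up s; rewrite /preimage /mkset germ_valE => sp.
  have [V [Vp VU [a [f sV]]]] := sp_funP s (exist _ p Up).
  have pa : ~ sp_ideal p a.
    have [/= pf e] := sV (exist _ p Up) Vp.
    by move=> pa; apply: sp; rewrite e; apply/fr_max.
  pose W := omeet V (basic_open a).
  have Wp : oset W p by [].
  have lt : @locally_fraction W (fun q => fr f (proj2 (proj2_sig q))).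
    move=> q; exists W; split=> //; first exact: (proj2_sig q).
    exists f, a => q' Wq'; exists (proj2 (proj2_sig q')) => //.
  pose t : spec_sec W := @Sp _ _ (spec_subprod W) _ lt.
  have WU : W `<=` U by move=> q [/VU].
  exists (@mkgerm Spec_rs p W Wp t).
  rewrite -(@mkgerm_res Spec_rs p U W Up Wp WU s) -!germE -rmorphM.
  rewrite -[RHS](rmorph1 (@germ Spec_rs p W Wp)); congr (germ _ _).
  apply: sp_ext => q /=.
  have [qf ->] := sV (sub_pts WU q) (proj1 (proj2_sig q)).
  rewrite frM; apply: (@cls_eq (loc_ringoid (sp_prime (sval q)))).
  by apply: (frac_eqv_eq (sp_prime (sval q))) => /=; ring.
Qed.

Definition Spec : locally_ringed_space :=
  @LocallyRingedSpace Spec_rs (fun p => ex_intro _ _ (spec_stalk_max p)).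

Lemma germ_val_unit (p : spec A) (a : @stalk Spec_rs p) :
  is_unit (germ_val p a) -> is_unit a.
Proof.
move=> /(local_unit _ (@loc_maxP p)) h.
exact/(local_unit _ (spec_stalk_max p)).
Qed.

Fact const_fraction U (a : A) :
  @locally_fraction U (fun p => to_loc (sp_prime (sval p)) a).
Proof.
move=> p; exists U; split=> //; first exact: (proj2_sig p).
by exists a, 1 => q _; exists (prime_n1 (sp_prime (sval q))).
Qed.

Definition to_sec U : {rmorphism A -> spec_sec U}.
Proof.
refine (@mk_rmorphism A (spec_sec U)
  (fun a => @Sp _ _ (spec_subprod U) _ (@const_fraction U a)) _ _ _).
- by move=> a b; apply: sp_ext => p; exact: rmorphD.
- by apply: sp_ext => p; exact: rmorph1.
- by move=> a b; apply: sp_ext => p; exact: rmorphM.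
Defined.

End StructureSheaf.

Section SpecMap.
Variables (A B : comPzRingType) (phi : {rmorphism A -> B}).

Definition spec_map (q : spec B) : spec A :=
  SpecPt (prime_preim phi (sp_prime q)).

Fact spec_map_cont : continuous spec_map.
Proof.
apply/continuousP => _ [S ->]; exists [set phi a | a in S].
apply/seteqP; split=> q /= h h'; apply: h.
  by move=> a Sa; apply: h'; exists a.
by move=> _ [a Sa <-]; exact: h'.
Qed.

Definition pts_map (U : opens (spec A)) (q : pts (opre spec_map_cont U)) :
  pts U := exist _ (spec_map (sval q)) (proj2_sig q).

Fact spec_map_subproof (U : opens (spec A)) (s : spec_sec U) :
  @locally_fraction B (opre spec_map_cont U)
    (fun q => loc_map phi (sp_prime (sval q)) (s (pts_map q))).
Proof.
move=> q; have [V [Vq VU [a [f sV]]]] := sp_funP s (pts_map q).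
exists (opre spec_map_cont V); split=> //; first exact: (opre_sub _ VU).
exists (phi a), (phi f) => q' /(sV (pts_map q')) [qf ->].
by exists qf; exact: loc_map_frac.
Qed.

Definition spec_map_sh (U : opens (spec A)) :
  {rmorphism spec_sec U -> spec_sec (opre spec_map_cont U)}.
Proof.
refine (@mk_rmorphism (spec_sec U) (spec_sec (opre spec_map_cont U))
  (fun s => @Sp _ _ (spec_subprod _) _ (spec_map_subproof s)) _ _ _).
- by move=> s t; apply: sp_ext => q; exact: rmorphD.
- by apply: sp_ext => q; exact: rmorph1.
- by move=> s t; apply: sp_ext => q; exact: rmorphM.
Defined.

Definition Spec_map_rs : rs_mor (Spec B) (Spec A).
Proof.
refine (@RsMor (Spec_rs B) (Spec_rs A) spec_map spec_map_cont spec_map_sh _).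
move=> U V VU s; apply: sp_ext => q.
apply: (congr1 (loc_map phi (sp_prime (sval q)))).
exact: (@pts_irr A U (sp_fun s) (spec_map (sval q))).
Defined.

Definition Spec_map : mor (Spec B) (Spec A).
Proof.
refine (@Mor (Spec B) (Spec A) Spec_map_rs _) => q.
apply: local_homI; elim/stalk_ind=> U Uq s u; apply: germ_val_unit.
rewrite germ_valE; apply/(local_unit _ (@loc_maxP A (spec_map q))).
move=> [a [f [pf [pa e]]]].
move: u; rewrite stalk_mapE /= => -[v uv].
have /(local_unit _ (@loc_maxP B q)) : is_unit (germ_val q
    (@mkgerm (Spec_rs B) q (opre spec_map_cont U) Uq (spec_map_sh U s))).
  by exists (germ_val q v); rewrite -rmorphM uv rmorph1.
apply; rewrite germ_valE /=.
rewrite [s _](etrans (pts_irr (sp_fun s) _ Uq) e).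
exists (phi a), (phi f), pf; split=> //.
exact: loc_map_frac.
Defined.

End SpecMap.

Section ResiduePoint.
Variables (X : locally_ringed_space) (x : X).
Let K := residue_field x.

Definition rpt (_ : spec K) : X := x.

Fact rpt_cont : continuous rpt.
Proof. exact: (@cst_continuous (spec K) X x). Qed.

Definition rpt_fun (U : opens X) (s : sec U) (p : pts (opre rpt_cont U)) :
  loc_at (sval p) :=
  to_loc (sp_prime (sval p)) (residue x (germ (proj2_sig p : oset U x) s)).

Fact rpt_fun_morph (U : opens X) (p : pts (opre rpt_cont U)) :
  [/\ forall s t, rpt_fun (s + t) p = rpt_fun s p + rpt_fun t p,
      rpt_fun (1 : sec U) p = 1 &
      forall s t, rpt_fun (s * t) p = rpt_fun s p * rpt_fun t p].
Proof.
rewrite /rpt_fun; move: (proj2_sig p : oset U x) => Ux.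
split=> [s t||s t].
- rewrite (rmorphD (germ Ux)) (rmorphD (residue x)); exact: rmorphD.
- rewrite (rmorph1 (germ Ux)) (rmorph1 (residue x)); exact: rmorph1.
- rewrite (rmorphM (germ Ux)) (rmorphM (residue x)); exact: rmorphM.
Qed.

Fact rpt_subproof (U : opens X) (s : sec U) :
  @locally_fraction K (opre rpt_cont U) (rpt_fun s).
Proof.
move=> p; have Ux : oset U x := proj2_sig p.
exists (opre rpt_cont U); split=> //.
exists (residue x (germ Ux s)), 1 => q _.
exists (prime_n1 (sp_prime (sval q))); rewrite /rpt_fun.
by rewrite (Prop_irrelevance (proj2_sig q) Ux).
Qed.

Definition rpt_sh (U : opens X) :
  {rmorphism sec U -> spec_sec (opre rpt_cont U)}.
Proof.
refine (@mk_rmorphism (sec U) (spec_sec (opre rpt_cont U))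
  (fun s => @Sp _ _ (spec_subprod _) _ (rpt_subproof s)) _ _ _).
- move=> s t; apply: sp_ext => p; have [h _ _] := rpt_fun_morph p.
  rewrite spec_addE; exact: h.
- apply: sp_ext => p; have [_ h _] := rpt_fun_morph p.
  rewrite spec_oneE; exact: h.
- move=> s t; apply: sp_ext => p; have [_ _ h] := rpt_fun_morph p.
  rewrite spec_mulE; exact: h.
Defined.

Definition residue_point_rs : rs_mor (Spec K) X.
Proof.
refine (@RsMor (Spec_rs K) X rpt rpt_cont rpt_sh _).
move=> U V VU s; apply: sp_ext => p /=; rewrite /rpt_fun /=.
by congr (to_loc _ (residue x _)); exact: mkgerm_res.
Defined.

Definition residue_point : mor (Spec K) X.
Proof.
refine (@Mor (Spec K) X residue_point_rs _) => p.
apply: local_homI; elim/stalk_ind=> U Ux s u.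
apply: contrapT => /residue_eq0 s0.
move: u; rewrite stalk_mapE /= => -[v uv].
have /(local_unit _ (@loc_maxP K p)) : is_unit (germ_val p
    (@mkgerm (Spec_rs K) p (opre rpt_cont U) Ux (rpt_sh U s))).
  by exists (germ_val p v); rewrite -rmorphM uv rmorph1.
apply; rewrite germ_valE /= /rpt_fun.
rewrite (_ : residue x _ = 0).
  by rewrite rmorph0; exact: (ideal0 (local_ideal (@loc_maxP K p))).
by rewrite -s0.
Defined.

End ResiduePoint.

Lemma rmorph_ext (A B : comPzRingType) (f g : {rmorphism A -> B}) :
  (forall x, f x = g x) -> f = g.
Proof.
case: f g => f [[fD] [fM]] [g [[gD] [gM]]] /= e.
have {}e : f = g by exact: funext.
case: g / e gD gM => gD gM.
by rewrite (Prop_irrelevance fD gD) (Prop_irrelevance fM gM).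
Qed.

Lemma mor_ext (X Y : locally_ringed_space) (f g : mor X Y) :
  (forall x, f x = g x) ->
  (forall (U : opens Y) (s : sec U) (W : opens X)
     (Wf : W `<=` opre (rs_cont f) U) (Wg : W `<=` opre (rs_cont g) U),
     res Wf (rs_sh f U s) = res Wg (rs_sh g U s)) ->
  f = g.
Proof.
case: f g => [[f cf fs fn] fl] [[g cg gs gn] gl] /= fg.
have {}fg : f = g by exact: funext.
case: g / fg cg gs gn gl => cg; rewrite -(Prop_irrelevance cf cg) => gs gn gl h.
have {}h : fs = gs.
  apply: functional_extensionality_dep => U; apply: rmorph_ext => s.
  have := h U s (opre cf U) (@subset_refl _ _) (@subset_refl _ _).
  by rewrite !res_id.
case: gs / h gn gl => gn; rewrite -(Prop_irrelevance fn gn) => gl.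
by rewrite (Prop_irrelevance fl gl).
Qed.

Lemma mcomp_idl (X Y : locally_ringed_space) (f : mor X Y) : idm Y \c f = f.
Proof.
apply: mor_ext => // U s W p q /=.
by rewrite rs_nat !resT; exact: res_irr.
Qed.

Lemma mcomp_idr (X Y : locally_ringed_space) (f : mor X Y) : f \c idm X = f.
Proof. by apply: mor_ext => // U s W p q /=; rewrite !resT; exact: res_irr. Qed.

Lemma mcompA (X Y Z T : locally_ringed_space) (h : mor Z T) (g : mor Y Z)
  (f : mor X Y) : h \c (g \c f) = (h \c g) \c f.
Proof.
apply: mor_ext => // U s W p q /=.
by rewrite rs_nat !resT; exact: res_irr.
Qed.

Section Schemes.
Implicit Types X Y Z S : locally_ringed_space.

Definition open_immersion X Y (f : mor X Y) :=
  [/\ injective f,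
      forall U : set X, open U -> open (f @` U) &
      forall V : opens Y, V `<=` range f -> bijective (rs_sh f V)].

(* f is a homeomorphism onto a closed subset and O_Y -> f_* O_X is an
   epimorphism of sheaves. *)
Definition closed_immersion X Y (f : mor X Y) :=
  [/\ injective f,
      forall C : set X, closed C -> closed (f @` C) &
      forall (V : opens Y) (s : sec (opre (rs_cont f) V)) (y : Y), oset V y ->
        exists (W : opens Y) (WV : W `<=` V), oset W y /\
          exists t : sec W, rs_sh f W t = res (opre_sub (rs_cont f) WV) s].

Definition is_scheme X :=
  forall x : X, exists (A : comPzRingType) (j : mor (Spec A) X),
    open_immersion j /\ range j x.

Definition locally_noetherian X :=
  forall x : X, exists (A : comPzRingType) (j : mor (Spec A) X),
    [/\ noetherian A, open_immersion j & range j x].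

Definition quasi_compact X := cover_compact [set: X].

Definition noetherian_scheme X :=
  [/\ is_scheme X, locally_noetherian X & quasi_compact X].

Definition reduced X :=
  forall (U : opens X) (s : sec U) m, s ^+ m = 0 -> s = 0.

(* j identifies Y with the reduced scheme associated to X: the closed subscheme
   of X that is reduced and has the same underlying space. *)
Definition is_reduction Y X (j : mor Y X) :=
  [/\ is_scheme Y, reduced Y, closed_immersion j & range j = setT].

(* (P, p, q) is the fibre product of f and g in the category of schemes. *)
Definition is_fibre_product X Y S (f : mor X S) (g : mor Y S)
    P (p : mor P X) (q : mor P Y) :=
  [/\ is_scheme P, f \c p = g \c q &
      forall W (a : mor W X) (b : mor W Y), is_scheme W -> f \c a = g \c b ->
        exists! h : mor W P, p \c h = a /\ q \c h = b].

Definition global_sections X := sec (ofull X).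

Definition global_map X Y (f : mor X Y) :
  {rmorphism global_sections Y -> global_sections X} :=
  @res X (opre (rs_cont f) (ofull Y)) (ofull X) (fun x _ => I) \o rs_sh f (ofull Y).

End Schemes.

(* The element sum_i x_i (x) b_i of the tensor product of the A-modules N and B
   vanishes: it is killed by every A-bilinear map on N x B. *)
Definition tensor_zero (A B : comPzRingType) (phi : {rmorphism A -> B})
    (N : lmodType A) (s : seq (N * B)) :=
  forall (Q : lmodType A) (beta : N -> B -> Q),
    (forall x y b, beta (x + y) b = beta x b + beta y b) ->
    (forall x b c, beta x (b + c) = beta x b + beta x c) ->
    (forall a x b, beta (a *: x) b = a *: beta x b) ->
    (forall a x b, beta x (phi a * b) = a *: beta x b) ->
  \sum_(xb <- s) beta xb.1 xb.2 = 0.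

(* B is a flat A-module: - (x) B preserves injectivity of linear maps. *)
Definition flat_hom (A B : comPzRingType) (phi : {rmorphism A -> B}) :=
  forall (N N' : lmodType A) (u : {linear N -> N'}), injective u ->
  forall s : seq (N * B),
    tensor_zero phi [seq (u xb.1, xb.2) | xb <- s] -> tensor_zero phi s.

Definition flat (X Y : locally_ringed_space) (f : mor X Y) :=
  forall x : X, flat_hom (stalk_map f x).

(* For K a field: A is a K-vector space of dimension n. *)
Definition has_dim (K A : comPzRingType) (phi : {rmorphism K -> A}) (n : nat) :=
  exists b : 'I_n -> A, forall a, exists! c : 'I_n -> K,
    a = \sum_i phi (c i) * b i.

Record kscheme (k : fieldType) := KScheme {
  ks_lrs :> locally_ringed_space;
  ks_scheme : is_scheme ks_lrs;
  ks_str : mor ks_lrs (Spec k) }.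

Record kmor (k : fieldType) (X Y : kscheme k) := KMor {
  kmor_mor :> mor X Y;
  kmor_str : ks_str Y \c kmor_mor = ks_str X }.

Lemma kcomp_str (k : fieldType) (X Y Z : kscheme k) (g : kmor Y Z)
  (f : kmor X Y) : ks_str Z \c (g \c f) = ks_str X.
Proof. by rewrite mcompA !kmor_str. Qed.

Definition kcomp (k : fieldType) (X Y Z : kscheme k) (g : kmor Y Z)
  (f : kmor X Y) : kmor X Z := KMor (kcomp_str g f).

Section Hilb.
Variables (k : fieldType) (R : comAlgType k) (P : set R).
Hypothesis localR : local_with P.

Definition Spec_k : mor (Spec R) (Spec k) := Spec_map (in_alg R).

Definition Spec_RP : mor (Spec (modI (local_ideal localR))) (Spec R) :=
  Spec_map (modI_pi (local_ideal localR)).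

(* T x_k Spec R is given by its universal property, so a closed subscheme comes
   with a chosen model of the product; [same_sub] below identifies closed
   subschemes of different models along the canonical isomorphism. *)
Record closed_sub (T : kscheme k) := ClosedSub {
  cs_prod : locally_ringed_space;
  cs_pr1 : mor cs_prod T;
  cs_pr2 : mor cs_prod (Spec R);
  cs_prodP : is_fibre_product (ks_str T) Spec_k cs_pr1 cs_pr2;
  cs_sub :> locally_ringed_space;
  cs_subP : is_scheme cs_sub;
  cs_imm : mor cs_sub cs_prod;
  cs_immP : closed_immersion cs_imm }.

Section Family.
Variables (T : kscheme k) (Z : closed_sub T).

Definition cs_toT : mor Z T := cs_pr1 Z \c cs_imm Z.
Definition cs_toR : mor Z (Spec R) := cs_pr2 Z \c cs_imm Z.

Definition fibre_dim (y : T) (n : nat) :=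
  exists (F : locally_ringed_space) (p : mor F Z)
    (q : mor F (Spec (residue_field y))),
    is_fibre_product cs_toT (residue_point y) p q /\
    has_dim (global_map q \o @to_sec (residue_field y) (ofull _)) n.

(* Z_red is contained in T x_k Spec(R/P): its closed immersion into
   T x_k Spec R factors through the canonical morphism c. *)
Definition red_supported :=
  exists (Zred : locally_ringed_space) (j : mor Zred Z),
    is_reduction j /\
  exists (Q : locally_ringed_space) (q1 : mor Q T)
    (q2 : mor Q (Spec (modI (local_ideal localR))))
    (c : mor Q (cs_prod Z)) (h : mor Zred Q),
    [/\ is_fibre_product (ks_str T) (Spec_k \c Spec_RP) q1 q2,
        cs_pr1 Z \c c = q1, cs_pr2 Z \c c = Spec_RP \c q2 &
        cs_imm Z \c j = c \c h].

End Family.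

Definition in_Hilb (n : nat) (T : kscheme k) (Z : closed_sub T) :=
  [/\ flat (cs_toT Z), forall y : T, fibre_dim Z y n & red_supported Z].

(* Z and Z' are the same closed subscheme of T x_k Spec R. *)
Definition same_sub (T : kscheme k) (Z Z' : closed_sub T) :=
  exists (u : mor Z Z') (v : mor Z' Z),
    [/\ v \c u = idm Z, u \c v = idm Z',
        cs_toT Z' \c u = cs_toT Z & cs_toR Z' \c u = cs_toR Z].

(* Z' is the pull-back U x_T Z, as a closed subscheme of U x_k Spec R. *)
Definition is_pullback (U T : kscheme k) (f : kmor U T)
    (Z : closed_sub T) (Z' : closed_sub U) :=
  exists g : mor Z' Z,
    is_fibre_product f (cs_toT Z) (cs_toT Z') g /\
    cs_toR Z \c g = cs_toR Z'.

(* Hilb^n R is isomorphic to Hom(-, H) on noetherian k-schemes: there are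
   bijections Phi from Hom(T, H) to the set Hilb^n R (T) -- the values of Phi
   being closed subschemes up to [same_sub] -- that are natural in T. *)
Definition Hilb_represented_by (n : nat) (H : kscheme k) :=
  exists Phi : forall T : kscheme k, kmor T H -> closed_sub T,
    [/\ forall T : kscheme k, noetherian_scheme T -> forall f, in_Hilb n (Phi T f),
        forall T : kscheme k, noetherian_scheme T -> forall f g,
          same_sub (Phi T f) (Phi T g) -> f = g,
        forall T : kscheme k, noetherian_scheme T -> forall Z, in_Hilb n Z ->
          exists f, same_sub (Phi T f) Z &
        forall U T : kscheme k, noetherian_scheme U -> noetherian_scheme T ->
          forall (g : kmor U T) (f : kmor T H),
          is_pullback g (Phi T f) (Phi U (kcomp f g))].

Definition Hilb_representable (n : nat) :=
  exists H : kscheme k, noetherian_scheme H /\ Hilb_represented_by n H.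

End Hilb.

Definition completion_is_powser (k : fieldType) (R : comAlgType k) (P : set R)
    (r : nat) :=
  exists psi : {rmorphism completion P -> powser k r},
    bijective psi /\ forall c : k, psi (to_completion P c%:A) = psC r c.

(* Main.v *)
Require Import Defs.
From HB Require Import structures.
From mathcomp Require Import all_boot all_order all_algebra.
From mathcomp Require Import mpoly.
From mathcomp Require Import boolp classical_sets topology.
From mathcomp Require Import ring.

(** Suppose that [H] represents the functor, and let [Z] be the universal family
    over [H], the member of the Hilbert functor that corresponds to the identity.
    Two facts about a function [t] in the maximal ideal [P] collide.

    On [Z] the function [t] is nilpotent. The reduced scheme of [Z] lies over the
    closed point of [Spec R], where [t] vanishes; as every point of [Z] comes from
    the reduced scheme, no germ of [t] on [Z] is invertible, and on affine charts
    this gives local nilpotency by the description of the nilradical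
    ([scheme_locally_nilpotent]). The residue field [R/P] is [k], so the support
    of [Z] is a closed subset of the image of the quasi-compact [H]
    ([base_change_k]), hence [Z] is quasi-compact and one exponent [N] works
    everywhere ([support_nilpotent]). Every family over a noetherian base is a
    pull-back of [Z], so [t ^+ N] vanishes on every family, with the same [N].

    On the other hand, let [A = k[T]/(T^M)] and [B = k[X]/(X^(nM))], where [B] is
    an [A]-algebra by [T = X^n], free with basis [1, X, ..., X^(n-1)]. Restricting
    power series to a coordinate axis gives a map from [R] to [B]. If [t] has a
    nonzero linear term along the axis, then the image of [t] generates [B] as a
    [k]-algebra, so [Spec B] is a closed subscheme of the product of [Spec A] and
    [Spec R], flat of degree [n] over [Spec A] and supported at [P]
    ([family_in_Hilb]); but [t ^+ N] is nonzero in [B] as soon as [N < nM].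
    Such a [t] exists because [P] generates the kernel of the projection of the
    completion onto [R/P], [R] being noetherian ([completion_gen],
    [exists_parameter]).

    The product of [Spec A] and [Spec R] must be a fibre product among all
    schemes. This is deduced from the bijection between morphisms from a locally
    ringed space [W] to [Spec C] and ring morphisms from [C] to the global sections
    of [W] ([mor_Spec_ext], [classify_mor]), which turns a pushout of rings into a
    fibre product of spectra ([Spec_fibre_product]). The same bijection reduces
    every identity between morphisms of affine schemes below to an identity between
    ring morphisms. *)

Set Implicit Arguments.
Unset Strict Implicit.
Unset Printing Implicit Defensive.
Import GRing.Theory.
Local Open Scope classical_set_scope.
Local Open Scope ring_scope.

(** * Units, germs and local rings *)

Lemma unit_rmorph (A B : comPzRingType) (f : {rmorphism A -> B}) a :
  is_unit a -> is_unit (f a).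
Proof. by move=> [b ab]; exists (f b); rewrite -rmorphM ab rmorph1. Qed.

Lemma unitM (A : comPzRingType) (a b : A) :
  is_unit a -> is_unit b -> is_unit (a * b).
Proof.
move=> [a' aa'] [b' bb']; exists (a' * b').
by rewrite mulrACA aa' bb' mulr1.
Qed.

Lemma unit_lreg (A : comPzRingType) (u a b : A) :
  is_unit u -> u * a = u * b -> a = b.
Proof.
move=> [v uv] e.
by rewrite -[a]mul1r -[b]mul1r -uv [u * v]mulrC -!mulrA e.
Qed.

Lemma local_nonunit0 (A : comPzRingType) : local_ring A -> ~ is_unit (0 : A).
Proof.
by move=> [m lm] /(local_unit _ lm); apply; exact: (ideal0 (local_ideal lm)).
Qed.

Lemma max_prime (A : comPzRingType) (m : set A) : local_with m -> prime_ideal m.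
Proof.
move=> lm; split=> [||a b mab]; first exact: local_ideal lm.
  by case: lm => -[].
apply: contrapT => /not_orP [/(local_unit _ lm) ua /(local_unit _ lm) ub].
by have /(local_unit _ lm) := unitM ua ub.
Qed.

Section Germs.
Variable X : ringed_space.

(** Sections of a sheaf are compared through their germs; this is how sections
    built by gluing are handled below, as gluing only prescribes germs. *)
Lemma sec_germ_eq (U : opens X) (s t : sec U) :
  (forall x (Ux : oset U x), mkgerm Ux s = mkgerm Ux t) -> s = t.
Proof.
move=> st; pose V (p : {x : X | oset U x}) :=
  projT1 (cid (eq_mkgerm (st _ (proj2_sig p)))).
have VP p : exists VU : V p `<=` U, oset (V p) (sval p) /\ res VU s = res VU t.
  rewrite /V; case: cid => W /= [WU [WU' [Wx e]]]; exists WU; split=> //.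
  by rewrite e; exact: res_irr.
apply: (@sec_sep X _ U V (fun p => projT1 (cid (VP p)))).
- by move=> x Ux; exists (exist _ x Ux) => //; have [? []] := VP (exist _ x Ux).
- by move=> p; case: (cid (VP p)) => VU [].
Qed.

Lemma unit_germ (x : X) (U : opens X) (Ux : oset U x) (s : sec U) :
  is_unit (mkgerm Ux s) ->
  exists (W : opens X) (WU : W `<=` U), oset W x /\ is_unit (res WU s).
Proof.
move=> [b]; elim/stalk_ind: b => V Vx t.
pose W := omeet U V; have Wx : oset W x by [].
rewrite -(mkgerm_res Ux Wx (@omeetl _ _ _)) -(mkgerm_res Vx Wx (@omeetr _ _ _)).
rewrite -!germE -rmorphM -(rmorph1 (germ Wx)) => /eq_mkgerm.
move=> [W' [W'W [W'W' [W'x]]]]; rewrite rmorph1 rmorphM /= => e.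
exists W', (subset_trans W'W (@omeetl _ _ _)); split=> //.
by rewrite -resT; exists (res W'W (res (@omeetr _ U V) t)).
Qed.

End Germs.

(** * Uniqueness of morphisms to an affine scheme *)

Definition at_pt (W : locally_ringed_space) (w : W) :
  {rmorphism global_sections W -> stalk w} := @germ W w (ofull W) I.

(** One direction of the bijection between morphisms from [W] to [Spec C] and ring
    morphisms from [C] to the global sections of [W]. *)
Definition pullback_hom (W : locally_ringed_space) (C : comPzRingType)
    (f : mor W (Spec C)) : {rmorphism C -> global_sections W} :=
  global_map f \o @to_sec C (ofull _).

Lemma res_to_sec (C : comPzRingType) (U V : opens (spec C)) (VU : V `<=` U) c :
  spec_res VU (to_sec U c) = to_sec V c.
Proof. by apply: sp_ext => p. Qed.

Lemma germ_to_sec (C : comPzRingType) (p : spec C) (U V : opens (spec C))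
    (Up : oset U p) (Vp : oset V p) c :
  @mkgerm (Spec C) p U Up (to_sec U c) = @mkgerm (Spec C) p V Vp (to_sec V c).
Proof.
apply: (@mkgerm_eq (Spec_rs C) p U V Up Vp _ _ (omeet U V)
  (@omeetl _ _ _) (@omeetr _ _ _)) => //.
exact: etrans (res_to_sec _ _) (esym (res_to_sec _ _)).
Qed.

(** The value of [stalk_map f w] on germs of constants is determined by
    [pullback_hom f]; fractions follow, which is why [pullback_hom f] determines
    [f]. *)
Lemma at_pt_pullback (W : locally_ringed_space) (C : comPzRingType)
    (f : mor W (Spec C)) (w : W) (U : opens (spec C)) (Uw : oset U (f w)) c :
  at_pt w (pullback_hom f c) = stalk_map f w (@mkgerm (Spec C) _ U Uw (to_sec U c)).
Proof.
rewrite (germ_to_sec Uw (I : oset (ofull _) _)).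
rewrite stalk_mapE /at_pt /pullback_hom germE /= /global_map /=.
exact: mkgerm_res.
Qed.

Lemma germ_to_sec_unit (C : comPzRingType) (p : spec C) (U : opens (spec C))
    (Up : oset U p) c :
  is_unit (@mkgerm (Spec C) p U Up (to_sec U c)) <-> ~ sp_ideal p c.
Proof.
split=> [u pc|pc]; last first.
  apply: germ_val_unit; rewrite germ_valE; apply/(local_unit _ (@loc_maxP C p)).
  by move=> /fr_max.
have /(local_unit _ (@loc_maxP C p)) := unit_rmorph (germ_val p) u.
by apply; rewrite germ_valE; apply/fr_max.
Qed.

(** Locality of [stalk_map f w] is what makes this an equivalence: the image of
    [w] can be read off from [pullback_hom f]. *)
Lemma pullback_point (W : locally_ringed_space) (C : comPzRingType)
    (f : mor W (Spec C)) (w : W) c :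
  sp_ideal (f w) c <-> ~ is_unit (at_pt w (pullback_hom f c)).
Proof.
rewrite (@at_pt_pullback _ _ f w (ofull _) I).
split=> [fc u|nu].
  have := local_hom_unit (@lrs_local (Spec C) (f w)) (lrs_local w)
    (@mor_local _ _ f w) u.
  by move=> /(germ_to_sec_unit (I : oset (ofull _) _)).
apply: contrapT => /(germ_to_sec_unit (I : oset (ofull _) _)) u.
by apply: nu; exact: unit_rmorph.
Qed.

Lemma spec_ext (C : comPzRingType) (p q : spec C) :
  (forall c, sp_ideal p c <-> sp_ideal q c) -> p = q.
Proof.
case: p q => p pp [q pq] /= pqE.
have {}pqE : p = q by apply/predeqP.
by case: q / pqE pq => pq; rewrite (Prop_irrelevance pp pq).
Qed.

(** Writing a section locally as a fraction [a/f] in the form [f * s = a], an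
    equation that survives any pull-back. *)
Lemma spec_sec_frac (C : comPzRingType) (U : opens (spec C)) (s : spec_sec U)
    (p : spec C) (Up : oset U p) :
  exists (V : opens (spec C)) (VU : V `<=` U), oset V p /\
    exists a f, (forall q, oset V q -> ~ sp_ideal q f) /\
      to_sec V f * spec_res VU s = to_sec V a.
Proof.
have [V [Vp VU [a [f sV]]]] := sp_funP s (exist _ p Up).
exists V, VU; split=> //; exists a, f; split=> [q Vq|].
  by have [] := sV (exist _ q (VU _ Vq)) Vq.
apply: sp_ext => q; rewrite spec_mulE /=.
have [qf ->] := sV (sub_pts VU q) (proj2_sig q).
rewrite [to_loc _ _]/= [to_loc _ _]/= /fr mkfracM.
apply: (@cls_eq (loc_ringoid (sp_prime (sval q)))).
by apply: (frac_eqv_eq (sp_prime (sval q))) => /=; ring.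
Qed.

Lemma pullback_sec (W : locally_ringed_space) (C : comPzRingType)
    (f : mor W (Spec C)) (w : W) (U V : opens (spec C)) (VU : V `<=` U)
    (Uw : oset U (f w)) (s : spec_sec U) a b :
  oset V (f w) -> to_sec V b * spec_res VU s = to_sec V a ->
  at_pt w (pullback_hom f b) *
    @mkgerm W w (opre (rs_cont f) U) Uw (rs_sh f U s) =
  at_pt w (pullback_hom f a).
Proof.
move=> Vw e; rewrite !(at_pt_pullback Vw) -e.
rewrite -(@stalk_mapE W (Spec C) f w U Uw).
have -> : @mkgerm (Spec C) (f w) U Uw s =
    @mkgerm (Spec C) (f w) V Vw (spec_res VU s).
  exact: (esym (@mkgerm_res (Spec C) (f w) U V Uw Vw VU s)).
by rewrite -!germE -rmorphM -rmorphM.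
Qed.

(** The points agree by [pullback_point]. A section [s] satisfies locally
    [b * s = a] with [b] nonvanishing, so the germ of its pull-back is the unique
    solution of an equation between pull-backs of [a] and [b]. *)
Lemma mor_Spec_ext (W : locally_ringed_space) (C : comPzRingType)
    (f g : mor W (Spec C)) :
  (forall c, pullback_hom f c = pullback_hom g c) -> f = g.
Proof.
move=> fg.
have fgp w : f w = g w.
  by apply: spec_ext => c; rewrite !pullback_point fg.
apply: mor_ext => // U s V Vf Vg; apply: sec_germ_eq => w Vw.
have Uf : oset U (f w) by exact: Vf.
have Ug : oset U (g w) by exact: Vg.
rewrite (@mkgerm_res W w (opre (rs_cont f) U) V Uf Vw Vf).
rewrite (@mkgerm_res W w (opre (rs_cont g) U) V Ug Vw Vg).
have [V' [V'U [V'w [a [b [bn e]]]]]] := spec_sec_frac s Uf.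
have V'g : oset V' (g w) by rewrite -fgp.
apply: (@unit_lreg _ (at_pt w (pullback_hom f b))).
  apply: contrapT => /pullback_point; exact: bn.
by rewrite (pullback_sec Uf V'w e) !fg (pullback_sec Ug V'g e).
Qed.

Lemma open_nbhds_cover (X : topologicalType) (A : set X) :
  (forall x, A x -> exists U : opens X, oset U x /\ U `<=` A) -> open A.
Proof.
move=> h; rewrite openE => x /h [U [Ux UA]].
by apply: (filterS UA); exact: (open_nbhs_nbhs (conj (oset_open U) Ux)).
Qed.

(** * Existence of morphisms to an affine scheme *)

Section LocLift.
Variables (A B : comPzRingType) (p : set A) (pp : prime_ideal p).
Variable h : {rmorphism A -> B}.
Hypothesis hu : forall a, ~ p a -> is_unit (h a).

Definition loc_inv (x : Defs.frac p) : B := projT1 (cid (hu (fdenP x))).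

Lemma loc_invP (x : Defs.frac p) : h (fden x) * loc_inv x = 1.
Proof. by rewrite /loc_inv; case: cid. Qed.

Lemma loc_lift_uniq (x : Defs.frac p) b : h (fden x) * b = h (fnum x) ->
  h (fnum x) * loc_inv x = b.
Proof. by move=> <-; rewrite mulrAC loc_invP mul1r. Qed.

Definition loc_lift : {rmorphism loc pp -> B}.
Proof.
refine (@qlift (loc_ringoid pp) B (fun x => h (fnum x) * loc_inv x) _ _ _ _).
- move=> x y [u [pu e]]; apply: loc_lift_uniq.
  apply: (unit_lreg (hu pu)); apply: (unit_lreg (hu (fdenP y))).
  have {}e := congr1 h e; rewrite !rmorphM in e.
  transitivity (h u * (h (fnum y) * h (fden x)) * (h (fden y) * loc_inv y));
    first by ring.
  by rewrite -e loc_invP; ring.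
- move=> x y; apply: loc_lift_uniq => /=; rewrite !(rmorphD, rmorphM).
  transitivity (h (fnum x) * h (fden y) * (h (fden x) * loc_inv x) +
     h (fnum y) * h (fden x) * (h (fden y) * loc_inv y)); first by ring.
  by rewrite !loc_invP; ring.
- by apply: loc_lift_uniq => /=; rewrite mulr1.
- move=> x y; apply: loc_lift_uniq => /=; rewrite !(rmorphD, rmorphM).
  transitivity (h (fnum x) * (h (fden x) * loc_inv x) *
     (h (fnum y) * (h (fden y) * loc_inv y))); first by ring.
  by rewrite !loc_invP; ring.
Defined.

Lemma loc_lift_frac a f (pf : ~ p f) :
  h f * loc_lift (mkfrac pp a pf) = h a.
Proof.
by rewrite [loc_lift _]qliftE /= mulrCA (@loc_invP (Frac a pf)) mulr1.
Qed.

End LocLift.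

(** Construction of the morphism [W -> Spec C] with a prescribed ring morphism
    [gamma] from [C] to the global sections of [W]. The image of [w] consists of
    the [c] whose germ [gamma c] at [w] is not invertible; [gamma] then extends to
    the local ring at that point ([at_loc]), and a section is pulled back to the
    only section with the germs that [at_loc] prescribes. *)
Section SpecUniversal.
Variables (W : locally_ringed_space) (C : comPzRingType).
Variable gamma : {rmorphism C -> global_sections W}.

Definition at_hom (w : W) : {rmorphism C -> stalk w} := at_pt w \o gamma.

Definition classify (w : W) : spec C :=
  SpecPt (prime_preim (at_hom w) (max_prime (max_idealP (lrs_local w)))).

Lemma classifyP w c : sp_ideal (classify w) c <-> ~ is_unit (at_hom w c).
Proof.
have l := max_idealP (lrs_local w); split=> [m /(local_unit _ l) //|nu].
by apply: contrapT => /(local_unit _ l).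
Qed.

Lemma classify_unit w c : ~ sp_ideal (classify w) c -> is_unit (at_hom w c).
Proof. by move=> h; apply: contrapT => /classifyP. Qed.

Fact classify_cont : continuous classify.
Proof.
apply/continuousP => _ [S ->]; apply: open_nbhds_cover => w.
move=> /= /existsNP [c /not_implyP [Sc /classify_unit /unit_germ]].
move=> [V [VT [Vw [v e]]]]; exists V; split=> // w' Vw' /= /(_ c Sc) /classifyP; apply.
rewrite /at_hom /= /at_pt germE -(@mkgerm_res W w' (ofull _) V I Vw' (fun _ _ => I)).
rewrite -germE; apply: unit_rmorph; exists v; rewrite -e; congr (_ * v).
exact: res_irr.
Qed.

Definition at_loc (w : W) : {rmorphism loc_at (classify w) -> stalk w} :=
  loc_lift (sp_prime (classify w)) (@classify_unit w).

Lemma at_loc_frac w a f (pf : ~ sp_ideal (classify w) f) :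
  at_hom w f * at_loc w (fr a pf) = at_hom w a.
Proof. exact: loc_lift_frac. Qed.

(** The section [t] has at every point the germ that the pull-back of [s] must
    have. Since germs determine sections, local solutions glue to a global one. *)
Definition realizes (U : opens (spec C)) (s : spec_sec U) (V : opens W)
    (VU : V `<=` opre classify_cont U) (t : sec V) :=
  forall w (Vw : oset V w),
    mkgerm Vw t = at_loc w (s (exist _ (classify w) (VU w Vw))).

Lemma realizes_uniq U s V VU t t' :
  @realizes U s V VU t -> @realizes U s V VU t' -> t = t'.
Proof. by move=> h h'; apply: sec_germ_eq => w Vw; rewrite h h'. Qed.

Lemma realizes_res U s (V : opens W) VU t (V' : opens W) (V'V : V' `<=` V)
    (VU' : V' `<=` opre classify_cont U) :
  @realizes U s V VU t -> @realizes U s V' VU' (res V'V t).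
Proof.
move=> h w Vw; rewrite (mkgerm_res (V'V _ Vw) Vw) h; congr (at_loc w _).
exact: pts_irr.
Qed.

(** Near [w] the section is a fraction [a/f]; the germ of [gamma f] at [w] is
    invertible, hence so is [gamma f] on a neighbourhood, and [gamma a] divided by
    [gamma f] is a solution there. *)
Lemma realizes_loc (U : opens (spec C)) (s : spec_sec U) (w : W) :
  oset U (classify w) -> exists (V : opens W) (VU : V `<=` opre classify_cont U),
    oset V w /\ exists t, @realizes U s V VU t.
Proof.
move=> Uw; have [O [Ow OU [a [f sO]]]] := sp_funP s (exist _ _ Uw).
have [pf _] := sO (exist _ _ Uw) Ow.
have [V1 [V1T [V1w [v e]]]] := unit_germ (classify_unit pf).
pose V := omeet V1 (opre classify_cont O).
have VU : V `<=` opre classify_cont U by move=> x [_]; exact: OU.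
exists V, VU; split=> //.
exists (@res _ (ofull _) V (fun _ _ => I) (gamma a) * res (@omeetl _ _ _) v) => w' Vw'.
have [pf' ->] := sO (exist _ (classify w') (VU w' Vw')) (omeetr Vw').
have gT b : mkgerm Vw' (@res _ (ofull _) V (fun _ _ => I) (gamma b)) = at_hom w' b.
  exact: mkgerm_res.
have u := classify_unit pf'; apply: (unit_lreg u); rewrite at_loc_frac -!gT.
rewrite -!germE -rmorphM; congr (germ _ _); rewrite mulrCA.
rewrite [X in _ * X](_ : _ = 1) ?mulr1 //.
have := congr1 (@res _ _ V (@omeetl _ _ _)) e.
by rewrite rmorph1 rmorphM => <-; congr (_ * _); rewrite resT; exact: res_irr.
Qed.

Lemma realizes_ex (U : opens (spec C)) (s : spec_sec U) :
  exists t, @realizes U s (opre classify_cont U) (@subset_refl _ _) t.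
Proof.
pose idx (p : {w : W | oset U (classify w)}) := cid (realizes_loc s (proj2_sig p)).
pose V p := projT1 (idx p).
have VP p : exists VU : V p `<=` opre classify_cont U,
    oset (V p) (sval p) /\ exists t, realizes s VU t.
  exact: projT2 (idx p).
pose VU p := projT1 (cid (VP p)).
have Vin p : oset (V p) (sval p) by have [] := projT2 (cid (VP p)).
have tP p : exists t, realizes s (VU p) t by have [] := projT2 (cid (VP p)).
pose t p := projT1 (cid (tP p)).
have tr p : realizes s (VU p) (t p) := projT2 (cid (tP p)).
have cov : opre classify_cont U `<=` \bigcup_p V p.
  by move=> w Uw; exists (exist _ w Uw) => //; exact: (Vin (exist _ w Uw)).
have [|u uP] := sec_glue VU cov (s := t).
  move=> p q O Op Oq; have OU := subset_trans Op (VU p).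
  by apply: (@realizes_uniq U s O OU); exact: realizes_res.
exists u => w Uw; have [p _ Vw] := cov _ Uw.
rewrite -(mkgerm_res Uw Vw (VU p)) uP (tr p w Vw); congr (at_loc w _).
exact: pts_irr.
Qed.

Definition classify_sec (U : opens (spec C)) (s : spec_sec U) :
  sec (opre classify_cont U) := projT1 (cid (realizes_ex s)).

Lemma classify_secP (U : opens (spec C)) (s : spec_sec U) w
    (Uw : oset (opre classify_cont U) w) :
  mkgerm Uw (classify_sec s) = at_loc w (s (exist _ (classify w) Uw)).
Proof.
apply: etrans (projT2 (cid (realizes_ex s)) w Uw) _; congr (at_loc w _).
exact: pts_irr.
Qed.

Definition classify_sh (U : opens (spec C)) :
  {rmorphism spec_sec U -> sec (opre classify_cont U)}.
Proof.
refine (@mk_rmorphism (spec_sec U) _ (@classify_sec U) _ _ _).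
- move=> s t; apply: sec_germ_eq => w Uw.
  transitivity (germ Uw (classify_sec s) + germ Uw (classify_sec t)).
    apply: etrans (classify_secP _ _) _.
    apply: etrans (rmorphD (at_loc w) _ _) _.
    exact: congr2 (esym (classify_secP _ _)) (esym (classify_secP _ _)).
  exact/esym/(rmorphD (germ Uw)).
- apply: sec_germ_eq => w Uw; transitivity (1 : stalk w).
    apply: etrans (classify_secP _ _) _; exact: (rmorph1 (at_loc w)).
  exact/esym/(rmorph1 (germ Uw)).
- move=> s t; apply: sec_germ_eq => w Uw.
  transitivity (germ Uw (classify_sec s) * germ Uw (classify_sec t)).
    apply: etrans (classify_secP _ _) _.
    apply: etrans (rmorphM (at_loc w) _ _) _.
    exact: congr2 (esym (classify_secP _ _)) (esym (classify_secP _ _)).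
  exact/esym/(rmorphM (germ Uw)).
Defined.

Definition classify_rs : rs_mor W (Spec C).
Proof.
refine (@RsMor W (Spec_rs C) classify classify_cont classify_sh _).
move=> U V VU s; apply: sec_germ_eq => w Vw.
rewrite (@mkgerm_res W w (opre classify_cont U) _ (VU _ Vw) Vw _ (classify_sec s)).
apply: etrans (classify_secP _ _) (etrans _ (esym (classify_secP _ _))).
congr (at_loc w _); exact: pts_irr.
Defined.

Definition classify_mor : mor W (Spec C).
Proof.
refine (@Mor W (Spec C) classify_rs _) => w.
apply: local_homI; elim/stalk_ind=> U Uw s u; apply: germ_val_unit.
rewrite germ_valE; apply/(local_unit _ (@loc_maxP C (classify w))).
move=> [a [f [pf [pa e]]]].
move: u; rewrite stalk_mapE => u.
have {u} : is_unit (at_loc w (s (exist _ (classify w) Uw))).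
  by rewrite -classify_secP.
rewrite e => u; move/classifyP: pa; apply.
rewrite -(at_loc_frac a pf); apply: unitM => //; exact: classify_unit.
Defined.

Lemma pullback_classify c : pullback_hom classify_mor c = gamma c.
Proof.
apply: sec_germ_eq => w []; rewrite [RHS](_ : _ = at_hom w c) //.
rewrite [LHS](@mkgerm_res W w (opre classify_cont (ofull _)) (ofull _) I I
  (fun _ _ => I) (classify_sec (to_sec (ofull _) c))).
rewrite classify_secP /= -[X in at_loc w X]/(fr c (prime_n1 (sp_prime (classify w)))).
by rewrite -[RHS](at_loc_frac c (prime_n1 (sp_prime (classify w)))) rmorph1 mul1r.
Qed.

End SpecUniversal.

(** * Spectra and ring morphisms *)

Lemma global_map_comp (X Y Z : locally_ringed_space) (f : mor Y Z) (g : mor X Y)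
    s : global_map (f \c g) s = global_map g (global_map f s).
Proof.
pose O := opre (rs_cont g) (opre (rs_cont f) (ofull Z)).
pose z : sec O := rs_sh g (opre (rs_cont f) (ofull Z)) (rs_sh f (ofull Z) s).
transitivity (@res X O (ofull X) (fun _ _ => I) z).
  pose O' := opre (rs_cont (f \c g)) (ofull Z).
  change (@res X O' (ofull X) (fun _ _ => I) (@res X O O' (fun _ Ux => Ux) z) =
          @res X O (ofull X) (fun _ _ => I) z).
  rewrite resT; exact: res_irr.
pose fT : ofull Y `<=` opre (rs_cont f) (ofull Z) := fun _ _ => I.
have e := rs_nat g fT (rs_sh f (ofull Z) s).
transitivity (@res X (opre (rs_cont g) (ofull Y)) (ofull X) (fun _ _ => I)
  (rs_sh g (ofull Y) (res fT (rs_sh f (ofull Z) s)))); last by [].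
by rewrite e resT; exact: res_irr.
Qed.

Lemma pullback_comp (V W : locally_ringed_space) (C : comPzRingType)
    (f : mor W (Spec C)) (g : mor V W) c :
  pullback_hom (f \c g) c = global_map g (pullback_hom f c).
Proof.
exact: global_map_comp.
Qed.

Lemma pullback_id (C : comPzRingType) c :
  pullback_hom (idm (Spec C)) c = to_sec (ofull _) c.
Proof.
pose O := opre (@cont_id (Spec C)) (ofull (Spec C)).
change (@res (Spec C) O (ofull _) (fun _ _ => I)
  (@res (Spec C) (ofull _) O (fun _ Ux => Ux) (to_sec (ofull _) c)) =
  to_sec (ofull _) c).
rewrite resT; exact: (@res_id (Spec C)).
Qed.

Lemma pullback_Spec_map (C D : comPzRingType) (phi : {rmorphism C -> D}) c :
  pullback_hom (Spec_map phi) c = to_sec (ofull _) (phi c).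
Proof.
apply: sp_ext => p.
change (loc_map phi (sp_prime (sval p)) (to_loc (prime_preim phi (sp_prime (sval p))) c) =
  to_loc (sp_prime (sval p)) (phi c)).
apply: etrans (@loc_map_frac _ _ phi _ (sp_prime (sval p)) c 1 _) _.
apply: (@cls_eq (loc_ringoid (sp_prime (sval p)))).
by apply: (frac_eqv_eq (sp_prime (sval p))) => /=; rewrite rmorph1.
Qed.

Lemma Spec_map_id (C : comPzRingType) (phi : {rmorphism C -> C}) :
  phi =1 id -> Spec_map phi = idm (Spec C).
Proof.
by move=> e; apply: mor_Spec_ext => c; rewrite pullback_Spec_map pullback_id e.
Qed.

Lemma global_to_sec (W : locally_ringed_space) (C : comPzRingType)
    (f : mor W (Spec C)) c :
  global_map f (to_sec (ofull _) c) = pullback_hom f c.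
Proof. by []. Qed.

(* The morphisms are from now on compared through the lemmas above only;
   unfolding them would make unification explore the structure sheaves. *)
Opaque pullback_hom.

Lemma pullback_comp_Spec (W : locally_ringed_space) (C D : comPzRingType)
    (phi : {rmorphism C -> D}) (f : mor W (Spec D)) c :
  pullback_hom (Spec_map phi \c f) c = pullback_hom f (phi c).
Proof. by rewrite pullback_comp pullback_Spec_map global_to_sec. Qed.

Lemma Spec_map_comp (C D E : comPzRingType) (phi : {rmorphism C -> D})
    (psi : {rmorphism D -> E}) (chi : {rmorphism C -> E}) :
  (forall c, chi c = psi (phi c)) -> Spec_map chi = Spec_map phi \c Spec_map psi.
Proof.
move=> e; apply: mor_Spec_ext => c.
by rewrite pullback_comp_Spec !pullback_Spec_map e.
Qed.

Lemma open_immersion_id (X : locally_ringed_space) : open_immersion (idm X).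
Proof.
split=> [//|U oU|V _].
  rewrite (_ : _ @` U = U) //.
  by apply/seteqP; split=> [y [z Uz <-]|y Uy] //; exists y.
exists (@res X (opre (@cont_id X) V) V (fun _ Ux => Ux)) => s.
  exact: etrans (resT _ _ _) (res_id _ _).
exact: etrans (resT _ _ _) (res_id _ _).
Qed.

Lemma is_scheme_Spec (C : comPzRingType) : is_scheme (Spec C).
Proof.
move=> x; exists C, (idm (Spec C)); split; last by exists x.
exact: open_immersion_id.
Qed.

(** * Fibre products of affine schemes *)

Definition is_pushout (K A B C : comPzRingType) (f : {rmorphism K -> A})
    (g : {rmorphism K -> B}) (i : {rmorphism A -> C}) (j : {rmorphism B -> C}) :=
  [/\ forall c, i (f c) = j (g c),
      forall (S : comPzRingType) (u v : {rmorphism C -> S}),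
        (forall a, u (i a) = v (i a)) -> (forall b, u (j b) = v (j b)) -> u =1 v &
      forall (S : comPzRingType) (u : {rmorphism A -> S}) (v : {rmorphism B -> S}),
        (forall c, u (f c) = v (g c)) -> exists w : {rmorphism C -> S},
          (forall a, w (i a) = u a) /\ forall b, w (j b) = v b].

(** Through [pullback_hom], the universal property of the pushout, applied to the
    ring of global sections of [W], is the universal property of the fibre
    product for morphisms from [W]. *)
Lemma Spec_fibre_product (K A B C : comPzRingType) (f : {rmorphism K -> A})
    (g : {rmorphism K -> B}) (i : {rmorphism A -> C}) (j : {rmorphism B -> C}) :
  is_pushout f g i j ->
  is_fibre_product (Spec_map f) (Spec_map g) (Spec_map i) (Spec_map j).
Proof.
move=> [com uniq ex]; split; first exact: is_scheme_Spec.
  pose h : {rmorphism K -> C} := i \o f.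
  rewrite -(@Spec_map_comp _ _ _ f i h) // -(@Spec_map_comp _ _ _ g j h) //.
move=> W a b _ ab.
have [c|gamma [gi gj]] := ex _ (pullback_hom a) (pullback_hom b).
  by rewrite -!pullback_comp_Spec ab.
have cE c : pullback_hom (classify_mor gamma) c = gamma c := pullback_classify gamma c.
exists (classify_mor gamma); split=> [|h [ha hb]].
  split; apply: mor_Spec_ext => x; rewrite pullback_comp_Spec cE; first exact: gi.
  exact: gj.
apply: mor_Spec_ext => x; rewrite cE; apply: uniq x => x.
  by rewrite gi -ha pullback_comp_Spec.
by rewrite gj -hb pullback_comp_Spec.
Qed.

Section Pushout.
Variables (K A B : comPzRingType).
Variables (f : {rmorphism K -> A}) (g : {rmorphism K -> B}).

(** The pushout is the ring of formal expressions in the elements of [A] and [B]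
    modulo the least congruence [push_eqv] that contains the ring axioms, makes
    both inclusions ring morphisms and identifies the two images of [K]. Its
    universal property holds by induction on expressions and on [push_eqv]. *)
Inductive push_term : Type :=
| PushL of A | PushR of B
| PushN of push_term | PushD of push_term & push_term
| PushM of push_term & push_term.

Inductive push_eqv : push_term -> push_term -> Prop :=
| push_refl x : push_eqv x x
| push_sym x y : push_eqv x y -> push_eqv y x
| push_trans x y z : push_eqv x y -> push_eqv y z -> push_eqv x z
| push_congN x y : push_eqv x y -> push_eqv (PushN x) (PushN y)
| push_congD x x' y y' : push_eqv x x' -> push_eqv y y' ->
    push_eqv (PushD x y) (PushD x' y')
| push_congM x x' y y' : push_eqv x x' -> push_eqv y y' ->
    push_eqv (PushM x y) (PushM x' y')
| pushDA x y z : push_eqv (PushD x (PushD y z)) (PushD (PushD x y) z)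
| pushDC x y : push_eqv (PushD x y) (PushD y x)
| push0D x : push_eqv (PushD (PushL 0) x) x
| pushND x : push_eqv (PushD (PushN x) x) (PushL 0)
| pushMA x y z : push_eqv (PushM x (PushM y z)) (PushM (PushM x y) z)
| pushMC x y : push_eqv (PushM x y) (PushM y x)
| push1M x : push_eqv (PushM (PushL 1) x) x
| pushMD x y z :
    push_eqv (PushM (PushD x y) z) (PushD (PushM x z) (PushM y z))
| pushLD a b : push_eqv (PushL (a + b)) (PushD (PushL a) (PushL b))
| pushLM a b : push_eqv (PushL (a * b)) (PushM (PushL a) (PushL b))
| pushRD a b : push_eqv (PushR (a + b)) (PushD (PushR a) (PushR b))
| pushRM a b : push_eqv (PushR (a * b)) (PushM (PushR a) (PushR b))
| pushR1 : push_eqv (PushR 1) (PushL 1)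
| pushLR c : push_eqv (PushL (f c)) (PushR (g c)).

Definition push_ringoid : ringoid :=
  @Ringoid push_term push_eqv (PushL 0) (PushL 1) PushN PushD PushM
    push_refl push_sym push_trans push_congN push_congD push_congM
    pushDA pushDC push0D pushND pushMA pushMC push1M pushMD.

Definition pushout : comPzRingType := quot push_ringoid.

Definition pushl : {rmorphism A -> pushout}.
Proof.
refine (@mk_rmorphism A pushout (fun a => @cls push_ringoid (PushL a)) _ _ _) => //.
- move=> a b; rewrite -(@clsD push_ringoid).
  by apply: (@cls_eq push_ringoid); exact: pushLD.
- move=> a b; rewrite -(@clsM push_ringoid).
  by apply: (@cls_eq push_ringoid); exact: pushLM.
Defined.

Definition pushr : {rmorphism B -> pushout}.
Proof.
refine (@mk_rmorphism B pushout (fun a => @cls push_ringoid (PushR a)) _ _ _).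
- move=> a b; rewrite -(@clsD push_ringoid).
  by apply: (@cls_eq push_ringoid); exact: pushRD.
- by apply: (@cls_eq push_ringoid); exact: pushR1.
- move=> a b; rewrite -(@clsM push_ringoid).
  by apply: (@cls_eq push_ringoid); exact: pushRM.
Defined.

Section Eval.
Variables (S : comPzRingType) (u : {rmorphism A -> S}) (v : {rmorphism B -> S}).
Hypothesis uv : forall c, u (f c) = v (g c).

Fixpoint push_eval (t : push_term) : S :=
  match t with
  | PushL a => u a | PushR b => v b
  | PushN x => - push_eval x
  | PushD x y => push_eval x + push_eval y
  | PushM x y => push_eval x * push_eval y
  end.

Lemma push_eval_eqv x y : push_eqv x y -> push_eval x = push_eval y.
Proof.
by elim=> //=; intros; rewrite ?(rmorph0, rmorph1, rmorphD, rmorphM) //;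
  (congruence || ring).
Qed.

Definition push_lift : {rmorphism pushout -> S}.
Proof.
by refine (@qlift push_ringoid S push_eval push_eval_eqv _ _ _) => //; exact: rmorph1.
Defined.

End Eval.

Lemma pushoutP : is_pushout f g pushl pushr.
Proof.
split=> [c|S u v uvl uvr|S u v uv].
- by apply: (@cls_eq push_ringoid); exact: pushLR.
- elim/(@quot_ind push_ringoid); elim=> [a|b|x IH|x IHx y IHy|x IHx y IHy].
  + exact: uvl.
  + exact: uvr.
  + by rewrite (@clsN push_ringoid) (rmorphN u) (rmorphN v) IH.
  + by rewrite (@clsD push_ringoid) (rmorphD u) (rmorphD v) IHx IHy.
  + by rewrite (@clsM push_ringoid) (rmorphM u) (rmorphM v) IHx IHy.
- by exists (push_lift uv); split=> x; exact: qliftE.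
Qed.

End Pushout.

Lemma factor_surj (A B S : comPzRingType) (p : {rmorphism A -> B})
    (v : {rmorphism A -> S}) :
  (forall x, exists a, p a = x) -> (forall a, p a = 0 -> v a = 0) ->
  exists w : {rmorphism B -> S}, forall a, w (p a) = v a.
Proof.
move=> ps ker.
have vE a a' : p a = p a' -> v a = v a'.
  move=> e; apply/eqP; rewrite -subr_eq0 -rmorphB ker //.
  by rewrite rmorphB e subrr.
pose h x := v (projT1 (cid (ps x))).
have hE a : h (p a) = v a by apply: vE; exact: projT2 (cid (ps (p a))).
have hD x y : h (x + y) = h x + h y.
  by have [a <-] := ps x; have [b <-] := ps y; rewrite -rmorphD !hE rmorphD.
have hM x y : h (x * y) = h x * h y.
  by have [a <-] := ps x; have [b <-] := ps y; rewrite -rmorphM !hE rmorphM.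
have h1 : h 1 = 1 by rewrite -(rmorph1 p) hE rmorph1.
by exists (mk_rmorphism hD h1 hM) => a; exact: hE.
Qed.

(** The pushout along a surjection [p] is the quotient by the ideal generated by
    the image of the kernel of [p]. The last hypothesis says that the kernel of
    [q] is no larger than that, in a form that avoids generators. *)
Lemma pushout_surj (K A B C : comPzRingType) (f : {rmorphism K -> B})
    (p : {rmorphism K -> A}) (i : {rmorphism A -> C}) (q : {rmorphism B -> C}) :
  (forall a, exists c, p c = a) -> (forall x, exists b, q b = x) ->
  (forall c, q (f c) = i (p c)) ->
  (forall (S : comPzRingType) (v : {rmorphism B -> S}),
     (forall c, p c = 0 -> v (f c) = 0) -> forall b, q b = 0 -> v b = 0) ->
  is_pushout f p q i.
Proof.
move=> ps qs com ker; split=> // [S u v uv _ x|S u v uv].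
  by have [b <-] := qs x; exact: uv.
have [b qb|w wE] := @factor_surj _ _ _ q u qs.
  by apply: (ker S u) => // c pc; rewrite uv pc rmorph0.
exists w; split=> // a; by have [c <-] := ps a; rewrite -com wE uv.
Qed.

(** * Local rings whose maximal ideal is nil *)

(** Such a ring has exactly one prime ideal, so that sections over a nonempty open
    set and germs are just elements of the ring. *)
Definition nil_local (A : comPzRingType) (m : set A) :=
  [/\ ideal m, ~ m 1, forall a, ~ m a -> is_unit a &
      forall a, m a -> exists N, a ^+ N = 0].

Lemma prime_pow (A : comPzRingType) (p : set A) (pp : prime_ideal p) a N :
  p (a ^+ N) -> p a.
Proof.
elim: N => [|N IH]; first by rewrite expr0 => /(prime_n1 pp).
by rewrite exprS => /(primeM pp) [].
Qed.

Section NilLocal.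
Variables (A : comPzRingType) (m : set A) (lnA : nil_local m).

Lemma nil_local_with : local_with m.
Proof. by case: lnA => *; exact: local_withI. Qed.

Lemma nil_local_prime (p : spec A) : sp_ideal p = m.
Proof.
have [idm m1 mu mnil] := lnA; have pp := sp_prime p.
apply/seteqP; split=> a pa.
  apply: contrapT => /mu [b ab]; apply: (prime_n1 pp).
  by rewrite -ab mulrC; exact: (idealM pp).
have [N aN] := mnil a pa; apply: (@prime_pow _ _ pp a N).
by rewrite aN; exact: (ideal0 pp).
Qed.

Lemma nil_local_pt (p q : spec A) : p = q.
Proof. by apply: spec_ext => a; rewrite !nil_local_prime. Qed.

Lemma nil_local_unit (p : spec A) a : is_unit a <-> ~ sp_ideal p a.
Proof. by rewrite nil_local_prime; exact: local_unit nil_local_with. Qed.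

Definition nil_local_point : spec A := SpecPt (max_prime nil_local_with).

Lemma nil_local_to_sec_inj (U : opens (spec A)) (p : spec A) (Up : oset U p) :
  injective (to_sec U).
Proof.
move=> a b /(congr1 (fun s : spec_sec U => s (exist _ p Up))).
move=> /(@eq_cls (loc_ringoid (sp_prime p))) [u [/nil_local_unit uu]].
by move=> /= /(unit_lreg uu); rewrite !mulr1.
Qed.

(** At the only point a section is a fraction whose denominator is not in the
    maximal ideal, hence is invertible in the ring. *)
Lemma nil_local_to_sec_surj (U : opens (spec A)) (p : spec A) (Up : oset U p)
    (s : spec_sec U) : exists a, to_sec U a = s.
Proof.
have [a [f [pf sp]]] := loc_frac (s (exist _ p Up)).
have [g fg] := (nil_local_unit p f).2 pf; exists (a * g).
apply: sp_ext => -[q Up']; have e := nil_local_pt p q; subst q.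
rewrite (pts_irr (sp_fun s) Up' Up) sp; apply: (@cls_eq (loc_ringoid (sp_prime p))).
by apply: (frac_eqv_eq (sp_prime p)) => /=; rewrite mulr1 -mulrA [g * f]mulrC fg mulr1.
Qed.

End NilLocal.

Section StalkMap.
Variables (A : comPzRingType) (p : spec A).

Definition to_stalk : {rmorphism A -> @stalk (Spec A) p} :=
  @at_pt (Spec A) p \o @to_sec A (ofull _).

Lemma to_stalk_unit a : is_unit (to_stalk a) <-> ~ sp_ideal p a.
Proof. exact: (@germ_to_sec_unit A p (ofull _) I a). Qed.

Variables (m : set A) (lnA : nil_local m).

Lemma to_stalk_inj : injective to_stalk.
Proof.
move=> a b /(congr1 (germ_val p)).
rewrite 2!(@germ_valE A p (ofull _) I).
move=> /(@eq_cls (loc_ringoid (sp_prime p))) [u [/(nil_local_unit lnA) uu]].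
by move=> /= /(unit_lreg uu); rewrite !mulr1.
Qed.

Lemma to_stalk_surj (s : @stalk (Spec A) p) : exists a, to_stalk a = s.
Proof.
elim/stalk_ind: s => U Up s.
have [a <-] := nil_local_to_sec_surj lnA Up s.
exists a; exact: germ_to_sec.
Qed.

End StalkMap.

Lemma stalk_map_to_stalk (A B : comPzRingType) (phi : {rmorphism A -> B})
    (q : spec B) a :
  stalk_map (Spec_map phi) q (to_stalk (Spec_map phi q) a) = to_stalk q (phi a).
Proof.
rewrite -[RHS](congr1 (@at_pt (Spec B) q) (pullback_Spec_map phi a)).
by rewrite (@at_pt_pullback _ _ (Spec_map phi) q (ofull _) I).
Qed.

Lemma sh_to_sec (A B : comPzRingType) (phi : {rmorphism A -> B})
    (U : opens (spec A)) a :
  rs_sh (Spec_map phi) U (to_sec U a) = to_sec (opre (@spec_map_cont A B phi) U) (phi a).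
Proof.
apply: sp_ext => p.
apply: etrans (@loc_map_frac _ _ phi _ (sp_prime (sval p)) a 1 _) _.
apply: (@cls_eq (loc_ringoid (sp_prime (sval p)))).
by apply: (frac_eqv_eq (sp_prime (sval p))) => /=; rewrite rmorph1.
Qed.

(** The image of the only point of [Spec B] is the preimage of the maximal ideal,
    which is maximal because [phi] is onto, so it is a closed point; sections lift
    because they are elements of [B]. *)
Lemma closed_immersion_nil_local (A B : comPzRingType) (m : set B)
    (lnB : nil_local m) (phi : {rmorphism A -> B}) :
  (forall b, exists a, phi a = b) -> closed_immersion (Spec_map phi).
Proof.
move=> phis; split=> [p q _|D _|V s y Vy].
- exact: nil_local_pt lnB p q.
- have [[p Dp]|nD] := pselect (exists p, D p); last first.
    suff -> : Spec_map phi @` D = set0 by exact: closed0.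
    by apply/seteqP; split=> // q [p Dp e]; apply: nD; exists p.
  suff -> : Spec_map phi @` D =
      ~` [set q : spec A | ~ phi @^-1` sp_ideal p `<=` sp_ideal q].
    by apply: open_closedC; exists (phi @^-1` sp_ideal p).
  apply/seteqP; split=> [q [p' Dp' <-] /=|q /=].
    by rewrite (nil_local_pt lnB p' p); apply.
  move=> /contrapT pq; exists p => //; apply: spec_ext => a.
  split=> [|qa]; first exact: pq.
  apply: contrapT => /(nil_local_unit lnB) [b ab].
  have [c cb] := phis b; have idq := prime_is_ideal (sp_prime q).
  apply: (prime_n1 (sp_prime q)).
  have -> : 1 = c * a - (c * a - 1) by ring.
  apply: idealB => //; first exact: (idealM idq).
  apply: pq => /=; rewrite rmorphB rmorphM rmorph1 cb mulrC ab subrr.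
  exact: (ideal0 (sp_prime p)).
- exists V, (@subset_refl _ _); split=> //.
  have [b <-] : exists b, to_sec (opre (@spec_map_cont A B phi) V) b = s.
    have [[p Vp]|nV] := pselect (exists p, oset (opre (@spec_map_cont A B phi) V) p).
      exact: (@nil_local_to_sec_surj B m lnB (opre (@spec_map_cont A B phi) V) p Vp s).
    by exists 0; apply: sp_ext => -[p Vp]; case: nV; exists p.
  have [a <-] := phis b; exists (to_sec V a).
  by rewrite sh_to_sec; apply: esym; exact: res_to_sec.
Qed.

Lemma reduced_Spec_field (A : comPzRingType) :
  (forall a : A, a <> 0 -> is_unit a) -> reduced (Spec A).
Proof.
move=> fA U s N sN; apply: sp_ext => p.
have [a [f [pf sp]]] := loc_frac ((s : spec_sec U) p).
have [a0|/fA ua] := pselect (a = 0).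
  rewrite sp a0; apply: (@cls_eq (loc_ringoid (sp_prime (sval p)))).
  by apply: (frac_eqv_eq (sp_prime (sval p))) => /=; rewrite !mul0r.
have us : is_unit ((s : spec_sec U) p).
  apply/(local_unit _ (@loc_maxP A (sval p))); rewrite sp => /fr_max pa.
  have [b ab] := ua; apply: (prime_n1 (sp_prime (sval p))).
  by rewrite -ab mulrC; exact: (idealM (sp_prime (sval p))).
have uX : is_unit (((s : spec_sec U) ^+ N) p).
  elim: (N) => [|M IH]; first by exists 1; rewrite expr0 spec_oneE mulr1.
  by rewrite exprS spec_mulE; exact: unitM.
have := @local_nonunit0 (loc_at (sval p)) (ex_intro _ _ (@loc_maxP A (sval p))).
by case; move: uX; rewrite [_ ^+ N]sN.
Qed.

(** * Finite free algebras and flatness *)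

Definition is_basis (A B : comPzRingType) (phi : {rmorphism A -> B}) n
    (b : 'I_n -> B) :=
  forall x, exists! c : 'I_n -> A, x = \sum_i phi (c i) * b i.

Lemma is_basis_iso (A B A' B' : comPzRingType) (phi : {rmorphism A -> B})
    (phi' : {rmorphism A' -> B'}) (f : {rmorphism A -> A'})
    (g : {rmorphism B -> B'}) n (b : 'I_n -> B) :
  injective g -> (forall y, exists x, g x = y) ->
  injective f -> (forall y, exists x, f x = y) ->
  (forall a, phi' (f a) = g (phi a)) ->
  is_basis phi b -> is_basis phi' (g \o b).
Proof.
move=> gi gs fi fs com bb y; have [x <-] := gs y.
have gE c : \sum_i phi' (f (c i)) * (g \o b) i = g (\sum_i phi (c i) * b i).
  by rewrite rmorph_sum; apply: eq_bigr => i _; rewrite com rmorphM.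
have [c [xc cu]] := bb x; exists (f \o c); split=> [|c' e].
  by rewrite gE -xc.
pose d i := projT1 (cid (fs (c' i))).
have dE : c' = f \o d by apply: funext => i; rewrite /= /d; case: cid.
by rewrite dE (cu d) //; apply: gi; rewrite e dE gE.
Qed.

(** With a finite basis, the tensor [sum x (x) y] vanishes exactly when all its
    coordinates [sum c_i(y) x] do: the coordinates are bilinear maps, and
    conversely every bilinear map is determined by them. Injective linear maps
    detect the vanishing of coordinates. *)
Lemma flat_basis (A B : comPzRingType) (phi : {rmorphism A -> B}) n
    (b : 'I_n -> B) : is_basis phi b -> flat_hom phi.
Proof.
move=> bb N N' u ui s us Q beta bDl bDr bZl bZr.
pose c x := projT1 (cid (bb x)).
have cE x : x = \sum_i phi (c x i) * b i by have [] := projT2 (cid (bb x)).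
have cu x d : x = \sum_i phi (d i) * b i -> c x = d.
  by have [_ h] := projT2 (cid (bb x)) => /h.
have cD x y i : c (x + y) i = c x i + c y i.
  rewrite (cu _ (fun i => c x i + c y i)) // {1}[x]cE {1}[y]cE -big_split.
  by apply: eq_bigr => j _; rewrite rmorphD mulrDl.
have cZ a x i : c (phi a * x) i = a * c x i.
  rewrite (cu _ (fun i => a * c x i)) // {1}[x]cE mulr_sumr.
  by apply: eq_bigr => j _; rewrite rmorphM mulrA.
have coord0 i : \sum_(xb <- s) c xb.2 i *: xb.1 = 0.
  apply: ui; rewrite raddf0 raddf_sum /=.
  have := us N' (fun x y => c y i *: x); rewrite big_map => h.
  rewrite -[RHS]h; first by apply: eq_bigr => xb _; rewrite linearZ.
  - by move=> x y y'; rewrite scalerDr.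
  - by move=> x y y'; rewrite cD scalerDl.
  - by move=> a x y; rewrite !scalerA mulrC.
  - by move=> a x y; rewrite cZ scalerA.
have bs0 x : beta x 0 = 0.
  by apply: (addrI (beta x 0)); rewrite -bDr !addr0.
have b0s x : beta 0 x = 0.
  by apply: (addrI (beta 0 x)); rewrite -bDl !addr0.
transitivity (\sum_i beta (\sum_(xb <- s) c xb.2 i *: xb.1) (b i)); last first.
  by rewrite big1 // => i _; rewrite coord0.
have betal i (t : seq (N * B)) : beta (\sum_(xb <- t) c xb.2 i *: xb.1) (b i) =
    \sum_(xb <- t) beta (c xb.2 i *: xb.1) (b i).
  by elim: t => [|xb t IH]; rewrite ?big_nil // !big_cons bDl IH.
under [RHS]eq_bigr do rewrite betal.
rewrite exchange_big; apply: eq_bigr => -[x y] _ /=.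
rewrite {1}[y]cE (big_morph (beta x) (bDr x) (bs0 x)).
by apply: eq_bigr => i _; rewrite bZr bZl.
Qed.

(** The stalks are the rings themselves, so the basis of [B] over [A] is a basis
    of the stalk. *)
Lemma flat_Spec_map (A B : comPzRingType) (m : set A) (m' : set B)
    (lnA : nil_local m) (lnB : nil_local m') (phi : {rmorphism A -> B}) n
    (b : 'I_n -> B) : is_basis phi b -> flat (Spec_map phi).
Proof.
move=> bb q; apply: (@flat_basis _ _ _ n (to_stalk q \o b)).
apply: (is_basis_iso (f := to_stalk (Spec_map phi q)) _ _ _ _ _ bb).
- exact: to_stalk_inj lnB.
- exact: to_stalk_surj lnB.
- exact: to_stalk_inj lnA.
- exact: to_stalk_surj lnA.
- exact: stalk_map_to_stalk.
Qed.

(** * The residue field at the point of a one-point spectrum *)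

Section ResidueMap.
Variables (A : comPzRingType) (m : set A) (lnA : nil_local m) (y : Spec A).

Definition to_residue : {rmorphism A -> residue_field y} :=
  @residue (Spec A) y \o to_stalk y.

Lemma to_residue_surj x : exists a, to_residue a = x.
Proof.
pose idm := local_ideal (max_idealP (@lrs_local (Spec A) y)).
elim/(@quot_ind (modI_ringoid idm)): x => s.
by have [a <-] := to_stalk_surj lnA s; exists a.
Qed.

Lemma to_residue_eq0 a : to_residue a = 0 <-> m a.
Proof.
rewrite -(nil_local_prime lnA y); split.
  move=> /residue_eq0 nu; apply: contrapT => ya; apply: nu; exact/to_stalk_unit.
by move=> ya; apply/residue_eq0 => /to_stalk_unit.
Qed.

Lemma residue_pointE : residue_point y = Spec_map to_residue.
Proof.
apply: mor_Spec_ext => c; rewrite pullback_Spec_map; exact: sp_ext.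
Qed.

End ResidueMap.

Lemma nil_local_noetherian_scheme (A : comPzRingType) (m : set A) :
  nil_local m -> noetherian A -> noetherian_scheme (Spec A).
Proof.
move=> lnA nA; split; first exact: is_scheme_Spec.
  move=> x; exists A, (idm (Spec A)).
  split; [exact: nA|exact: open_immersion_id|by exists x].
move=> I D f fo cov; have [i Di fi] := cov (nil_local_point lnA) Logic.I.
exists (finmap.fset1 i).
  by move=> j; rewrite finmap.in_fset1 => /eqP ->; rewrite in_setE.
move=> p _; exists i; first by rewrite /= finmap.in_fset1.
by rewrite (nil_local_pt lnA p (nil_local_point lnA)).
Qed.

(** * Truncated polynomial rings *)

Section ModILift.
Variables (A S : comPzRingType) (I : set A) (idI : ideal I).
Variables (h : {rmorphism A -> S}) (hI : forall a, I a -> h a = 0).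

Fact modI_lift_eqv (a b : modI_ringoid idI) : eqv a b -> h a = h b.
Proof. by move=> /hI /eqP; rewrite rmorphB subr_eq0 => /eqP. Qed.

Definition modI_lift : {rmorphism modI idI -> S} :=
  @qlift (modI_ringoid idI) S h modI_lift_eqv
    (@rmorphD _ _ h) (rmorph1 h) (@rmorphM _ _ h).

Lemma modI_liftE a : modI_lift (modI_pi idI a) = h a.
Proof. exact: (@qliftE (modI_ringoid idI)). Qed.

End ModILift.

Section TruncPoly.
Variables (k : fieldType).

(** The multiples of [X^m], described by their coefficients, which makes equality
    in the quotient a statement about finitely many coefficients. *)
Definition low0 (m : nat) : set {poly k} :=
  [set p | forall i, (i < m)%N -> p`_i = 0].

Fact low0_ideal m : ideal (low0 m).
Proof.
split=> [i _|p q p0 q0 i im|p q q0 i im]; first by rewrite coef0.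
  by rewrite coefD p0 ?q0 ?addr0.
rewrite coefM big1 // => j _; rewrite q0 ?mulr0 //.
by apply: leq_ltn_trans im; exact: leq_subr.
Qed.

Definition tpoly m : comPzRingType := modI (low0_ideal m).
Definition tpi m : {rmorphism {poly k} -> tpoly m} := modI_pi (low0_ideal m).

Lemma tpi_ind m (P : tpoly m -> Prop) : (forall p, P (tpi m p)) -> forall x, P x.
Proof. exact: (@quot_ind (modI_ringoid (low0_ideal m))). Qed.

Lemma tpi_eq m (p q : {poly k}) :
  tpi m p = tpi m q <-> forall i, (i < m)%N -> p`_i = q`_i.
Proof.
rewrite modI_pi_eq; split=> h i im; first by apply/eqP; rewrite -subr_eq0 -coefB h.
by rewrite coefB h ?subrr.
Qed.

Lemma tpi_eq0 m p : tpi m p = 0 <-> low0 m p.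
Proof. by rewrite -(rmorph0 (tpi m)) modI_pi_eq subr0. Qed.

Lemma low0_mulXn v (p : {poly k}) : low0 v p -> exists q, p = 'X^v * q.
Proof.
move=> p0; exists (drop_poly v p).
rewrite -[LHS](poly_take_drop v) [take_poly v p](_ : _ = 0) ?add0r 1?mulrC //.
apply/polyP => i; rewrite coef_take_poly coef0; case: ifP => // iv; exact: p0.
Qed.

Lemma low0_Xn m v (q : {poly k}) : (m <= v)%N -> low0 m ('X^v * q).
Proof. by move=> mv i im; rewrite coefXnM (leq_trans im mv). Qed.

Definition tmax m : set (tpoly m) :=
  [set x | exists p : {poly k}, p`_0 = 0 /\ x = tpi m p].

Lemma coef0M (p q : {poly k}) : (p * q)`_0 = p`_0 * q`_0.
Proof. by rewrite coefM big_ord1. Qed.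

Lemma coef0X (p : {poly k}) N : (p ^+ N)`_0 = p`_0 ^+ N.
Proof.
by elim: N => [|N IH]; rewrite ?expr0 ?coef1 // !exprS coef0M IH.
Qed.

Lemma tmax_tpi m (p : {poly k}) : (0 < m)%N -> tmax (tpi m p) <-> p`_0 = 0.
Proof.
move=> m0; split=> [[q [q0 /tpi_eq]]|p0]; last by exists p.
by move=> ->.
Qed.

(** A polynomial with nonzero constant term is a constant [c] minus a nilpotent
    [q], and [c^m - q^m] is a multiple of [c - q]. *)
Lemma tpoly_nil_local m : (0 < m)%N -> nil_local (@tmax m).
Proof.
move=> m0.
have nil (p : {poly k}) : p`_0 = 0 -> tpi m p ^+ m = 0.
  move=> p0; have [|q ->] := @low0_mulXn 1 p; first by case.
  rewrite -rmorphXn exprMn.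
  by rewrite -exprM mul1n; apply/tpi_eq0; exact: low0_Xn.
split.
- split=> [|x y|x y]; first by exists 0; rewrite coef0 rmorph0.
  + move=> [p [p0 ->]] [q [q0 ->]]; exists (p + q).
    by rewrite coefD p0 q0 addr0 rmorphD.
  + elim/tpi_ind: x => p [q [q0 ->]]; exists (p * q).
    by rewrite coef0M q0 mulr0 rmorphM.
- rewrite -(rmorph1 (tpi m)) => /(tmax_tpi _ m0); rewrite coef1 => /eqP.
  by rewrite oner_eq0.
- elim/tpi_ind=> p /(tmax_tpi _ m0) p0.
  pose c := p`_0; pose q := c%:P - p.
  have q0 : q`_0 = 0 by rewrite coefB coefC /= subrr.
  have -> : p = c%:P - q by rewrite /q opprB addrC subrK.
  have /(congr1 (tpi m)) := subrXX (c%:P) q m.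
  rewrite rmorphB (rmorphXn _ m q) nil // subr0 rmorphM => e.
  exists (tpi m (\sum_(i < m) c%:P ^+ (m.-1 - i) * q ^+ i) * tpi m ((c ^+ m)^-1)%:P).
  rewrite mulrA -e -rmorphM -[RHS](rmorph1 (tpi m)); congr (tpi m _).
  rewrite -rmorphXn -polyCM mulfV //; apply: expf_neq0; exact/eqP.
- by move=> _ [p [p0 ->]]; exists m; exact: nil.
Qed.

(** Every ideal is generated by a power of [X], namely the least degree of a
    monomial that occurs in one of its elements: such an element is this power
    times a unit. *)
Lemma tpoly_noetherian m : noetherian (tpoly m).
Proof.
move=> I idI.
(* The alternative [m <= v] covers the zero ideal, generated by [X^m = 0]. *)
pose P v := (m <= v)%N || `[< exists p : {poly k}, I (tpi m p) /\ p`_v != 0 >].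
have [|v Pv vmin] := ex_minnP (P := P); first by exists m; rewrite /P leqnn.
have low p : I (tpi m p) -> low0 v p.
  move=> Ip i iv; apply/eqP; apply: contraTT iv => pi0; rewrite -leqNgt.
  by apply: vmin; apply/orP; right; apply/asboolP; exists p.
have Iv : I (tpi m 'X^v).
  case/orP: (Pv) => [mv|/asboolP [p [Ip pv]]].
    have -> : tpi m 'X^v = 0 by apply/tpi_eq0; rewrite -['X^v]mulr1; exact: low0_Xn.
    exact: ideal0.
  have [m0|m0] := posnP m.
    have -> : tpi m 'X^v = 0 by apply/tpi_eq0 => i; rewrite m0.
    exact: ideal0.
  have [q pE] := low0_mulXn (low p Ip).
  have [|x qx] := (local_unit (tpi m q) (nil_local_with (tpoly_nil_local m0))).2.
    move=> /(tmax_tpi _ m0) q0; move: pv.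
    by rewrite pE coefXnM ltnn subnn q0 eqxx.
  rewrite -[tpi m _]mulr1 -qx mulrA -rmorphM -pE mulrC.
  exact: (idealM idI).
exists [:: tpi m 'X^v]; apply/seteqP; split=> x.
  elim/tpi_ind: x => p Ip J idJ SJ; have [q ->] := low0_mulXn (low p Ip).
  by rewrite mulrC rmorphM; apply: (idealM idJ); apply: SJ; rewrite /= inE.
by apply => // y /=; rewrite inE => /eqP ->.
Qed.

Definition teval m (m0 : (0 < m)%N) : {rmorphism tpoly m -> k}.
Proof.
refine (@modI_lift _ _ _ (low0_ideal m) (horner_eval 0) _).
by move=> p p0; rewrite [LHS](horner_coef0 p) p0.
Defined.

Lemma tevalE m (m0 : (0 < m)%N) (p : {poly k}) : teval m0 (tpi m p) = p`_0.
Proof. by rewrite [LHS]modI_liftE [LHS](horner_coef0 p). Qed.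

Definition ttrunc m m' (mm' : (m' <= m)%N) : {rmorphism tpoly m -> tpoly m'}.
Proof.
refine (@modI_lift _ _ _ (low0_ideal m) (tpi m') _).
by move=> p p0; apply/tpi_eq0 => i im; apply: p0; exact: leq_trans mm'.
Defined.

Lemma ttruncE m m' (mm' : (m' <= m)%N) p : ttrunc mm' (tpi m p) = tpi m' p.
Proof. exact: modI_liftE. Qed.

Section PowerMap.
Variables (n M : nat) (n0 : (0 < n)%N).

Definition subst_pow : {rmorphism {poly k} -> {poly k}} := comp_poly 'X^n.

(** The algebra structure of [k[X]/(X^(nM))] over [k[T]/(T^M)] with [T = X^n]. *)
Definition tpow : {rmorphism tpoly M -> tpoly (n * M)}.
Proof.
refine (@modI_lift _ _ _ (low0_ideal M) (tpi (n * M) \o subst_pow) _).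
move=> p p0; apply/tpi_eq0 => i im; rewrite coef_comp_poly_Xn //.
by case: ifP => // _; rewrite p0 // ltn_divLR // mulnC.
Defined.

Lemma tpowE p : tpow (tpi M p) = tpi (n * M) (p \Po 'X^n).
Proof. exact: modI_liftE. Qed.

Lemma coef_sum_Xn_mul (c : 'I_n -> {poly k}) i :
  (\sum_(j < n) (c j \Po 'X^n) * 'X^j)`_i = (c (Ordinal (ltn_pmod i n0)))`_(i %/ n).
Proof.
rewrite coef_sum (bigD1 (Ordinal (ltn_pmod i n0))) //= big1 ?addr0 => [|j ji].
  rewrite coefMXn ltnNge leq_mod /= coef_comp_poly_Xn //.
  have -> : (i - i %% n)%N = (i %/ n * n)%N by rewrite {1}(divn_eq i n) addnK.
  by rewrite dvdn_mull // mulnK.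
rewrite coefMXn; case: ltnP => // ij; rewrite coef_comp_poly_Xn //.
case: ifP => // /dvdnP [d e]; case/eqP: ji; apply: val_inj => /=.
by rewrite -(subnK ij) e modnMDl modn_small.
Qed.

Definition tXn m (j : 'I_n) : tpoly m := tpi m 'X^j.

Lemma tpi_coef_sum m (d : 'I_n -> k) :
  \sum_i tpi m (d i)%:P * tXn m i = tpi m (\sum_(i < n) d i *: 'X^i).
Proof.
by rewrite rmorph_sum; apply: eq_bigr => i _; rewrite -rmorphM mul_polyC.
Qed.

Lemma coef_sum_Xn (d : 'I_n -> k) (i : 'I_n) :
  (\sum_(j < n) d j *: 'X^j)`_i = d i.
Proof.
rewrite coef_sum (bigD1 i) //= coefZ coefXn eqxx mulr1 big1 ?addr0 // => j ji.
by rewrite coefZ coefXn eq_sym (inj_eq val_inj) (negPf ji) mulr0.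
Qed.

Lemma tpow_sum (c : 'I_n -> {poly k}) :
  \sum_i tpow (tpi M (c i)) * tXn (n * M) i =
  tpi (n * M) (\sum_(j < n) (c j \Po 'X^n) * 'X^j).
Proof.
by rewrite rmorph_sum; apply: eq_bigr => i _; rewrite tpowE -rmorphM.
Qed.

(** The coordinate on [X^j] collects the coefficients in the degrees congruent to
    [j] modulo [n]; [coef_sum_Xn_mul] is the division of the degree by [n]. *)
Lemma tpow_basis : is_basis tpow (@tXn (n * M)).
Proof.
elim/tpi_ind=> p; pose c (j : 'I_n) := \poly_(l < M) p`_(l * n + j).
exists (fun j => tpi M (c j)); split.
  rewrite tpow_sum; apply/tpi_eq => i im; rewrite coef_sum_Xn_mul coef_poly.
  by rewrite ltn_divLR // mulnC im -divn_eq.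
move=> d; have [e ->] : exists e : 'I_n -> {poly k}, d = fun j => tpi M (e j).
  have ex j : exists q, d j = tpi M q by elim/tpi_ind: (d j) => q; exists q.
  exists (fun j => projT1 (cid (ex j))); apply: funext => j.
  exact: projT2 (cid (ex j)).
rewrite tpow_sum => /tpi_eq pe; apply: funext => j; apply/tpi_eq => l lM.
have jn := ltn_ord j.
have lt : (l * n + j < n * M)%N.
  apply: (@leq_trans (l.+1 * n)); first by rewrite mulSn addnC ltn_add2r.
  by rewrite mulnC leq_mul2l lM orbT.
rewrite coef_poly lM pe // coef_sum_Xn_mul divnMDl // divn_small // addn0.
by congr ((e _)`_l); apply: val_inj; rewrite /= modnMDl modn_small.
Qed.

Section Fibre.
Variables (K : comPzRingType) (rho : {rmorphism tpoly M -> K}).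
Hypotheses (M0 : (0 < M)%N) (rhos : forall x, exists a, rho a = x).
Hypothesis rho0 : forall a, rho a = 0 <-> tmax a.

Fact leq_nM : (n <= n * M)%N. Proof. by rewrite leq_pmulr. Qed.

Lemma trunc_tpow p : ttrunc leq_nM (tpow (tpi M p)) = tpi n (p`_0)%:P.
Proof.
rewrite tpowE ttruncE; apply/tpi_eq => i i_n.
rewrite coef_comp_poly_Xn // coefC; case: eqP => [->|/eqP i0].
  by rewrite dvdn0 div0n.
by rewrite gtnNdvd // lt0n.
Qed.

(** Killing [T] in [k[X]/(X^(nM))] leaves [k[X]/(X^n)]: this is the ring of the
    fibre, of dimension [n] over the residue field. The map [rho] is the projection
    to the residue field, described by its surjectivity and its kernel. *)
Lemma fibre_hom : exists i : {rmorphism K -> tpoly n},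
  is_pushout tpow rho (ttrunc leq_nM) i /\ is_basis i (@tXn n).
Proof.
have trunc0 a : rho a = 0 -> ttrunc leq_nM (tpow a) = 0.
  move=> /rho0 [p [p0 ->]]; by rewrite trunc_tpow p0 rmorph0.
have [i iE] := @factor_surj _ _ _ rho (ttrunc leq_nM \o tpow) rhos trunc0.
exists i; split.
  apply: pushout_surj.
  - exact: rhos.
  - by elim/tpi_ind=> p; exists (tpi (n * M) p); exact: ttruncE.
  - by move=> c; rewrite iE.
  - move=> S v vker; elim/tpi_ind=> p; rewrite ttruncE => /tpi_eq0 /low0_mulXn [q ->].
    rewrite rmorphM (rmorphM v) (_ : tpi _ 'X^n = tpow (tpi M 'X)).
      rewrite vker ?mul0r //; apply/rho0/tmax_tpi => //; exact: coefX.
    by rewrite tpowE comp_polyX.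
elim/tpi_ind=> p; exists (fun j : 'I_n => rho (tpi M (p`_j)%:P)).
have iC c : i (rho (tpi M c)) = tpi n (c`_0)%:P by rewrite iE [LHS]trunc_tpow.
split.
  under eq_bigr do rewrite iC coefC /=.
  rewrite tpi_coef_sum; apply/tpi_eq => l ln.
  by rewrite -[l in RHS]/(val (Ordinal ln)) coef_sum_Xn.
move=> d; have [e ->] : exists e : 'I_n -> {poly k}, d = fun j => rho (tpi M (e j)).
  have ex j : exists q, d j = rho (tpi M q).
    have [a <-] := rhos (d j); elim/tpi_ind: a => q; by exists q.
  exists (fun j => projT1 (cid (ex j))); apply: funext => j.
  exact: projT2 (cid (ex j)).
under eq_bigr do rewrite iC.
rewrite tpi_coef_sum => /tpi_eq pe; apply: funext => j; apply/eqP.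
rewrite -subr_eq0 -!rmorphB; apply/eqP/rho0/tmax_tpi => //.
by rewrite coefB coefC /= pe // coef_sum_Xn subrr.
Qed.

End Fibre.
End PowerMap.

(** An element of order one generates the truncated polynomial ring: subtracting
    from [q], of order [v], the right multiple of the [v]-th power of that element
    raises the order, so that descending induction on the order applies. *)
Lemma tpoly_gen m (p : {poly k}) (S : set (tpoly m)) :
  p`_0 = 0 -> p`_1 != 0 -> S (tpi m p) -> (forall c, S (tpi m c%:P)) ->
  (forall x y, S x -> S y -> S (x + y)) ->
  (forall x y, S x -> S y -> S (x * y)) -> forall x, S x.
Proof.
move=> p0 p1 Sp SC SD SM.
have [p' pE] : exists q, p = 'X^1 * q by apply: low0_mulXn; case.
have p'0 : p'`_0 != 0 by move: p1; rewrite pE coefXnM.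
suff H j q : low0 (m - j) q -> S (tpi m q).
  by elim/tpi_ind=> q; apply: (H m); rewrite subnn.
have S0 : S 0 by rewrite -(rmorph0 (tpi m)) -polyC0.
have S1 : S 1 by rewrite -(rmorph1 (tpi m)) -polyC1.
elim: j q => [|j IH] q lq.
  by rewrite (tpi_eq0 m q).2 // -[m]subn0.
have [mj|jm] := leqP m j.
  by apply: IH => i; have /eqP -> : (m - j)%N == 0%N by rewrite subn_eq0.
set v := (m - j.+1)%N in lq; have vE : (m - j)%N = v.+1 by rewrite /v -subSn.
pose c := q`_v / p'`_0 ^+ v.
have -> : q = c%:P * p ^+ v + (q - c%:P * p ^+ v) by rewrite addrC subrK.
rewrite rmorphD; apply: SD.
  rewrite rmorphM rmorphXn; apply: (SM) => //.
  by elim: (v) => [|u IHu]; rewrite ?expr0 // exprS; exact: SM.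
apply: IH => i; rewrite vE ltnS leq_eqVlt.
rewrite coefB mul_polyC coefZ pE exprMn -exprM mul1n coefXnM.
case/orP=> [/eqP ->|iv]; last by rewrite iv mulr0 lq ?subrr.
by rewrite ltnn subnn coef0X /c mulfVK ?subrr // expf_neq0.
Qed.

(** The [N]-th power of an element of order one has order exactly [N]. *)
Lemma tpoly_expr_neq0 m (p : {poly k}) N :
  p`_0 = 0 -> p`_1 != 0 -> (N < m)%N -> tpi m p ^+ N <> 0.
Proof.
move=> p0 p1 Nm; have [p' pE] : exists q, p = 'X^1 * q by apply: low0_mulXn; case.
have p'0 : p'`_0 != 0 by move: p1; rewrite pE coefXnM.
rewrite -rmorphXn => /tpi_eq0 /(_ N Nm) /eqP.
rewrite pE exprMn -exprM mul1n coefXnM ltnn subnn coef0X.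
by apply/negP; rewrite expf_neq0.
Qed.

End TruncPoly.

(** * Power series restricted to a coordinate axis *)

Section AxisRestriction.
Variables (k : fieldType) (r : nat) (e : 'I_r).

Definition axis_mon (i : nat) : 'X_{1..r} := (U_(e) *+ i)%MM.

Lemma mdeg_axis_mon i : mdeg (axis_mon i) = i.
Proof. by rewrite mdegMn mdeg1 mul1n. Qed.

(** All variables but one are set to zero. Products of power series are defined by
    a sum over pairs of monomials; this morphism on polynomials reduces their
    coefficients along the axis to products of one-variable polynomials. *)
Definition axis_eval : {rmorphism {mpoly k[r]} -> {poly k}} :=
  mmap polyC (fun i => if i == e then 'X else 0).

Lemma coef_axis_mmap1 (m : 'X_{1..r}) i :
  (mmap1 (fun i => if i == e then 'X else 0 : {poly k}) m)`_i = (m == axis_mon i)%:R.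
Proof.
have [h|/forallPn [j]] := boolP [forall j, (j != e) ==> (m j == 0)%N]; last first.
  rewrite negb_imply => /andP [je mj].
  rewrite /mmap1 (bigD1 j) //= (negPf je) expr0n (negPf mj) mul0r coef0.
  case: eqP => // mE; move: mj.
  by rewrite mE mulmnE mnm1E (eq_sym e) (negPf je).
have mE : m = axis_mon (m e).
  apply/mnmP => j; rewrite mulmnE mnm1E (eq_sym e).
  have [->|je] := eqVneq j e; first by rewrite mul1n.
  by apply/eqP; have /forallP /(_ j) := h; rewrite je.
have -> : mmap1 (fun i => if i == e then 'X else 0 : {poly k}) m = 'X^(m e).
  rewrite /mmap1 (bigD1 e) //= eqxx big1 ?mulr1 // => j je.
  by have /forallP /(_ j) := h; rewrite je (negPf je) => /eqP ->.
rewrite coefXn; congr (_%:R); congr nat_of_bool.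
apply/eqP/eqP => [->//|mi].
have := congr1 (@mdeg r) mi; rewrite mdeg_axis_mon => <-.
by rewrite [in LHS]mE mdeg_axis_mon.
Qed.

Lemma coef_axis_eval (p : {mpoly k[r]}) i : (axis_eval p)`_i = p@_(axis_mon i).
Proof.
rewrite /axis_eval /= /mmap coef_sum.
under eq_bigr do rewrite mul_polyC coefZ coef_axis_mmap1.
have [mi|mi] := boolP (axis_mon i \in msupp p).
  rewrite (bigD1_seq (axis_mon i)) ?msupp_uniq //= eqxx mulr1.
  by rewrite big1 ?addr0 // => m /negPf ->; rewrite mulr0.
rewrite (memN_msupp_eq0 mi) big_seq big1 // => m mp.
by case: eqP mp mi => [-> ->//|]; rewrite mulr0.
Qed.

Definition axis_poly m (f : powser k r) : {poly k} :=
  \poly_(i < m) coefps f (axis_mon i).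

Lemma coef_axis_mul f g i : coefps (f * g : powser k r) (axis_mon i) =
  \sum_(j < i.+1) coefps f (axis_mon j) * coefps g (axis_mon (i - j)).
Proof.
rewrite (@psM_trunc _ _ i.+1 f g) ?mdeg_axis_mon // -coef_axis_eval rmorphM coefM.
apply: eq_bigr => j _; rewrite !coef_axis_eval !pstruncE // mdeg_axis_mon //.
by rewrite ltnS leq_subr.
Qed.

Definition axis_hom m : {rmorphism powser k r -> tpoly k m}.
Proof.
refine (@mk_rmorphism (powser k r) (tpoly k m) (fun f => tpi k m (axis_poly m f)) _ _ _).
- move=> f g; rewrite -rmorphD; apply/tpi_eq => i im.
  by rewrite coefD !coef_poly im.
- rewrite -(rmorph1 (tpi k m)); apply/tpi_eq => i im.
  rewrite coef_poly im coef1 -[LHS]/(if axis_mon i == 0%MM then 1 else 0).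
  by rewrite -mdeg_eq0 mdeg_axis_mon; case: eqP.
- move=> f g; rewrite -rmorphM; apply/tpi_eq => i im.
  rewrite coef_poly im coef_axis_mul coefM; apply: eq_bigr => j _.
  have jm : (j < m)%N by apply: leq_ltn_trans im; rewrite -ltnS.
  have ijm : (i - j < m)%N by apply: leq_ltn_trans im; exact: leq_subr.
  by rewrite !coef_poly jm ijm.
Defined.

Lemma axis_homE m f : axis_hom m f = tpi k m (axis_poly m f).
Proof. by []. Qed.

Lemma coef_axis_poly m f i : (i < m)%N -> (axis_poly m f)`_i = coefps f (axis_mon i).
Proof. by move=> im; rewrite coef_poly im. Qed.

Lemma axis_hom_C m c : axis_hom m (psC r c) = tpi k m c%:P.
Proof.
rewrite axis_homE; apply/tpi_eq => i im; rewrite coef_axis_poly // coefC /=.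
by rewrite -mdeg_eq0 mdeg_axis_mon.
Qed.

End AxisRestriction.

(** * The completion and the existence of a parameter *)

Section FiniteGeneration.
Variables (A : comPzRingType) (s : seq A).

Lemma ideal_gen_seq a : ideal_gen [set` s] a ->
  exists c : 'I_(size s) -> A, a = \sum_i c i * s`_i.
Proof.
pose J := [set a | exists c : 'I_(size s) -> A, a = \sum_i c i * s`_i].
move=> /(_ J); apply => [|x /= xs].
  split=> [|_ _ [c ->] [d ->]|x _ [c ->]].
  - by exists (fun _ => 0); rewrite big1 // => i _; rewrite mul0r.
  - exists (fun i => c i + d i); rewrite -big_split.
    by apply: eq_bigr => i _; rewrite mulrDl.
  - by exists (fun i => x * c i); rewrite mulr_sumr; apply: eq_bigr => i _; rewrite mulrA.
have lt : (index x s < size s)%N by rewrite index_mem.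
exists (fun i => (i == Ordinal lt)%:R).
rewrite (bigD1 (Ordinal lt)) //= eqxx mul1r nth_index // big1 ?addr0 // => i /negPf ->.
by rewrite mul0r.
Qed.

Variable P : set A.
Hypothesis PE : P = ideal_gen [set` s].

Lemma ideal_pow_step m a : ideal_pow P m.+1 a ->
  exists c : 'I_(size s) -> A,
    (forall i, ideal_pow P m (c i)) /\ a = \sum_i c i * s`_i.
Proof.
have idm := ideal_powP P m.
pose J := [set a | exists c : 'I_(size s) -> A,
  (forall i, ideal_pow P m (c i)) /\ a = \sum_i c i * s`_i].
move=> /(_ J); apply; first split=> [|_ _ [c [cP ->]] [d [dP ->]]|x _ [c [cP ->]]].
- exists (fun _ => 0); split=> [_|]; first exact: (ideal0 idm).
  by rewrite big1 // => i _; rewrite mul0r.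
- exists (fun i => c i + d i); split=> [i|]; first exact: (idealD idm).
  by rewrite -big_split; apply: eq_bigr => i _; rewrite mulrDl.
- exists (fun i => x * c i); split=> [i|]; first exact: (idealM idm).
  by rewrite mulr_sumr; apply: eq_bigr => i _; rewrite mulrA.
move=> _ [f [fP ->]]; rewrite big_ord_recl.
have := fP ord0; rewrite {1}PE => /ideal_gen_seq [d ->].
exists (fun i => d i * \prod_(i < m) f (lift ord0 i)); split=> [i|].
  apply: (idealM idm) => I idI SI; apply: SI.
  by exists (fun i => f (lift ord0 i)).
by rewrite mulr_suml; apply: eq_bigr => i _; rewrite mulrAC.
Qed.

Lemma ideal_powS m a : ideal_pow P m.+1 a -> ideal_pow P m a.
Proof.
move=> /ideal_pow_step [c [cP ->]].
apply: big_ind => [|x y|i _]; first exact: (ideal0 (ideal_powP P m)).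
  exact: (idealD (ideal_powP P m)).
by rewrite mulrC; apply: (idealM (ideal_powP P m)).
Qed.

Lemma completion_sumE I (t : seq I) (F : I -> completion P) m :
  (\sum_(i <- t) F i) m = \sum_(i <- t) F i m.
Proof. by elim: t => [|i t IH]; rewrite ?big_nil // !big_cons -IH. Qed.

(** The kernel of the projection of the completion onto [A / P] is generated by
    the generators of [P]: a sequence [b] representing [v] is a sum of increments
    [d m] in [P^(m+1)], each is expanded on the generators with coefficients in
    [P^m], and the coefficients of each generator are summed. *)
Lemma completion_gen (v : completion P) : v 1%N = 0 ->
  exists w : 'I_(size s) -> completion P,
    v = \sum_(i < size s) to_completion P (s`_i) * w i.
Proof.
move=> v1; have comp := sp_funP v : compatible v.
(* The representative [b m] is correct at the levels [m.+1] and [m.+2], so that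
   the increment [d m] lies in [P^(m+1)] also for [m = 0], where [v 1 = 0]. *)
pose b m := projT1 (cid (comp m.+1)).
have bP m : modI_pi (ideal_powP P m.+1) (b m) = v m.+1 /\
  modI_pi (ideal_powP P m.+2) (b m) = v m.+2 by exact: projT2 (cid (comp m.+1)).
have bE m : modI_pi (ideal_powP P m) (b m) = v m.
  have [a [am aS]] := comp m.
  have h : ideal_pow P m.+1 (b m - a).
    by apply/(modI_pi_eq (ideal_powP P m.+1)); exact: etrans (bP m).1 (esym aS).
  by rewrite -am; apply/modI_pi_eq; exact: ideal_powS h.
pose d m := if m is m'.+1 then b m - b m' else b 0%N.
have dP m : ideal_pow P m.+1 (d m).
  case: m => [|l] /=; last first.
    apply/(modI_pi_eq (ideal_powP P l.+2)).
    exact: etrans (bP l.+1).1 (esym (bP l).2).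
  rewrite -[b 0%N]subr0; apply/(modI_pi_eq (ideal_powP P 1)).
  by rewrite rmorph0; exact: etrans (bP 0%N).1 v1.
have dsum m : \sum_(l < m.+1) d l = b m.
  elim: m => [|m IH]; first by rewrite big_ord1.
  by rewrite big_ord_recr IH /= addrC subrK.
pose c m := projT1 (cid (ideal_pow_step (dP m))).
have cP m i : ideal_pow P m (c m i).
  by have [h _] := projT2 (cid (ideal_pow_step (dP m))); exact: h.
have cE m : d m = \sum_i c m i * s`_i.
  by have [_ h] := projT2 (cid (ideal_pow_step (dP m))).
pose w0 i m := modI_pi (ideal_powP P m) (\sum_(l < m) c l i).
have w0c i : compatible (w0 i).
  move=> m; exists (\sum_(l < m.+1) c l i); split=> //.
  by apply/modI_pi_eq; rewrite big_ord_recr /= addrAC subrr add0r.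
exists (fun i => @Sp _ _ (completion_subprod P) _ (w0c i)).
apply: sp_ext => m; rewrite completion_sumE.
rewrite -[LHS]bE.
transitivity (\sum_(i < size s)
  modI_pi (ideal_powP P m) (s`_i * \sum_(l < m) c l i)); last first.
  by apply: eq_bigr => i _; rewrite rmorphM.
rewrite -rmorph_sum; apply/modI_pi_eq.
have -> : \sum_(i < size s) s`_i * \sum_(l < m) c l i = \sum_(l < m) d l.
  under [RHS]eq_bigr do rewrite cE.
  rewrite exchange_big; apply: eq_bigr => i _; rewrite mulrC mulr_suml //.
rewrite -dsum big_ord_recr /= addrAC subrr add0r; exact: ideal_powS.
Qed.

End FiniteGeneration.

Section PowerSeriesCompletion.
Variables (k : fieldType) (r : nat) (R : comAlgType k) (P : set R).
Hypotheses (localR : local_with P) (noethR : noetherian R).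
Variables (psi : {rmorphism completion P -> powser k r}).
Hypotheses (psi_bij : bijective psi)
  (psiC : forall c : k, psi (to_completion P c%:A) = psC r c).
Variable e : 'I_r.

Definition jet m : {rmorphism R -> tpoly k m} :=
  axis_hom k e m \o psi \o to_completion P.

Definition jet_poly m (a : R) : {poly k} := axis_poly e m (psi (to_completion P a)).

Lemma jetE m a : jet m a = tpi k m (jet_poly m a).
Proof. by []. Qed.

Lemma jet_C m c : jet m c%:A = tpi k m c%:P.
Proof. by rewrite [LHS]/= psiC; exact: axis_hom_C. Qed.

Lemma coef_jet_poly m a i : (i < m)%N ->
  (jet_poly m a)`_i = coefps (psi (to_completion P a)) (axis_mon e i).
Proof. exact: coef_axis_poly. Qed.

(** The constant term of the power series of an element of [R]. *)
Definition augment : {rmorphism R -> k} := teval k (ltn0Sn 0) \o jet 1.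

Lemma augmentE m a : (0 < m)%N -> (jet_poly m a)`_0 = augment a.
Proof.
move=> m0; apply: etrans (coef_jet_poly a m0) (esym _).
apply: etrans (tevalE (ltn0Sn 0) (jet_poly 1 a)) _; exact: coef_jet_poly.
Qed.

Lemma augment_C c : augment c%:A = c.
Proof. by rewrite [LHS](congr1 _ (jet_C 1 c)) tevalE coefC. Qed.

(** An element with zero constant term is not invertible, so it lies in [P]; and a
    nonzero constant is invertible, so it does not. In particular [R/P] is [k]. *)
Lemma augment_eq0 a : augment a = 0 <-> P a.
Proof.
have nu b : augment b = 0 -> P b.
  move=> b0; apply: contrapT => /(local_unit _ localR) /(unit_rmorph augment).
  by rewrite b0 => -[c /eqP]; rewrite mul0r eq_sym oner_eq0.
split=> [|Pa]; first exact: nu.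
have PaC : P (augment a)%:A.
  have -> : (augment a)%:A = a - (a - (augment a)%:A) by rewrite opprB addrC subrK.
  apply: (idealB (local_ideal localR)) => //; apply: nu.
  by rewrite rmorphB augment_C subrr.
apply: contrapT => /eqP a0.
have /(local_unit _ localR) // : is_unit ((augment a)%:A : R).
exists ((augment a)^-1)%:A.
by rewrite -!in_algE -rmorphM mulfV // rmorph1.
Qed.

(** If no element of [P] had a linear term along the axis, then neither would any
    element of the ideal generated by [P] in the completion, by the product rule.
    By [completion_gen] this ideal contains the difference between the coordinate
    of the axis and some [a] in [R]. Comparing constant terms, [a] lies in [P]; then
    the linear term of the coordinate would be zero. *)
Lemma exists_parameter : exists2 a, P a &
  forall m, (1 < m)%N -> (jet_poly m a)`_1 != 0.
Proof.
apply: contrapT => no.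
have jet0 a : P a -> jet 2 a = 0.
  move=> Pa; rewrite jetE; apply/tpi_eq0 => -[|[|//]] _.
    by rewrite augmentE //; apply/augment_eq0.
  apply/eqP; apply: contrapT => /negP a1; apply: no; exists a => // m m1.
  by rewrite coef_jet_poly // -(@coef_jet_poly 2).
have [s PE] := noethR (local_ideal localR).
have [phi phiK psiK] := psi_bij.
pose x : powser k r := PowSer (fun m => (m == axis_mon e 1)%:R).
pose v := phi x.
have [a [a0 a1]] : exists a, _ /\ modI_pi (ideal_powP P 1) a = v 1%N :=
  (sp_funP v : compatible v) 0%N.
have [|w uE] := @completion_gen R s P PE (v - to_completion P a).
  by rewrite -[LHS]/(v 1%N - modI_pi (ideal_powP P 1) a) a1 subrr.
have u0 : axis_hom k e 2 (psi (v - to_completion P a)) = 0.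
  rewrite uE !rmorph_sum big1 // => i _; rewrite !rmorphM.
  have : jet 2 s`_i = 0.
    by apply: jet0; rewrite PE => I idI; apply; rewrite /= mem_nth.
  by move=> h; rewrite -[axis_hom k e 2 (psi _)]/(jet 2 s`_i) h mul0r.
have vE : axis_hom k e 2 (psi v) = jet 2 a.
  by apply/eqP; rewrite -subr_eq0 -!rmorphB u0.
have coefx i : (i < 2)%N -> (axis_poly e 2 (psi v))`_i = (i == 1%N)%:R.
  move=> i2; rewrite coef_axis_poly // /v psiK /x /=; congr (nat_of_bool _)%:R.
  apply/eqP/eqP => [|->//] h.
  by rewrite -(mdeg_axis_mon e i) h mdeg_axis_mon.
move: vE; rewrite jetE axis_homE => vE.
have Pa : P a.
  apply/augment_eq0; rewrite -(@augmentE 2) //.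
  by move/tpi_eq: vE => /(_ 0%N isT) <-; rewrite coefx.
have := jet0 a Pa; rewrite jetE -vE => /tpi_eq0 /(_ 1%N isT) /eqP.
by rewrite coefx // oner_eq0.
Qed.

End PowerSeriesCompletion.

(** * Functions without invertible germs *)

(** An ideal maximal among those that contain no power of [a] is prime. As the
    empty set has to be allowed in order to start from the empty chain, it is an
    additional member of the family to which Zorn's lemma is applied. *)
Lemma nilradical (A : comPzRingType) (a : A) :
  (forall p : spec A, sp_ideal p a) -> exists N, a ^+ N = 0.
Proof.
move=> ap; apply: contrapT => nil.
pose Q (J : set A) := J = set0 \/ (ideal J /\ forall N, ~ J (a ^+ N)).
have [F FQ Ftot|m [Qm mmax]] := @Zorn_bigcup A Q.
  have [F0|/existsNP [J /not_implyP [FJ J0]]] :=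
    pselect (forall J, F J -> J = set0).
    by left; apply/seteqP; split=> // x [J /F0 ->].
  right; have [//|[idJ _]] := FQ _ FJ.
  split; last first.
    by move=> N [X FX XN]; have [X0|[_ h]] := FQ _ FX; [rewrite X0 in XN|exact: h XN].
  split=> [|x y [X FX Xx] [Y FY Yy]|x y [X FX Xy]].
  - by exists J => //; exact: ideal0 idJ.
  - have [Z [FZ Zx Zy]] : exists Z, [/\ F Z, Z x & Z y].
      by have [XY|YX] := Ftot _ _ FX FY; [exists Y|exists X];
        split=> //; [exact: XY|exact: YX].
    have [Z0|[idZ _]] := FQ _ FZ; first by rewrite Z0 in Zx.
    by exists Z => //; exact: (idealD idZ).
  - have [X0|[idX _]] := FQ _ FX; first by rewrite X0 in Xy.
    by exists X => //; exact: (idealM idX).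
have [m0|[idm ma]] := Qm.
  apply: (mmax [set 0]); last first.
    right; split=> [|N /= aN]; last by apply: nil; exists N.
    split=> [//|x y /= -> ->|x y /= ->]; [exact: addr0|exact: mulr0].
  by rewrite m0; split=> // /(_ 0); apply.
have big x : ~ m x -> exists N c, m (a ^+ N - c * x).
  move=> mx; pose J := [set y | exists c, m (y - c * x)].
  apply: contrapT => no; apply: (mmax J); last first.
    right; split=> [|N [c h]]; last by apply: no; exists N, c.
    split=> [|y z [c h] [d h']|y z [c h]].
    - by exists 0; rewrite mul0r subrr; exact: ideal0 idm.
    - exists (c + d); have -> : y + z - (c + d) * x = (y - c * x) + (z - d * x) by ring.
      exact: idealD idm _ _ h h'.
    - exists (y * c); have -> : y * z - y * c * x = y * (z - c * x) by ring.
      exact: idealM idm _ _ h.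
  split=> [y my|h]; first by exists 0; rewrite mul0r subr0.
  by apply: mx; apply: h; exists 1; rewrite mul1r subrr; exact: ideal0 idm.
have pm : prime_ideal m.
  split=> [//|m1|x y mxy]; first by apply: (ma 0%N); rewrite expr0.
  apply: contrapT => /not_orP [/big [M [c h]] /big [N [d h']]].
  apply: (ma (M + N)%N).
  have -> : a ^+ (M + N) = a ^+ N * (a ^+ M - c * x) + (c * x) * (a ^+ N - d * y)
    + c * d * (x * y) by rewrite exprD; ring.
  apply: (idealD idm); first apply: (idealD idm); exact: (idealM idm).
by apply: (ma 1%N); rewrite expr1; exact: (ap (SpecPt pm)).
Qed.

Lemma unit_factor (A : comPzRingType) (a b : A) : is_unit (a * b) -> is_unit b.
Proof. by move=> [c abc]; exists (a * c); rewrite mulrCA mulrA. Qed.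

Lemma spec_secX (A : comPzRingType) (U : opens (spec A)) (s : spec_sec U) N p :
  (s ^+ N) p = (s p) ^+ N.
Proof.
elim: N => [|N IH]; first by rewrite !expr0 spec_oneE.
by rewrite !exprS spec_mulE IH.
Qed.

Lemma at_pt_global (X Y : locally_ringed_space) (f : mor X Y) (x : X)
    (s : global_sections Y) :
  at_pt x (global_map f s) = stalk_map f x (at_pt (f x) s).
Proof.
rewrite [RHS](@stalk_mapE X Y f x (ofull Y) I s).
exact: (@mkgerm_res X x (opre (rs_cont f) (ofull Y)) (ofull X) I I (fun _ _ => I)).
Qed.

Definition sub_full (X : topologicalType) (U : opens X) : U `<=` ofull X :=
  fun _ _ => I.

(** Locally [f * s = b] with [f] invertible, so [b] vanishes at all points of a
    basic open set [D(g)]; then [b * g] vanishes at all points and is nilpotent. *)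
Lemma spec_locally_nilpotent (A : comPzRingType) (s : spec_sec (ofull (spec A))) :
  (forall p : Spec A, ~ is_unit (@at_pt (Spec A) p s)) ->
  forall q : spec A, exists (D : opens (spec A)) (N : nat), oset D q /\
    spec_res (@sub_full _ D) s ^+ N = 0.
Proof.
move=> nu q.
have [V [VT [Vq [b [f [fV e]]]]]] := spec_sec_frac s (I : oset (ofull _) q).
have bV p : oset V p -> sp_ideal p b.
  move=> Vp; apply: contrapT => pb; apply: (nu p).
  pose G : {rmorphism spec_sec V -> @stalk (Spec A) p} := @germ (Spec A) p V Vp.
  have uG : is_unit (G (to_sec V b)) by exact: (germ_to_sec_unit Vp b).2.
  have sG : at_pt (W := Spec A) p s = G (spec_res VT s).
    exact: (esym (@mkgerm_res (Spec A) p (ofull _) V I Vp VT s)).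
  by rewrite sG; move: uG; rewrite -e (rmorphM G); exact: unit_factor.
have [S VE] := oset_open V.
have := Vq; rewrite VE /= => /existsNP [g /not_implyP [Sg qg]].
have [N bgN] : exists N, (b * g) ^+ N = 0.
  apply: nilradical => p; have idp := prime_is_ideal (sp_prime p).
  have [pg|pg] := pselect (sp_ideal p g); first exact: (idealM idp).
  by rewrite mulrC; apply: (idealM idp); apply: bV; rewrite VE /= => /(_ g Sg).
exists (basic_open g), N; split=> //.
apply: sp_ext => -[p pg]; rewrite spec_secX.
have Vp : oset V p by rewrite VE /= => /(_ g Sg).
set y := (X in X ^+ N).
have yE : to_loc (sp_prime p) f * y = to_loc (sp_prime p) b.
  have := congr1 (fun u : spec_sec V => u (exist _ p Vp)) e.
  rewrite spec_mulE => e'; apply: etrans e'; congr (_ * _).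
  exact: (pts_irr (sp_fun s)).
have u : is_unit (to_loc (sp_prime p) (f * g) ^+ N).
  rewrite -rmorphXn.
  apply/(local_unit _ (@loc_maxP A p)) => /fr_max /(prime_pow (sp_prime p)).
  by move=> /(primeM (sp_prime p)) [] //; exact: fV.
apply: (unit_lreg u); rewrite mulr0 -exprMn rmorphM mulrAC yE -rmorphM -rmorphXn bgN.
exact: rmorph0.
Qed.

(** An open immersion identifies sections over a chart with sections over its
    image, so the affine case applies to the pull-back of [s] to each chart. *)
Lemma scheme_locally_nilpotent (X : locally_ringed_space) (s : global_sections X) :
  is_scheme X -> (forall x : X, ~ is_unit (at_pt x s)) ->
  forall x : X, exists (U : opens X) (N : nat), oset U x /\
    res (@sub_full _ U) s ^+ N = 0.
Proof.
move=> sX nu x; have [A [j [[ji jo jb] [q _ <-]]]] := sX x.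
pose s' : spec_sec (ofull (spec A)) := global_map j s.
have [p|D [N [Dq DN]]] := @spec_locally_nilpotent A s' _ q.
  rewrite /s' at_pt_global => u; apply: (nu (j p)).
  exact: (local_hom_unit (@lrs_local X (j p)) (@lrs_local (Spec A) p)
    (@mor_local _ _ j p) u).
pose U := Opens (jo D (oset_open D)).
exists U, N; split; first by exists q.
have [|g jK _] := jb U; first by move=> _ [p _ <-]; exists p.
apply: (can_inj jK); rewrite rmorphXn rmorph0 rs_nat.
have UD : opre (rs_cont j) U `<=` D by move=> p [p' Dp' /ji <-].
have := congr1 (@res (Spec A) D _ UD) DN; rewrite rmorphXn rmorph0 => <-.
congr (_ ^+ N); rewrite /s' /global_map.
apply: etrans _ (esym (@resT (Spec A) (ofull _) D _ _ UD (global_map j s))).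
apply: etrans _ (esym (resT _ _ _)); exact: res_irr.
Qed.

(** * Families over a quasi-compact base *)

(** The scheme [Z] is homeomorphic to a closed subset of the image of the
    quasi-compact [T]: the open sets of points of [T] whose image is not in
    [i (~ U N)] cover [T]. *)
Lemma quasi_compact_exhaustion (Z W T : locally_ringed_space) (i : mor Z W)
    (f : mor T W) (U : nat -> set Z) :
  closed_immersion i -> quasi_compact T -> range i `<=` range f ->
  (forall N, open (U N)) -> (forall M N, (M <= N)%N -> U M `<=` U N) ->
  (forall z, exists N, U N z) -> exists N, U N = setT.
Proof.
move=> [ii ic _] qT ran Uo Um Uc.
pose V N := f @^-1` (~` (i @` (~` U N))).
have [N _||D _ cov] := qT nat setT V.
- apply: (continuousP _).1; first exact: rs_cont.
  by apply: closed_openC; apply: ic; exact: open_closedC.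
- move=> t _; have [[z _ zt]|nt] := pselect (range i (f t)).
    have [N UN] := Uc z; exists N => //= -[z' nz' e].
    by apply: nz'; rewrite (ii z' z) // e.
  by exists 0%N => //= -[z _ e]; apply: nt; exists z.
exists (\max_(j <- finmap.enum_fset D) j); apply/seteqP; split=> // z _.
have [t _ tz] := ran (i z) (ex_intro2 _ _ z I erefl).
have [j /= jD] := cov t I.
rewrite /V /preimage /= tz => nU.
apply: (Um j); first exact: (@leq_bigmax_seq _ _ xpredT id j).
by apply: contrapT => nUz; apply: nU; exists z.
Qed.

Section Support.
Variables (k : fieldType) (R : comAlgType k) (P : set R) (localR : local_with P).
Variables (eps : {rmorphism R -> k}).
Hypotheses (epsC : forall c, eps c%:A = c) (eps0 : forall a, eps a = 0 <-> P a).

Let pi := modI_pi (local_ideal localR).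

(** The inverse of the isomorphism from [k] to [R/P]. *)
Definition residue_to_k : {rmorphism modI (local_ideal localR) -> k} :=
  modI_lift (local_ideal localR) (fun a => (eps0 a).2).

Lemma residue_to_kE a : residue_to_k (pi a) = eps a.
Proof. exact: modI_liftE. Qed.

Lemma residue_to_kK x : pi (residue_to_k x)%:A = x.
Proof.
elim/(@quot_ind (modI_ringoid (local_ideal localR))): x => a.
rewrite -[cls a]/(pi a) residue_to_kE; apply/modI_pi_eq/eps0.
by rewrite rmorphB epsC subrr.
Qed.

Lemma Spec_k_RP : (Spec_k R \c Spec_RP localR) \c Spec_map residue_to_k = idm (Spec k).
Proof.
rewrite /Spec_k /Spec_RP.
rewrite -mcompA.
apply: mor_Spec_ext => c.
rewrite pullback_comp_Spec.
rewrite pullback_comp_Spec.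
rewrite pullback_Spec_map pullback_id.
congr (to_sec _ _).
exact: etrans (residue_to_kE _) (epsC _).
Qed.

Lemma Spec_RP_k : Spec_map residue_to_k \c (Spec_k R \c Spec_RP localR) =
  idm (Spec (modI (local_ideal localR))).
Proof.
rewrite /Spec_k /Spec_RP.
apply: mor_Spec_ext => x.
rewrite 2!pullback_comp_Spec pullback_Spec_map pullback_id.
congr (to_sec _ _); exact: residue_to_kK.
Qed.

(** Base change of [T] along the isomorphism from [Spec (R/P)] to [Spec k] is
    [T]: the universal property gives a section of [q1], and this section is
    inverse to [q1] because both composites have the same projections. *)
Lemma base_change_k (T Q : locally_ringed_space) (t : mor T (Spec k))
    (q1 : mor Q T) (q2 : mor Q (Spec (modI (local_ideal localR)))) :
  is_scheme T -> is_fibre_product t (Spec_k R \c Spec_RP localR) q1 q2 ->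
  exists h : mor T Q, forall q, h (q1 q) = q.
Proof.
move=> sT [sQ com univ].
have [|h [[h1 h2] _]] := univ T (idm T) (Spec_map residue_to_k \c t) sT.
  by rewrite mcompA Spec_k_RP mcomp_idl mcomp_idr.
have [g [_ gu]] := univ Q q1 q2 sQ com.
have e1 : g = idm Q by apply: gu; rewrite !mcomp_idr.
have e2 : g = h \c q1.
  apply: gu; rewrite !mcompA h1 h2 mcomp_idl; split=> //.
  by rewrite -mcompA com mcompA Spec_RP_k mcomp_idl.
exists h => q; have := congr1 (fun m : mor Q Q => m q) e2; rewrite e1; exact: esym.
Qed.

(** The reduced family factors through [Spec (R/P)], so [p] pulls back to zero on
    it and has no invertible germ on [Z], whose points are those of the reduced
    family. The points where the [N]-th power vanishes locally form an increasing
    sequence of open sets that exhausts [Z]. *)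
Lemma support_nilpotent (T : kscheme k) (Z : closed_sub R T) (p : R) :
  quasi_compact T -> red_supported localR Z -> P p ->
  exists N, pullback_hom (cs_toR Z) p ^+ N = 0.
Proof.
move=> qT [Zr [j [[_ _ _ jr] [Q [q1 [q2 [c [h [fp c1 c2 comm]]]]]]]]] Pp.
have [g gq] := base_change_k (@ks_scheme k T) fp.
have js z : exists y, j y = z.
  have : range j z by rewrite jr.
  by move=> [y _ <-]; exists y.
pose s := pullback_hom (cs_toR Z) p.
have snu z : ~ is_unit (at_pt z s).
  have [y <-] := js z => u.
  have /unit_rmorph := u => /(_ _ (stalk_map j y)); rewrite -at_pt_global -pullback_comp.
  have -> : cs_toR Z \c j = Spec_RP localR \c (q2 \c h).
    by rewrite /cs_toR -mcompA comm !mcompA c2.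
  rewrite pullback_comp_Spec (_ : modI_pi _ p = 0); last first.
    by rewrite -(rmorph0 (modI_pi (local_ideal localR))); apply/modI_pi_eq; rewrite subr0.
  by rewrite !rmorph0; exact: (local_nonunit0 (lrs_local y)).
have nil := scheme_locally_nilpotent (@cs_subP k R T Z) snu.
pose V N := [set z : Z | exists U : opens Z, oset U z /\ res (@sub_full _ U) s ^+ N = 0].
have Vle M N : (M <= N)%N -> V M `<=` V N.
  move=> MN z [U [Uz UM]]; exists U; split=> //.
  by rewrite -(subnK MN) exprD UM mulr0.
have [_ [z _ <-]|N||M VM] := @quasi_compact_exhaustion Z (cs_prod Z) T (cs_imm Z)
    (c \c g) V (cs_immP Z) qT _ _ Vle.
- have [y <-] := js z; exists (q1 (h y)) => //.
  have := congr1 (fun m : mor Zr (cs_prod Z) => m y) comm.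
  by move=> e; apply: etrans _ (esym e); exact: (congr1 c (gq (h y))).
- apply: open_nbhds_cover => z [U [Uz UN]]; exists U; split=> // z' Uz'.
  by exists U.
- by move=> z; have [U [N [Uz UN]]] := nil z; exists N, U.
exists M; apply: sec_germ_eq => z zT.
have : V M z by rewrite VM.
move=> [U [Uz UM]].
rewrite -(@mkgerm_res Z z (ofull Z) U zT Uz (@sub_full _ U)) rmorphXn UM.
by rewrite -(@mkgerm_res Z z (ofull Z) U zT Uz (@sub_full _ U) 0) rmorph0.
Qed.

End Support.

(** * A family on which a parameter has large nilpotency order *)

Lemma field_nil_local (k : fieldType) : nil_local ([set 0] : set k).
Proof.
split=> [|/= /eqP|a /= /eqP a0|a /= ->]; last by exists 1%N; rewrite expr1.
- by split=> [//|a b /= -> ->|a b /= ->]; [exact: addr0|exact: mulr0].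
- by rewrite oner_eq0.
- by exists a^-1; rewrite mulfV.
Qed.

(** The family with ring [B = k[X]/(X^(nM))] over [A = k[T]/(T^M)], as a closed
    subscheme of the product of [Spec A] and [Spec R]. The map [jetB] from [R] to
    [B] sends [t] to an element of order one, hence [A] and [R] generate [B]. *)
Section Family.
Variables (k : fieldType) (n M : nat) (n0 : (0 < n)%N) (M0 : (0 < M)%N).
Variables (R : comAlgType k) (P : set R) (localR : local_with P).
Variables (eps : {rmorphism R -> k}).
Hypotheses (epsC : forall c, eps c%:A = c) (eps0 : forall a, eps a = 0 <-> P a).

Let A := tpoly k M.
Let B := tpoly k (n * M).
Variables (jetB : {rmorphism R -> B}) (jetp : R -> {poly k}).
Hypotheses (jetBE : forall a, jetB a = tpi k (n * M) (jetp a))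
  (jetB_C : forall c, jetB c%:A = tpi k (n * M) c%:P)
  (jetp0 : forall a, (jetp a)`_0 = eps a).
Variables (t : R) (Pt : P t) (t1 : (jetp t)`_1 != 0).

Let nM0 : (0 < n * M)%N. Proof. by rewrite muln_gt0 n0. Qed.

Definition constA : {rmorphism k -> A} := tpi k M \o polyC.

Definition base : kscheme k :=
  @KScheme k (Spec A) (@is_scheme_Spec A) (Spec_map constA).

Let prod := pushout constA (in_alg R).
Let prodl : {rmorphism A -> prod} := pushl constA (in_alg R).
Let prodr : {rmorphism R -> prod} := pushr constA (in_alg R).
Let prodP : is_pushout constA (in_alg R) prodl prodr := pushoutP _ _.

Fact family_hom_ex : exists w : {rmorphism prod -> B},
  (forall a, w (prodl a) = tpow k M n0 a) /\ forall a, w (prodr a) = jetB a.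
Proof.
have [_ _ ex] := prodP; apply: ex => c.
by rewrite [LHS]tpowE comp_polyC [RHS]jetB_C.
Qed.

Definition family_hom : {rmorphism prod -> B} := projT1 (cid family_hom_ex).

Lemma family_homl a : family_hom (prodl a) = tpow k M n0 a.
Proof. by rewrite /family_hom; case: cid => w []. Qed.

Lemma family_homr a : family_hom (prodr a) = jetB a.
Proof. by rewrite /family_hom; case: cid => w []. Qed.

Lemma family_hom_surj b : exists a, family_hom a = b.
Proof.
apply: (@tpoly_gen k (n * M) (jetp t) [set b | exists a, family_hom a = b]) => //.
- by rewrite jetp0; apply/eps0.
- by exists (prodr t); rewrite family_homr jetBE.
- by move=> c; exists (prodr c%:A); rewrite family_homr jetB_C.
- by move=> _ _ [x <-] [y <-]; exists (x + y); rewrite rmorphD.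
- by move=> _ _ [x <-] [y <-]; exists (x * y); rewrite rmorphM.
Qed.

Definition family : closed_sub R base :=
  @ClosedSub k R base (Spec prod) (Spec_map prodl) (Spec_map prodr)
    (Spec_fibre_product prodP) (Spec B) (@is_scheme_Spec B) (Spec_map family_hom)
    (closed_immersion_nil_local (tpoly_nil_local k nM0) family_hom_surj).

Lemma family_toT : cs_toT family = Spec_map (tpow k M n0).
Proof.
apply: esym; apply: Spec_map_comp => a; exact: esym (family_homl a).
Qed.

Lemma family_toR : cs_toR family = Spec_map jetB.
Proof.
apply: esym; apply: Spec_map_comp => a; exact: esym (family_homr a).
Qed.

Lemma family_flat : flat (cs_toT family).
Proof.
rewrite family_toT.
apply: (flat_Spec_map (tpoly_nil_local k M0) (tpoly_nil_local k nM0)).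
exact: tpow_basis.
Qed.

Lemma family_fibre (y : base) : fibre_dim family y n.
Proof.
have lnA := tpoly_nil_local k M0.
have [i [po bas]] :=
  fibre_hom n0 M0 (to_residue_surj lnA (y := y)) (to_residue_eq0 lnA y).
exists (Spec (tpoly k n)), (Spec_map (ttrunc k (leq_nM n M0))), (Spec_map i).
split.
  rewrite family_toT (residue_pointE y); exact: Spec_fibre_product.
pose g : {rmorphism tpoly k n -> global_sections (Spec (tpoly k n))} :=
  @to_sec (tpoly k n) (ofull _).
exists (g \o @tXn k n n).
pose K := residue_field y.
pose idK : {rmorphism K -> K} := idfun.
pose str : {rmorphism K -> global_sections (Spec (tpoly k n))} :=
  global_map (Spec_map i) \o @to_sec K (ofull _).
have strE a : str (idK a) = g (i a) by exact: pullback_Spec_map.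
have lnF := tpoly_nil_local k n0; pose p := nil_local_point lnF.
refine (@is_basis_iso _ _ _ _ i str idK g n _ _ _ _ _ strE bas).
- exact: (@nil_local_to_sec_inj _ _ lnF (ofull _) p I).
- exact: (@nil_local_to_sec_surj _ _ lnF (ofull _) p I).
- by [].
- by move=> x; exists x.
Qed.

Fact section_hom_ex : exists w : {rmorphism prod -> A},
  (forall a, w (prodl a) = a) /\ forall a, w (prodr a) = constA (eps a).
Proof.
have [_ _ ex] := prodP.
apply: (ex _ (idfun : {rmorphism A -> A}) (constA \o eps : {rmorphism R -> A})) => c.
by rewrite /= epsC.
Qed.

(** The reduced scheme is [Spec k], and both its maps to the product, through
    [Spec B] and through [Spec A] embedded over the closed point of [Spec R], are
    given by the constant terms. The base change of [Spec A] to [R/P] is [Spec A]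
    itself, since [R/P] is [k]. *)
Lemma family_support : red_supported localR family.
Proof.
have [w [wl wr]] := section_hom_ex.
have evB := tevalE (k := k) nM0; have evA := tevalE (k := k) M0.
exists (Spec k), (Spec_map (teval k nM0)); split.
  split; first exact: is_scheme_Spec.
  - by apply: reduced_Spec_field => a /eqP a0; exists a^-1; rewrite mulfV.
  - apply: (closed_immersion_nil_local (field_nil_local k)) => c.
    by exists (tpi k _ c%:P); rewrite evB coefC.
  - apply/seteqP; split=> // q _; exists (nil_local_point (field_nil_local k)) => //.
    exact: (nil_local_pt (tpoly_nil_local k nM0)).
pose q2 : {rmorphism modI (local_ideal localR) -> A} :=
  constA \o residue_to_k localR eps0.
exists (Spec A), (idm (Spec A)), (Spec_map q2), (Spec_map w), (Spec_map (teval k M0)).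
split.
- pose g : {rmorphism k -> modI (local_ideal localR)} :=
    modI_pi (local_ideal localR) \o in_alg R.
  have gE : Spec_k R \c Spec_RP localR = Spec_map g.
    by apply: esym; exact: Spec_map_comp.
  have idE : idm (Spec A) = Spec_map (idfun : {rmorphism A -> A}).
    by apply: esym; exact: Spec_map_id.
  rewrite gE [X in is_fibre_product _ _ X]idE; apply: Spec_fibre_product.
  split=> [c|S u v uv _ x|S u v uv].
  + have gc : residue_to_k localR eps0 (g c) = c.
      exact: etrans (residue_to_kE _ _ _) (epsC c).
    exact: esym (congr1 constA gc).
  + exact: uv.
  + exists u; split=> // x.
    apply: etrans (uv (residue_to_k localR eps0 x)) _.
    have gx : g (residue_to_k localR eps0 x) = x by exact: residue_to_kK.
    by rewrite gx.
- change (Spec_map prodl \c Spec_map w = idm (Spec A)).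
  apply: mor_Spec_ext => a; rewrite pullback_comp_Spec pullback_Spec_map.
  by rewrite pullback_id wl.
- change (Spec_map prodr \c Spec_map w = Spec_RP localR \c Spec_map q2).
  rewrite /Spec_RP; apply: mor_Spec_ext => a.
  rewrite 2!pullback_comp_Spec 2!pullback_Spec_map wr; congr (to_sec _ _).
  have e : residue_to_k localR eps0 (modI_pi (local_ideal localR) a) = eps a.
    exact: residue_to_kE.
  by rewrite -e.
- change (Spec_map family_hom \c Spec_map (teval k nM0) =
          Spec_map w \c Spec_map (teval k M0)).
  have [_ uniq _] := prodP.
  have e := uniq k (teval k nM0 \o family_hom) (teval k M0 \o w).
  apply: mor_Spec_ext => x; rewrite 2!pullback_comp_Spec 2!pullback_Spec_map.
  congr (to_sec _ _); apply: e x => a.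
    apply: etrans (congr1 (teval k nM0) (family_homl a)) _.
    apply: etrans _ (esym (congr1 (teval k M0) (wl a))).
    elim/tpi_ind: a => p.
    by rewrite tpowE evB evA coef_comp_poly_Xn // dvdn0 div0n.
  apply: etrans (congr1 (teval k nM0) (family_homr a)) _.
  apply: etrans _ (esym (congr1 (teval k M0) (wr a))).
  by rewrite jetBE evB jetp0 [RHS]evA coefC.
Qed.

Lemma family_in_Hilb : in_Hilb localR n family.
Proof.
split; [exact: family_flat|exact: family_fibre|exact: family_support].
Qed.

Lemma base_noetherian : noetherian_scheme base.
Proof.
exact: nil_local_noetherian_scheme (tpoly_nil_local k M0) (@tpoly_noetherian k M).
Qed.

End Family.

(** * Non-representability *)

Lemma kmor_ext (k : fieldType) (X Y : kscheme k) (f g : kmor X Y) :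
  kmor_mor f = kmor_mor g -> f = g.
Proof.
case: f g => f hf [g hg] /= e; case: g / e hg => hg.
by rewrite (Prop_irrelevance hf hg).
Qed.

Definition kid (k : fieldType) (X : kscheme k) : kmor X X :=
  KMor (mcomp_idr (ks_str X)).

Lemma kcomp_idl (k : fieldType) (X Y : kscheme k) (f : kmor X Y) :
  kcomp (kid Y) f = f.
Proof. by apply: kmor_ext; exact: mcomp_idl. Qed.

Theorem theorem4p8 (k : fieldType) (n r : nat) (R : comAlgType k) (P : set R)
    (n_gt0 : (0 < n)%N) (r_gt0 : (0 < r)%N)
    (localR : local_with P) (noethR : noetherian R)
    (completionR : completion_is_powser P r) :
  ~ Hilb_representable localR n.
Proof.
move=> [H [nH [Phi [PhiH _ Phi_surj Phi_nat]]]].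
have [psi [psi_bij psiC]] := completionR.
pose e : 'I_r := Ordinal r_gt0.
pose eps := augment psi e.
have epsC : forall c, eps c%:A = c by exact: augment_C.
have eps0 : forall a, eps a = 0 <-> P a by exact: augment_eq0.
have [t Pt t1] := exists_parameter localR noethR psi_bij psiC e.
have [N tN] : exists N, pullback_hom (cs_toR (Phi H (kid H))) t ^+ N = 0.
  have [_ _ supp] := PhiH H nH (kid H); have [_ _ qH] := nH.
  exact: (support_nilpotent epsC eps0 qH supp).
(* [M > N] keeps the [N]-th power nonzero, and [M > 1] keeps the linear term of
   [t] in [B] even for [n = 1]. *)
pose M := N.+2; have M0 : (0 < M)%N by []; have M1 : (1 < M)%N by [].
have nM : (M <= n * M)%N by rewrite leq_pmull.
pose jetB := jet psi e (n * M).
have jetBC : forall c, jetB c%:A = tpi k (n * M) c%:P by exact: jet_C.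
have jetp0 a : (jet_poly psi e (n * M) a)`_0 = eps a.
  by apply: augmentE; exact: leq_trans nM.
have tlin : (jet_poly psi e (n * M) t)`_1 != 0 by apply: t1; exact: leq_trans nM.
pose Z := family n_gt0 M0 eps0 (jetE psi e (n * M)) jetBC jetp0 Pt tlin.
have HZ : in_Hilb localR n Z by exact: family_in_Hilb.
have nT := base_noetherian k M0.
have [f [u [v [_ uv _ toR]]]] := Phi_surj _ nT Z HZ.
have := Phi_nat _ _ nT nH f (kid H); rewrite kcomp_idl => -[g [_ gR]].
have ZE : cs_toR Z = cs_toR (Phi H (kid H)) \c (g \c v).
  by rewrite mcompA gR -toR -mcompA uv mcomp_idr.
have : pullback_hom (cs_toR Z) t ^+ N = 0.
  by rewrite ZE pullback_comp -rmorphXn tN rmorph0.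
rewrite family_toR pullback_Spec_map -rmorphXn => jt0.
have lnB := @tpoly_nil_local k (n * M) (ltnW (leq_trans M1 nM)).
have {}jt0 : jetB t ^+ N = 0.
  apply: (@nil_local_to_sec_inj _ _ lnB (ofull _) (nil_local_point lnB) I).
  by apply: etrans jt0 (esym _); exact: rmorph0.
move: jt0; rewrite [jetB t]jetE; apply: tpoly_expr_neq0 => //.
  by rewrite jetp0; apply/eps0.
by apply: leq_trans nM; rewrite /M leqW.
Qed.
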